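(* Let $\widetilde\Sigma\looparrowright\mathbb{E}(\widetilde\kappa,\widetilde\tau)$ be a minimal immersed surface and $\Sigma\looparrowright\mathbb{E}(\kappa,\tau)$ its sister $H$-immersion with phase angle $\theta\in[0,\pi)$. Let $\widetilde\gamma:[0,\ell]\to\widetilde\Sigma$ parametrize a vertical segment such that $\widetilde\gamma'=\widetilde\xi$, and let $\gamma:[0,\ell]\to\Sigma$ be the conjugate (i.e. corresponding) curve in $\Sigma$. We can write the normal of $\widetilde\Sigma$ along $\widetilde\gamma$ as \[\widetilde N_{\widetilde\gamma(t)}=\cos(\vartheta(t))\widetilde E_1(t)+\sin(\vartheta(t))\widetilde E_2(t)\] for some $\vartheta\in\mathcal C^\infty([0,\ell])$, where $\{\widetilde E_1,\widetilde E_2,\widetilde E_3=\widetilde\xi\}$ is the standard positively oriented orthonormal frame of the Cartan model of $\mathbb{E}(\widetilde\kappa,\widetilde\tau)$. Then: (a) The curve $\gamma$ satisfies $\langle\gamma',\xi\rangle=\cos(\theta)$. (b) The projection $\alpha=\pi\circ\gamma$ has geodesic curvature $\kappa_g=2H-\frac{\vartheta'}{\sin(\theta)}$ as a curve of $\mathbb{M}^2(\kappa)$ with respect to $\pi_*N$ as unit normal along $\alpha$. (c) Assume that $\widetilde R\subseteq\widetilde\Sigma$ and $R\subseteq\Sigma$ are conjugate (i.e. corresponding) regions on which $\nu>0$, and such that $\widetilde\gamma\subset\partial\widetilde R$ and $\gamma\subset\partial R$. - If $\vartheta'>0$, then $J\widetilde\gamma'$ (resp. $J\gamma'$) is a unit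 outer conormal to $\widetilde R$ (resp. $R$) along $\widetilde\gamma$ (resp. $\gamma$), $\pi_*N$ points to the interior of $\pi(R)$ along $\alpha$, and $R$ locally approaches $\gamma$ from below. - If $\vartheta'<0$, then $J\widetilde\gamma'$ (resp. $J\gamma'$) is a unit inner conormal to $\widetilde R$ (resp. $R$) along $\widetilde\gamma$ (resp. $\gamma$), $\pi_*N$ points to the exterior of $\pi(R)$ along $\alpha$, and $R$ locally approaches $\gamma$ from above.
   Context: $\mathbb{E}(\kappa,\tau)$ is the unique simply connected oriented Riemannian 3-manifold admitting a Riemannian submersion $\pi:\mathbb{E}(\kappa,\tau)\to\mathbb{M}^2(\kappa)$ onto the complete simply connected surface of constant curvature $\kappa$ whose fibers are the integral curves of a complete unit Killing field $\xi$ satisfying $\overline\nabla_X\xi=\tau\,X\times\xi$ (constant bundle curvature $\tau$). Vertical means tangent to $\xi$; horizontal means orthogonal to $\xi$. Cartan model (a global model if $\kappa\le0$, a local one if $\kappa>0$): $\{(x,y,z)\in\mathbb{R}^3:\lambda_\kappa>0\}$, $\lambda_\kappa=(1+\frac{\kappa}{4}(x^2+y^2))^{-1}$, with metric $\lambda_\kappa^2(dx^2+dy^2)+(dz+\tau\lambda_\kappa(y\,dx-x\,dy))^2$. Here $\pi(x,y,z)=(x,y)$ and the standard frame $E_1=\frac1{\lambda_\kappa}\partial_x-\tau y\,\partial_z$, $E_2=\frac1{\lambda_\kappa}\partial_y+\tau x\,\partial_z$, $E_3=\partial_z=\xi$ is orthonormal and positively oriented. The vertical segment $\widetilde\gamma$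 is considered in this model. For an isometric immersion of an oriented surface $\Sigma$ into $\mathbb{E}(\kappa,\tau)$ with unit normal $N$, the fundamental data are: the shape operator $Av=-\overline\nabla_vN$; the angle function $\nu=\langle N,\xi\rangle$; the tangent part $T=\xi-\nu N$; and the $\frac\pi2$-rotation $J$ given by $Ju=N\times u$. The mean curvature is $H=\frac12\mathrm{trace}(A)$. Let $\mathrm{Rot}_\theta=\cos(\theta)\,\mathrm{id}+\sin(\theta)J$. Let $\kappa,\tau,H,\widetilde\kappa,\widetilde\tau,\widetilde H$ be real with $\kappa-4\tau^2=\widetilde\kappa-4\widetilde\tau^2$ and $\tau+iH=e^{i\theta}(\widetilde\tau+i\widetilde H)$. An $\widetilde H$-immersion into $\mathbb{E}(\widetilde\kappa,\widetilde\tau)$ and an $H$-immersion into $\mathbb{E}(\kappa,\tau)$ of the same simply connected Riemannian surface are sister immersions with phase angle $\theta$ if their fundamental data satisfy $(A,T,J,\nu)=(\mathrm{Rot}_\theta\circ(\widetilde A-\widetilde H\,\mathrm{id})+H\,\mathrm{id},\ \mathrm{Rot}_\theta(\widetilde T),\ \widetilde J,\ \widetilde\nu)$ (Daniel's correspondence). Tildes denote objects in $\mathbb{E}(\widetilde\kappa,\widetilde\tau)$. Here $\widetilde H=0$, so $\kappa=\widetilde\kappa-4\widetilde\tau^2\sin^2\theta$, $\tau=\widetilde\tau\cos\theta$, $H=\widetilde\tau\sin\theta$. Corresponding curves or regions are those given by the same curve or region of the common abstract surface. In (c), ''$R$ locally approaches $\gamma$ from below (resp. above)'' means that, with the vertical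 direction oriented by $\xi$, the directions in $T\Sigma$ orthogonal to $\gamma$ that enter $R$ from $\gamma$ have negative (resp. positive) $\xi$-component, i.e. $R$ lies locally below (resp. above) its boundary curve $\gamma$. The interior/exterior of $\pi(R)$ is understood locally near $\alpha$.
   Formalization: For θ=0 (α constant, 1/sin θ undefined, Jγ' horizontal) part (b) and the π_*N and below/above claims of (c) fail; they are stated for θ>0 only. In (c) R is open with smooth boundary along γ, and the claims are at interior points of γ, as its ends may be corners. *)

(* Defs.v *)
From HB Require Import structures.
From mathcomp Require Import all_boot all_order all_algebra.
From mathcomp Require Import all_classical all_reals all_analysis.

Set Implicit Arguments.
Unset Strict Implicit.
Unset Printing Implicit Defensive.

Import Order.TTheory GRing.Theory Num.Theory.
Import numFieldNormedType.Exports.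

Local Open Scope ring_scope.
Local Open Scope classical_set_scope.

(* [Ck U k f]: f is of class C^k on U, for U open. *)
Fixpoint Ck (R : realType) (V W : normedModType R) (U : set V) (k : nat)
    (f : V -> W) : Prop :=
  match k with
  | 0%N => forall x, U x -> {for x, continuous f}
  | k'.+1 => (forall x, U x -> differentiable f x) /\
             (forall v, Ck U k' (fun x => 'D_v f x))
  end.

Definition smooth_on (R : realType) (V W : normedModType R) (U : set V)
  (f : V -> W) : Prop := forall k, Ck U k f.

(* Riemannian geometry in coordinates.
   Tangent vectors are row vectors of components in the coordinate frame and
   a metric is given by its Gram matrix g x at each point x. *)

Section Coordinates.
Variables (R : realType) (n : nat).
Implicit Types (G : 'M[R]_n) (g : 'rV[R]_n -> 'M[R]_n) (x u v w : 'rV[R]_n).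

Definition basis_vec (i : 'I_n) : 'rV[R]_n := delta_mx 0 i.

Definition inner G u v : R := (u *m G *m v^T) 0 0.

(* Gamma^k_ij u^i v^j, the Christoffel symbols of the second kind being
   obtained from those of the first kind by raising an index. *)
Definition christoffel g x u v : 'rV[R]_n :=
  (\row_k (2^-1 * (inner ('D_u g x) v (basis_vec k)
                   + inner ('D_v g x) u (basis_vec k)
                   - inner ('D_(basis_vec k) g x) u v))) *m invmx (g x).

(* Levi-Civita covariant derivative, in the direction u at the point p, of the
   vector field V along the map f; f is the identity for vector fields on an
   open subset of R^n, and for curves p is the time and u = 1. *)
Definition nabla (P : normedModType R) g (f V : P -> 'rV[R]_n) (p u : P) :
  'rV[R]_n := 'D_u V p + christoffel g (f p) ('D_u f p) (V p).

End Coordinates.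

(* K = <R(e_1,e_2)e_2, e_1> / det g *)
Definition gauss_curvature (R : realType) (g : 'rV[R]_2 -> 'M[R]_2)
    (x : 'rV[R]_2) : R :=
  let e1 := basis_vec R (0 : 'I_2) in
  let e2 := basis_vec R (1 : 'I_2) in
  let D u (V : 'rV[R]_2 -> 'rV[R]_2) := fun y => nabla g idfun V y u in
  inner (g x) (D e1 (D e2 (cst e2)) x - D e2 (D e1 (cst e2)) x) e1
  / \det (g x).

(* The vector product of the oriented metric G, i.e. the vector with
   <u x v, w> = vol_G(u, v, w) = sqrt(det G) det(u, v, w) for all w. *)
Definition cross (R : realType) (G : 'M[R]_3) (u v : 'rV[R]_3) : 'rV[R]_3 :=
  Num.sqrt (\det G) *:
  ((\row_k \det (\matrix_(i < 3) nth 0 [:: u; v; basis_vec R k] i))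
   *m invmx G).

(* k is the geodesic curvature at time t, with respect to the unit normal nv,
   of the curve a, which is not assumed to be parametrized by arc length. *)
Definition has_geodesic_curvature (R : realType) (g : 'rV[R]_2 -> 'M[R]_2)
    (a : R -> 'rV[R]_2) (t : R) (nv : 'rV[R]_2) (k : R) : Prop :=
  let G := g (a t) in
  let a' := derive1 a in
  [/\ a' t != 0, inner G nv nv = 1, inner G nv (a' t) = 0 &
      k = inner G (nabla g a a' t 1) nv / inner G (a' t) (a' t)].

(* Fundamental data of the immersion f of an open subset of R^2 into an open
   subset of R^3 with metric g and distinguished vector field xi *)

Section FundamentalData.
Variables (R : realType) (g : 'rV[R]_3 -> 'M[R]_3).
Variables (xi : 'rV[R]_3 -> 'rV[R]_3) (f : 'rV[R]_2 -> 'rV[R]_3).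
Implicit Types (x v : 'rV[R]_2) (w : 'rV[R]_3).

Definition push x v : 'rV[R]_3 := 'D_v f x.

(* The unit normal for which (f_* e_1, f_* e_2, N) is positively oriented *)
Definition unit_normal x : 'rV[R]_3 :=
  let w := cross (g (f x)) (push x (basis_vec R 0)) (push x (basis_vec R 1)) in
  (Num.sqrt (inner (g (f x)) w w))^-1 *: w.

Definition first_form x : 'M[R]_2 :=
  \matrix_(i, j) inner (g (f x)) (push x (basis_vec R i))
                                 (push x (basis_vec R j)).

(* The components, in the basis f_* e_i of the tangent plane, of the orthogonal
   projection of w onto that plane *)
Definition tangent_part x w : 'rV[R]_2 :=
  (\row_j inner (g (f x)) w (push x (basis_vec R j))) *m invmx (first_form x).

Definition shape_operator x v : 'rV[R]_2 :=
  tangent_part x (- nabla g f unit_normal x v).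

Definition angle x : R := inner (g (f x)) (unit_normal x) (xi (f x)).

Definition xi_tangent x : 'rV[R]_2 :=
  tangent_part x (xi (f x) - angle x *: unit_normal x).

Definition rotJ x v : 'rV[R]_2 :=
  tangent_part x (cross (g (f x)) (unit_normal x) (push x v)).

Definition mean_curvature x : R :=
  2^-1 * \tr (\matrix_(i < 2) shape_operator x (basis_vec R i)).

Definition Rot (theta : R) x v : 'rV[R]_2 :=
  cos theta *: v + sin theta *: rotJ x v.

End FundamentalData.

Record chart (R : realType) (n : nat) (X : topologicalType) := Chart {
  cdom : set X;
  cfun :> X -> 'rV[R]_n;
  cinv : 'rV[R]_n -> X;
  cdom_open : open cdom;
  ccod_open : open (cfun @` cdom);
  cfunK : forall p, cdom p -> cinv (cfun p) = p;
  cfun_cont : forall p, cdom p -> {for p, continuous cfun};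
  cinv_cont : forall x, (cfun @` cdom) x -> {for x, continuous cinv} }.

(* Domain and expression in the charts c and d of a map F *)
Definition ldom (R : realType) (n m : nat) (X Y : topologicalType)
    (c : chart R n X) (d : chart R m Y) (F : X -> Y) : set 'rV[R]_n :=
  c @` (cdom c `&` F @^-1` cdom d).

Definition lrep (R : realType) (n m : nat) (X Y : topologicalType)
    (c : chart R n X) (d : chart R m Y) (F : X -> Y) (x : 'rV[R]_n) :
  'rV[R]_m := d (F (cinv c x)).

(* The atlas need not be maximal. *)
Record riemannian (R : realType) (n : nat) := Riemannian {
  pts :> topologicalType;
  atlas : set (chart R n pts);
  gram : chart R n pts -> 'rV[R]_n -> 'M[R]_n;
  pts_hausdorff : hausdorff_space pts;
  pts_second_countable : @second_countable pts;
  atlas_cover : forall p, exists2 c, atlas c & cdom c p;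
  atlas_smooth : forall c d, atlas c -> atlas d ->
    smooth_on (ldom c d id) (lrep c d id);
  gram_smooth : forall c, atlas c -> smooth_on (c @` cdom c) (gram c);
  gram_sym : forall c p, atlas c -> cdom c p ->
    (gram c (c p))^T = gram c (c p);
  gram_pos : forall c p u, atlas c -> cdom c p ->
    u != 0 -> 0 < inner (gram c (c p)) u u;
  gram_change : forall c d p u v, atlas c -> atlas d -> cdom c p -> cdom d p ->
    inner (gram d (d p)) ('D_u (lrep c d id) (c p)) ('D_v (lrep c d id) (c p))
    = inner (gram c (c p)) u v }.

Section Manifolds.
Variables (R : realType) (n : nat).
Implicit Types (M : riemannian R n).

Definition oriented M : Prop :=
  forall c d p, atlas c -> atlas d -> cdom c p -> cdom d p ->
    0 < \det ('J (lrep c d (@id M)) (c p)).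

Definition simply_connected (X : topologicalType) : Prop :=
  let I := [set s : R | 0 <= s <= 1] in
  [/\ exists p : X, True,
      forall p q : X, exists f : R -> X,
        [/\ {within I, continuous f}, f 0 = p & f 1 = q] &
      forall f : R -> X, {within I, continuous f} -> f 0 = f 1 ->
        exists h : R * R -> X,
          [/\ {within I `*` I, continuous h},
              forall s, I s -> h (s, 0) = f s /\ h (s, 1) = f 0 &
              forall t, I t -> h (0, t) = f 0 /\ h (1, t) = f 0]].

Definition smooth_map (m : nat) M (N : riemannian R m) (F : M -> N) : Prop :=
  continuous F /\
  forall (c : chart R n M) (d : chart R m N), atlas c -> atlas d ->
    smooth_on (ldom c d F) (lrep c d F).

Definition smooth_curve M (I : set R) (s : R -> M) : Prop :=
  (forall t, I t -> {for t, continuous s}) /\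
  forall c, atlas c -> smooth_on (I `&` s @^-1` cdom c) (c \o s).

Definition velocity M (c : chart R n M) (s : R -> M) (t : R) : 'rV[R]_n :=
  derive1 (c \o s) t.

Definition geodesic M (s : R -> M) : Prop :=
  smooth_curve setT s /\
  forall c t, atlas c -> cdom c (s t) ->
    nabla (gram c) (c \o s) (velocity c s) t 1 = 0.

Definition geodesically_complete M : Prop :=
  forall (c : chart R n M) p v, atlas c -> cdom c p ->
    exists s : R -> M, [/\ geodesic s, s 0 = p & velocity c s 0 = v].

(* The vector v at p is given by its components in the chart c. *)
Definition enters M (D : set M) (p : M) (c : chart R n M) (v : 'rV[R]_n) :
  Prop :=
  forall s : R -> M, s 0 = p -> {for 0, continuous s} ->
    is_derive (0 : R) 1 (c \o s) v -> \forall t \near 0^'+, D (s t).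

Definition points_inside M (D : set M) (p : M) (c : chart R n M)
    (v : 'rV[R]_n) : Prop :=
  enters D° p c v /\ enters (~` closure D) p c (- v).

Definition points_outside M (D : set M) (p : M) (c : chart R n M)
    (v : 'rV[R]_n) : Prop := points_inside D p c (- v).

End Manifolds.

(* M^2(kappa) *)
Definition space_form (R : realType) (kappa : R) (M : riemannian R 2) : Prop :=
  [/\ simply_connected R M, geodesically_complete M &
      forall (c : chart R 2 M) p, atlas c -> cdom c p ->
        gauss_curvature (gram c) (c p) = kappa].

(* E(kappa, tau). The field xi is given by its components in each chart. *)

Definition integral_curve (R : realType) (n : nat) (M : riemannian R n)
    (X : chart R n M -> 'rV[R]_n -> 'rV[R]_n) (s : R -> M) : Prop :=
  continuous s /\
  forall c t, atlas c -> cdom c (s t) ->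
    is_derive t 1 (c \o s) (X c (c (s t))).

Record Ekt (R : realType) (kappa tau : R) := EktSpace {
  total_space :> riemannian R 3;
  base_space : riemannian R 2;
  bundle_proj : total_space -> base_space;
  xi : chart R 3 total_space -> 'rV[R]_3 -> 'rV[R]_3;
  total_oriented : oriented total_space;
  total_simply_connected : simply_connected R total_space;
  base_space_form : space_form kappa base_space;
  proj_smooth : smooth_map bundle_proj;
  proj_surj : forall b, exists p, bundle_proj p = b;
  proj_submersion : forall d e p, atlas d -> atlas e ->
    cdom d p -> cdom e (bundle_proj p) ->
    forall w, exists u, 'D_u (lrep d e bundle_proj) (d p) = w;
  proj_riemannian : forall d e p u, atlas d -> atlas e ->
    cdom d p -> cdom e (bundle_proj p) ->
    (forall k, 'D_k (lrep d e bundle_proj) (d p) = 0 ->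
       inner (gram d (d p)) u k = 0) ->
    inner (gram e (e (bundle_proj p))) ('D_u (lrep d e bundle_proj) (d p))
                                       ('D_u (lrep d e bundle_proj) (d p))
    = inner (gram d (d p)) u u;
  xi_smooth : forall d, atlas d -> smooth_on (d @` cdom d) (xi d);
  xi_change : forall d d' p, atlas d -> atlas d' -> cdom d p -> cdom d' p ->
    'D_(xi d (d p)) (lrep d d' id) (d p) = xi d' (d' p);
  xi_unit : forall d p, atlas d -> cdom d p ->
    inner (gram d (d p)) (xi d (d p)) (xi d (d p)) = 1;
  xi_killing : forall d p u v, atlas d -> cdom d p ->
    inner (gram d (d p)) (nabla (gram d) idfun (xi d) (d p) u) v
    + inner (gram d (d p)) u (nabla (gram d) idfun (xi d) (d p) v) = 0;
  xi_bundle_curvature : forall d p u, atlas d -> cdom d p ->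
    nabla (gram d) idfun (xi d) (d p) u
    = tau *: cross (gram d (d p)) u (xi d (d p));
  (* xi is complete and the fibers are its integral curves *)
  xi_complete : forall p, exists s : R -> total_space,
    [/\ integral_curve xi s, s 0 = p &
        forall q, bundle_proj q = bundle_proj p <-> exists t, s t = q] }.

Section Cartan.
Variables (R : realType) (kappa tau : R).
Implicit Types x : 'rV[R]_3.

Definition lambda_inv x : R := 1 + kappa / 4 * (x 0 0 ^+ 2 + x 0 1 ^+ 2).

Definition row3 (a b c : R) : 'rV[R]_3 := \row_i nth 0 [:: a; b; c] i.

Definition E1 x := row3 (lambda_inv x) 0 (- (tau * x 0 1)).
Definition E2 x := row3 0 (lambda_inv x) (tau * x 0 0).
Definition E3 := row3 0 0 1.

(* Gram matrix of lambda^2 (dx^2 + dy^2) + (dz + tau lambda (y dx - x dy))^2 *)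
Definition cartan_gram x : 'M[R]_3 :=
  let lam := (lambda_inv x)^-1 in
  let dx := row3 1 0 0 in
  let dy := row3 0 1 0 in
  let eta := row3 (tau * lam * x 0 1) (- (tau * lam * x 0 0)) 1 in
  lam ^+ 2 *: (dx^T *m dx + dy^T *m dy) + eta^T *m eta.

(* In such a chart the fibers are the lines where x and y are constant, so that
   (x, y) are local coordinates of the base. *)
Definition cartan_chart (E : Ekt kappa tau) (d : chart R 3 E) : Prop :=
  atlas d /\
  forall p, cdom d p ->
    [/\ 0 < lambda_inv (d p), gram d (d p) = cartan_gram (d p) &
        xi d (d p) = E3].

End Cartan.

Section Surfaces.
Variables (R : realType) (S : riemannian R 2).

Definition isometric_immersion (kappa tau : R) (E : Ekt kappa tau)
    (phi : S -> E) : Prop :=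
  smooth_map phi /\
  forall c d p u v, atlas c -> atlas d -> cdom c p -> cdom d (phi p) ->
    inner (gram d (d (phi p))) (push (lrep c d phi) (c p) u)
                               (push (lrep c d phi) (c p) v)
    = inner (gram c (c p)) u v.

Definition has_mean_curvature (kappa tau : R) (E : Ekt kappa tau)
    (phi : S -> E) (H : R) : Prop :=
  forall c d p, atlas c -> atlas d -> cdom c p -> cdom d (phi p) ->
    mean_curvature (gram d) (lrep c d phi) (c p) = H.

(* The second and third conditions are the real and imaginary parts of
   tau + i H = e^(i theta) (tau' + i H'). *)
Definition sister_immersions (theta kappa' tau' H' kappa tau H : R)
    (E' : Ekt kappa' tau') (phi' : S -> E')
    (E : Ekt kappa tau) (phi : S -> E) : Prop :=
  [/\ [/\ oriented S & simply_connected R S],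
      [/\ kappa - 4 * tau ^+ 2 = kappa' - 4 * tau' ^+ 2,
          tau = cos theta * tau' - sin theta * H' &
          H = sin theta * tau' + cos theta * H'],
      isometric_immersion phi' /\ has_mean_curvature phi' H',
      isometric_immersion phi /\ has_mean_curvature phi H &
      forall c d' d p, atlas c -> atlas d' -> atlas d ->
        cdom c p -> cdom d' (phi' p) -> cdom d (phi p) ->
        let f' := lrep c d' phi' in
        let f := lrep c d phi in
        let x := c p in
        [/\ forall v, shape_operator (gram d) f x v
              = Rot (gram d') f' theta x
                  (shape_operator (gram d') f' x v - H' *: v)
                + H *: v,
            xi_tangent (gram d) (xi d) f x
              = Rot (gram d') f' theta x (xi_tangent (gram d') (xi d') f' x),
            forall v, rotJ (gram d) f x v = rotJ (gram d') f' x v &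
            angle (gram d) (xi d) f x = angle (gram d') (xi d') f' x]].

Definition positive_angle_on (kappa tau : R) (E : Ekt kappa tau)
    (phi : S -> E) (D : set S) : Prop :=
  forall c d p, atlas c -> atlas d -> D p -> cdom c p -> cdom d (phi p) ->
    0 < angle (gram d) (xi d) (lrep c d phi) (c p).

(* Near s t, the set D is a domain with smooth boundary, given by a defining
   function h with nonzero differential, and the curve s lies on the boundary.
 *)
Definition boundary_arc (D : set S) (s : R -> S) (t : R) : Prop :=
  exists (c : chart R 2 S) (U : set 'rV[R]_2) (h : 'rV[R]_2 -> R),
    [/\ atlas c, cdom c (s t), open_nbhs (c (s t)) U & U `<=` c @` cdom c] /\
    [/\ smooth_on U h, exists v, 'D_v h (c (s t)) != 0,
        forall x, U x -> (D (cinv c x) <-> 0 < h x) &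
        \forall r \near t, h (c (s r)) = 0].

(* A region whose boundary contains s([0, l]); the end points of s may be
   corners of D. *)
Definition region_along (D : set S) (s : R -> S) (l : R) : Prop :=
  [/\ open D, connected D & forall t, 0 < t < l -> boundary_arc D s t].

Definition unit_conormal (c : chart R 2 S) (s : R -> S) (t : R)
    (v : 'rV[R]_2) : Prop :=
  let G := gram c (c (s t)) in
  inner G v v = 1 /\ inner G v (velocity c s t) = 0.

Definition outer_conormal (D : set S) (c : chart R 2 S) (s : R -> S) (t : R)
    (v : 'rV[R]_2) : Prop :=
  unit_conormal c s t v /\ points_outside D (s t) c v.

Definition inner_conormal (D : set S) (c : chart R 2 S) (s : R -> S) (t : R)
    (v : 'rV[R]_2) : Prop :=
  unit_conormal c s t v /\ points_inside D (s t) c v.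

Variables (kappa tau : R) (E : Ekt kappa tau) (phi : S -> E).

(* pi_* N at the point p, in the chart e of the base *)
Definition proj_normal (c : chart R 2 S) (d : chart R 3 E)
    (e : chart R 2 (base_space E)) (p : S) : 'rV[R]_2 :=
  'D_(unit_normal (gram d) (lrep c d phi) (c p))
    (lrep d e (@bundle_proj R kappa tau E)) (d (phi p)).

(* Interior and exterior of the projection of D are local near p: only the part
   of D in small neighborhoods of p is projected. *)
Definition points_inside_proj (D : set S) (p : S)
    (e : chart R 2 (base_space E)) (w : 'rV[R]_2) : Prop :=
  exists2 V, open_nbhs p V & forall W, open_nbhs p W -> W `<=` V ->
    points_inside ((fun q => bundle_proj (phi q)) @` (D `&` W))
      (bundle_proj (phi p)) e w.

Definition points_outside_proj (D : set S) (p : S)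
    (e : chart R 2 (base_space E)) (w : 'rV[R]_2) : Prop :=
  exists2 V, open_nbhs p V & forall W, open_nbhs p W -> W `<=` V ->
    points_outside ((fun q => bundle_proj (phi q)) @` (D `&` W))
      (bundle_proj (phi p)) e w.

Definition xi_component (c : chart R 2 S) (d : chart R 3 E) (p : S)
    (v : 'rV[R]_2) : R :=
  inner (gram d (d (phi p))) (push (lrep c d phi) (c p) v) (xi d (d (phi p))).

Definition approaches_from_below (D : set S) (c : chart R 2 S)
    (d : chart R 3 E) (s : R -> S) (t : R) : Prop :=
  forall v, inner (gram c (c (s t))) v (velocity c s t) = 0 ->
    enters D (s t) c v -> xi_component c d (s t) v < 0.

Definition approaches_from_above (D : set S) (c : chart R 2 S)
    (d : chart R 3 E) (s : R -> S) (t : R) : Prop :=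
  forall v, inner (gram c (c (s t))) v (velocity c s t) = 0 ->
    enters D (s t) c v -> 0 < xi_component c d (s t) v.

(* s is smooth on some open interval containing [0, l], where s' = xi. *)
Definition vertical_segment (s : R -> S) (l : R) : Prop :=
  [/\ 0 < l,
      exists2 r : R, 0 < r & smooth_curve [set t | - r < t < l + r] s &
      forall (d : chart R 3 E) (t : R), atlas d -> 0 <= t <= l ->
        cdom d (phi (s t)) ->
        velocity d (phi \o s) t = xi d (d (phi (s t)))].

(* a is a smooth function on [0, l] such that, in the Cartan chart d0,
   N = cos(a) E_1 + sin(a) E_2 along the curve s. *)
Definition normal_angle (d0 : chart R 3 E) (s : R -> S) (l : R) (a : R -> R) :
  Prop :=
  (exists2 r : R, 0 < r & smooth_on [set t : R | - r < t < l + r] a) /\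
  forall (c : chart R 2 S) (t : R), atlas c -> 0 <= t <= l -> cdom c (s t) ->
    let q := d0 (phi (s t)) in
    unit_normal (gram d0) (lrep c d0 phi) (c (s t))
    = cos (a t) *: E1 kappa tau q + sin (a t) *: E2 kappa tau q.

End Surfaces.

(* Main.v *)
Require Import Defs.
From HB Require Import structures.
From mathcomp Require Import all_boot all_order all_algebra.
From mathcomp Require Import all_classical all_reals all_analysis.
From mathcomp Require Import ring lra.

Import Order.TTheory GRing.Theory Num.Theory.
Import numFieldNormedType.Exports.

Local Open Scope ring_scope.
Local Open Scope classical_set_scope.

Set Implicit Arguments.
Unset Strict Implicit.
Unset Printing Implicit Defensive.

(** In charts, let f' and f be the two immersions, N' and N their unit normals,
    nu' = nu the angle function, X the velocity of the segment, so that
    f'_* X = xi', and J the common rotation of the abstract surface.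

    Along the segment nu' = <N', f'_* X> = 0 and T' = X. Hence nu = 0 and
    T = cos theta X + sin theta J X is a tangent vector with f_* T = xi
    ([push_kernel]). Its inner products with X and J X are those of f_* X and
    f_* J X with xi; the first one is (a).

    For (b), the fields E_1 and E_2 of the Cartan model are invariant along the
    fibers, so their derivatives in the direction of the fibers are those of xi
    in their own directions, which the bundle curvature gives. A horizontal unit
    field at angle vth with the frame then turns about the fiber with speed
    vth' - tau' ([nabla_horizontal_field]). For N' this says <A' X, X> = 0 and
    <A' X, J X> = vth' - tau', and by the sister relation
    <A X, X> = 2 H - sin theta vth' ([sister_shape]), the normal curvature of
    gam. Under the Riemannian submersion pi the curvature of a curve changes by
    the second fundamental form of pi. Differentiating the identity
    <pi_* u, pi_* v> = <u, v> - <u, xi> <v, xi> determines this symmetric form,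
    as in the Koszul formula ([submersion_curve]). What is left is to divide by
    the square sin theta ^ 2 of the speed of alpha.

    For (c), the symmetry of the second fundamental form and the bundle
    curvature give the derivatives 0 and - vth' of nu in the directions X and
    J X. Since nu vanishes on the curve and is positive on the region, the
    derivative in the direction J X of a defining function h of the region has
    the sign of - vth' ([region_function]). This decides on which side of the
    curve the region lies, and <f_* J X, xi> = sin theta > 0 turns it into
    above or below. The map F = pi o f satisfies F_* T = - nu pi_* N, so it has
    rank one on the curve, and it folds there: on the part of a level curve
    of <F, alpha'> that lies in the region, <F, pi_* N> is monotone in h because
    nu does not change sign ([rising_near]). By the inverse function theorem for
    the pair (<F, alpha'>, h) the image of the region is, near alpha, all of one
    side of alpha ([fold_image]).

    The function vth exists because the normal is horizontal along the segment:
    it is a primitive of the angular velocity of the normal in the Cartan frame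
    ([angle_lift]). *)

(** * Directional derivatives *)

Section ChainRule.
Variable R : realType.

Lemma derive_comp (U V W : normedModType R) (f : V -> W) (g : U -> V) x v :
  differentiable g x -> differentiable f (g x) ->
  'D_v (fun y => f (g y)) x = 'D_('D_v g x) f (g x).
Proof.
move=> dg df; rewrite deriveE; last exact: differentiable_comp.
by rewrite diff_comp // !deriveE.
Qed.

Lemma deriveD_dir (V W : normedModType R) (f : V -> W) x u v :
  differentiable f x -> 'D_(u + v) f x = 'D_u f x + 'D_v f x.
Proof. by move=> df; rewrite !deriveE // linearD. Qed.

Lemma deriveZ_dir (V W : normedModType R) (f : V -> W) x k v :
  differentiable f x -> 'D_(k *: v) f x = k *: 'D_v f x.
Proof. by move=> df; rewrite !deriveE // linearZ. Qed.

Lemma deriveN_dir (V W : normedModType R) (f : V -> W) x v :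
  differentiable f x -> 'D_(- v) f x = - 'D_v f x.
Proof. by move=> df; rewrite !deriveE // linearN. Qed.

Lemma row_sum_basis n (v : 'rV[R]_n) : v = \sum_i v 0 i *: basis_vec R i.
Proof. exact: row_sum_delta. Qed.

Lemma derive_basis n (W : normedModType R) (f : 'rV[R]_n -> W) x v :
  differentiable f x ->
  'D_v f x = \sum_i v 0 i *: 'D_(basis_vec R i) f x.
Proof.
move=> df; rewrite [in LHS](row_sum_basis v) deriveE // linear_sum.
by apply: eq_bigr => i _; rewrite linearZ /= deriveE.
Qed.

Lemma near_eq_differentiable (V W : normedModType R) (f g : V -> W) (x : V) :
  {near x, f =1 g} -> differentiable f x -> differentiable g x.
Proof.
move=> fg df.
have gx : f x = g x := nbhs_singleton fg.
have /diff_locallyP[cf fE] := df.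
have gE : g \o shift x = cst (g x) + 'd f x +o_ (0 : V) id.
  apply/eqaddoP => _/posnumP[e].
  have /eqaddoP/(_ _ (gt0 e)) := fE.
  apply: filter_app.
  have : \forall y \near (0 : V), f (y + x) = g (y + x).
    by move: fg; rewrite (near_shift (0 : V)) /= subr0.
  apply: filterS => y yE; rewrite /= !fctE /=.
  by rewrite gx yE.
apply/diff_locallyP.
by rewrite (diff_unique cf gE).
Qed.

Lemma derive_ext (V W : normedModType R) (U : set V) (f g : V -> W) v :
  open U -> (forall x, U x -> f x = g x) ->
  forall x, U x -> 'D_v f x = 'D_v g x.
Proof.
move=> oU fg x Ux; apply: near_eq_derive.
by near=> y; apply: fg; near: y; exact: open_nbhs_nbhs.
Unshelve. all: by end_near. Qed.

Lemma differentiable_mxcoord (V : normedModType R) m n (A : V -> 'M[R]_(m, n)) i j x :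
  differentiable A x -> differentiable (fun y => A y i j) x.
Proof.
move=> dA; apply: (@differentiable_comp _ _ _ _ A (fun M : 'M[R]_(m, n) => M i j)) => //.
exact: differentiable_coord.
Qed.

Lemma derive_coord (V : normedModType R) m n (A : V -> 'M[R]_(m, n)) i j x v :
  differentiable A x -> 'D_v (fun y => A y i j) x = ('D_v A x) i j.
Proof. by move=> dA; rewrite derive_mx ?mxE //; exact: diff_derivable. Qed.

End ChainRule.

(** * Maps of class C^k *)

Section CkTheory.
Variable R : realType.

Lemma Ck_sub (V W : normedModType R) (U U' : set V) k (f : V -> W) :
  U' `<=` U -> Ck U k f -> Ck U' k f.
Proof.
move=> sU; elim: k f => [|k IH] f /=; first by move=> h x /sU /h.
by move=> [df Df]; split=> [x /sU /df //|v]; exact: IH.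
Qed.

Lemma CkS (V W : normedModType R) (U : set V) k (f : V -> W) :
  Ck U k.+1 f <-> (forall x, U x -> differentiable f x) /\
                  (forall v, Ck U k (fun x => 'D_v f x)).
Proof. by []. Qed.

Lemma CkW (V W : normedModType R) (U : set V) k (f : V -> W) :
  Ck U k.+1 f -> Ck U k f.
Proof.
elim: k f => [|k IH] f [df Df]; first by move=> x /df /differentiable_continuous.
by split=> // v; exact: IH.
Qed.

Lemma Ck_ext (V W : normedModType R) (U : set V) k (f g : V -> W) :
  open U -> (forall x, U x -> f x = g x) -> Ck U k f -> Ck U k g.
Proof.
move=> oU; elim: k f g => [|k IH] f g fg.
  move=> cf x Ux; rewrite /prop_for /continuous_at -(fg _ Ux).
  apply: cvg_trans (cf _ Ux); apply: near_eq_cvg.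
  by near=> y; apply: fg; near: y; exact: open_nbhs_nbhs.
move=> [df Df]; split=> [x Ux|v].
  apply: near_eq_differentiable (df _ Ux).
  by near=> y; apply: fg; near: y; exact: open_nbhs_nbhs.
by apply: IH (Df v) => x Ux; exact: derive_ext Ux.
Unshelve. all: by end_near. Qed.

Lemma Ck_cst (V W : normedModType R) (U : set V) k (a : W) :
  Ck U k (fun _ : V => a).
Proof.
elim: k a => [|k IH] a; first by move=> x _; exact: cst_continuous.
split=> [x _|v]; first exact: differentiable_cst.
have -> : (fun x => 'D_v (fun _ : V => a) x) = (fun _ => 0).
  by apply/funext => x; rewrite derive_cst.
exact: IH.
Qed.

Lemma Ck_linear (V W : normedModType R) (U : set V) k (f : {linear V -> W}) :
  continuous f -> Ck U k f.
Proof.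
move=> cf; case: k => [x _|k]; first exact: cf.
split=> [x _|v]; first exact: linear_differentiable.
have -> : (fun x => 'D_v f x) = (fun _ => f v); last exact: Ck_cst.
by apply/funext => x; rewrite deriveE ?diff_lin//; exact: linear_differentiable.
Qed.

Lemma CkD (V W : normedModType R) (U : set V) k (f g : V -> W) :
  open U -> Ck U k f -> Ck U k g -> Ck U k (fun x => f x + g x).
Proof.
move=> oU; elim: k f g => [|k IH] f g.
  by move=> cf cg x Ux; apply: cvgD; [exact: cf|exact: cg].
move=> /CkS[df Df] /CkS[dg Dg]; apply/CkS; split=> [x Ux|v].
  by apply: differentiableD; [exact: df|exact: dg].
apply: (@Ck_ext _ _ _ _ (fun x => 'D_v f x + 'D_v g x)) => //.
  by move=> x Ux; rewrite deriveD //; apply: diff_derivable; [exact: df|exact: dg].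
exact: IH.
Qed.

(** Scaling as a function of two arguments, which carries the structure of a
    bilinear map. *)
Definition scale_op (W : normedModType R) (a : R) (w : W) : W := a *: w.

Lemma scale_op_is_bilinear (W : normedModType R) :
  bilinear_for
    (GRing.Scale.Law.clone _ _ *:%R _) (GRing.Scale.Law.clone _ _ *:%R _)
    (@scale_op W).
Proof.
split=> [u'|u] a x y /=; first by rewrite /scale_op scalerDl scalerA.
by rewrite /scale_op scalerDr !scalerA mulrC.
Qed.

HB.instance Definition _ (W : normedModType R) :=
  bilinear_isBilinear.Build R R W W _ _ (@scale_op W) (scale_op_is_bilinear W).

Lemma is_diff_scale (V W : normedModType R) (k : V -> R) (f : V -> W) x :
  differentiable k x -> differentiable f x ->
  is_diff x (fun y => k y *: f y) (fun v => k x *: 'd f x v + 'd k x v *: f x).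
Proof.
move=> dk df.
have cs : continuous (fun p : R * W => scale_op p.1 p.2).
  by move=> p; exact: scale_continuous.
have dkf : differentiable (fun y => (k y, f y)) x by exact: differentiable_pair.
have db := differentiable_bilin (k x, f x) cs.
apply: DiffDef.
  exact: (differentiable_comp dkf db).
rewrite (_ : (fun y => k y *: f y) =
  (fun p : R * W => scale_op p.1 p.2) \o (fun y => (k y, f y))) //.
rewrite diff_comp // diff_bilin // diff_pair //.
Qed.

Lemma differentiable_scale (V W : normedModType R) (k : V -> R) (f : V -> W) x :
  differentiable k x -> differentiable f x ->
  differentiable (fun y => k y *: f y) x.
Proof. by move=> dk df; have [] := is_diff_scale dk df. Qed.

Lemma derive_scale (V W : normedModType R) (k : V -> R) (f : V -> W) x v :
  differentiable k x -> differentiable f x ->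
  'D_v (fun y => k y *: f y) x = k x *: 'D_v f x + 'D_v k x *: f x.
Proof.
move=> dk df; have [dkf dE] := is_diff_scale dk df.
by rewrite !deriveE // dE.
Qed.

Lemma CkZ (V W : normedModType R) (U : set V) k (a : V -> R) (f : V -> W) :
  open U -> Ck U k a -> Ck U k f -> Ck U k (fun x => a x *: f x).
Proof.
move=> oU; elim: k a f => [|k IH] a f.
  by move=> ca cf x Ux; apply: cvgZ; [exact: ca|exact: cf].
move=> Ha Hf; have /CkS[da Da] := Ha; have /CkS[df Df] := Hf.
apply/CkS; split=> [x Ux|v].
  by apply: differentiable_scale; [exact: da|exact: df].
apply: (@Ck_ext _ _ _ _ (fun x => a x *: 'D_v f x + 'D_v a x *: f x)) => //.
  by move=> x Ux; rewrite derive_scale //; [exact: da|exact: df].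
by apply: CkD => //; apply: IH => //; apply: CkW.
Qed.

Lemma Ck_sum (V W : normedModType R) (U : set V) k (I : Type) (r : seq I)
    (P : pred I) (F : I -> V -> W) :
  open U -> (forall i, Ck U k (F i)) ->
  Ck U k (fun x => \sum_(i <- r | P i) F i x).
Proof.
move=> oU HF; elim: r => [|i r IH].
  under eq_fun do rewrite big_nil; exact: Ck_cst.
under eq_fun do rewrite big_cons; case: (P i) => //; exact: CkD.
Qed.

Lemma Ck_coord (V : normedModType R) (U : set V) m n k (f : V -> 'M[R]_(m, n)) i j :
  open U -> Ck U k f -> Ck U k (fun x => f x i j).
Proof.
move=> oU; elim: k f => [|k IH] f.
  move=> cf x Ux; apply: (@continuous_comp _ _ _ f (fun M : 'M[R]_(m, n) => M i j)).
    exact: cf.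
  exact: coord_continuous.
move=> /CkS[df Df]; apply/CkS; split=> [x Ux|v].
  apply: (@differentiable_comp _ _ _ _ f (fun M : 'M[R]_(m, n) => M i j)).
    exact: df.
  exact: differentiable_coord.
apply: (@Ck_ext _ _ _ _ (fun x => ('D_v f x) i j)) => //; last exact: IH.
by move=> x Ux; rewrite derive_mx ?mxE //; apply: diff_derivable; exact: df.
Qed.

(** By the chain rule the derivative of f (g x) is a sum of partial derivatives
    of f at g x, with the coordinates of the derivative of g as coefficients;
    these are again compositions and products of maps of class C^k. *)
Lemma Ck_comp n (V W : normedModType R) (U : set V) (U' : set 'rV[R]_n) k
    (f : 'rV[R]_n -> W) (g : V -> 'rV[R]_n) :
  open U -> (forall x, U x -> U' (g x)) ->
  Ck U' k f -> Ck U k g -> Ck U k (fun x => f (g x)).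
Proof.
move=> oU gU; elim: k f => [|k IH] f.
  move=> cf cg x Ux; apply: continuous_comp; first exact: cg.
  by apply: cf; exact: gU.
move=> /CkS[df Df] Hg; have /CkS[dg Dg] := Hg; apply/CkS; split=> [x Ux|v].
  by apply: (differentiable_comp (dg _ Ux)); exact: df (gU _ Ux).
apply: (@Ck_ext _ _ _ _
  (fun x => \sum_i ('D_v g x) 0 i *: 'D_(basis_vec R i) f (g x))) => //.
  move=> x Ux; rewrite (derive_comp v (dg _ Ux) (df _ (gU _ Ux))).
  by rewrite [RHS]derive_basis //; exact: df (gU _ Ux).
apply: Ck_sum => // i; apply: CkZ => //; first exact: Ck_coord.
exact: (IH _ (Df _) (CkW Hg)).
Qed.

(** Being of class C^k on U only involves derivatives at the points of U. *)
Lemma Ck_point (V W : normedModType R) (U : set V) k (f : V -> W) :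
  (forall x, U x -> Ck [set x] k f) -> Ck U k f.
Proof.
elim: k f => [|k IH] f Hf; first by move=> x /Hf; exact.
apply/CkS; split=> [x Ux|v]; first by have /CkS[df _] := Hf x Ux; exact: df.
by apply: IH => x Ux; have /CkS[_] := Hf x Ux.
Qed.

Lemma Ck_inv (V : normedModType R) (U : set V) k (f : V -> R) :
  open U -> (forall x, U x -> f x != 0) -> Ck U k f ->
  Ck U k (fun x => (f x)^-1).
Proof.
move=> oU f0; elim: k => [|k IH].
  by move=> cf x Ux; apply: cvgV; [exact: f0|exact: cf].
move=> Hf; have /CkS[df Df] := Hf; apply/CkS; split=> [x Ux|v].
  by apply: differentiableV; [exact: df|exact: f0].
have IHf := IH (CkW Hf).
apply: (@Ck_ext _ _ _ _ (fun x => (f x)^-1 *: ((f x)^-1 *: (-1 *: 'D_v f x)))) => //.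
  move=> x Ux; rewrite deriveV; [|exact: f0|by apply: diff_derivable; exact: df].
  by rewrite !scalerA; congr (_ *: _); rewrite mulrN1 expr2 invfM.
by apply: CkZ => //; apply: CkZ => //; apply: CkZ => //; exact: Ck_cst.
Qed.

Lemma Ck_sqrt (V : normedModType R) (U : set V) k (f : V -> R) :
  open U -> (forall x, U x -> 0 < f x) -> Ck U k f ->
  Ck U k (fun x => Num.sqrt (f x)).
Proof.
move=> oU f0; elim: k => [|k IH].
  move=> cf x Ux; apply: (@continuous_comp _ _ _ f (@Num.sqrt R)).
    exact: cf.
  exact: sqrt_continuous.
move=> Hf; have /CkS[df Df] := Hf.
have dsqrt x : U x -> differentiable (@Num.sqrt R) (f x).
  by move=> Ux; apply/derivable1_diffP; have [] := is_derive1_sqrt (f0 x Ux).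
apply/CkS; split=> [x Ux|v].
  by apply: (@differentiable_comp _ _ _ _ f); [exact: df|exact: dsqrt].
have IHf := IH (CkW Hf).
apply: (@Ck_ext _ _ _ _ (fun x => (2 * Num.sqrt (f x))^-1 *: 'D_v f x)) => //.
  move=> x Ux; rewrite (derive_comp v (df _ Ux) (dsqrt _ Ux)).
  rewrite -[X in 'D_X Num.sqrt _]mulr1 -[_ * 1]/(_ *: (1 : R)).
  rewrite deriveZ_dir; last exact: dsqrt.
  by rewrite derive_sqrt ?f0 // /GRing.scale /= mulrC.
apply: CkZ => //; apply: Ck_inv => //.
  by move=> x Ux; rewrite mulf_neq0 ?pnatr_eq0 // gt_eqF // sqrtr_gt0 f0.
by apply: (@CkZ _ _ _ _ (fun=> 2)) => //; exact: Ck_cst.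
Qed.

End CkTheory.

(** * Germs of smooth maps *)

Section SmoothAt.
Variable R : realType.

(** The domain is hidden, so that expressions built from maps with different
    domains can be treated at a point. *)
Definition smooth_at (V W : normedModType R) (f : V -> W) (x : V) : Prop :=
  exists2 U, open_nbhs x U & smooth_on U f.

Lemma smooth_on_at (V W : normedModType R) (U : set V) (f : V -> W) x :
  open U -> U x -> smooth_on U f -> smooth_at f x.
Proof. by move=> oU Ux sf; exists U. Qed.

Lemma smooth_at_on (V W : normedModType R) (U : set V) (f : V -> W) :
  (forall x, U x -> smooth_at f x) -> smooth_on U f.
Proof.
move=> sf k; apply: Ck_point => x /sf[U' [_ U'x] /(_ k)].
by apply: Ck_sub => _ ->.
Qed.

Lemma smooth_at_near (V W : normedModType R) (f g : V -> W) x :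
  {near x, f =1 g} -> smooth_at f x -> smooth_at g x.
Proof.
move=> fg [U [oU Ux] sf].
have nA : nbhs x (U `&` [set y | f y = g y]).
  by apply: filterI => //; exact: open_nbhs_nbhs.
exists (U `&` [set y | f y = g y])°.
  by split; [exact: open_interior|].
move=> k; apply: (@Ck_ext _ _ _ _ _ f); first exact: open_interior.
  by move=> y /interior_subset[].
by apply: Ck_sub (sf k) => y /interior_subset[].
Qed.

Lemma smooth_at_diff (V W : normedModType R) (f : V -> W) x :
  smooth_at f x -> differentiable f x.
Proof. by move=> [U [_ Ux] /(_ 1%N)[df _]]; exact: df. Qed.

Lemma smooth_at_cont (V W : normedModType R) (f : V -> W) x :
  smooth_at f x -> {for x, continuous f}.
Proof. by move=> /smooth_at_diff/differentiable_continuous. Qed.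

Lemma smooth_at_nbhs (V W : normedModType R) (f : V -> W) x :
  smooth_at f x -> \forall y \near x, smooth_at f y.
Proof.
move=> [U [oU Ux] sf]; apply: filterS (open_nbhs_nbhs (conj oU Ux)) => y Uy.
by exists U.
Qed.

Lemma smooth_at_derive (V W : normedModType R) (f : V -> W) x v :
  smooth_at f x -> smooth_at (fun y => 'D_v f y) x.
Proof. by move=> [U oU sf]; exists U => // k; have /CkS[_] := sf k.+1. Qed.

Lemma smooth_at_comp n (V W : normedModType R) (f : 'rV[R]_n -> W)
    (g : V -> 'rV[R]_n) x :
  smooth_at g x -> smooth_at f (g x) -> smooth_at (fun y => f (g y)) x.
Proof.
move=> sg [U' [oU' U'gx] sf]; have cg := smooth_at_cont sg.
have [U [oU Ux] sgU] := sg.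
have nA : nbhs x (U `&` (g @^-1` U')).
  apply: filterI; first exact: open_nbhs_nbhs.
  by apply: cg; exact: open_nbhs_nbhs.
exists (U `&` (g @^-1` U'))°; first by split; [exact: open_interior|].
move=> k; apply: (@Ck_comp _ _ _ _ _ U').
- exact: open_interior.
- by move=> y /interior_subset[].
- exact: sf.
- by apply: Ck_sub (sgU k) => y /interior_subset[].
Qed.

Lemma smooth_at_op2 (V W1 W2 W : normedModType R) (f : V -> W1) (g : V -> W2)
    (h : V -> W) x :
  (forall U, open U -> smooth_on U f -> smooth_on U g -> smooth_on U h) ->
  smooth_at f x -> smooth_at g x -> smooth_at h x.
Proof.
move=> H [U [oU Ux] sf] [U' [oU' U'x] sg].
exists (U `&` U'); first by split=> //; exact: openI.
apply: H; first exact: openI.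
  by move=> k; apply: Ck_sub (sf k) => y [].
by move=> k; apply: Ck_sub (sg k) => y [].
Qed.

Lemma smooth_at_cst (V W : normedModType R) (a : W) (x : V) :
  smooth_at (fun _ : V => a) x.
Proof.
by exists setT; [split=> //; exact: openT|move=> k; exact: Ck_cst].
Qed.

Lemma smooth_at_linear (V W : normedModType R) (f : {linear V -> W}) (x : V) :
  continuous f -> smooth_at f x.
Proof.
by move=> cf; exists setT; [split=> //; exact: openT|move=> k; exact: Ck_linear].
Qed.

Lemma smooth_at_id (V : normedModType R) (x : V) : smooth_at (fun y : V => y) x.
Proof. by apply: (@smooth_at_linear _ _ (@idfun V)) => y; exact: cvg_id. Qed.

Lemma smooth_atD (V W : normedModType R) (f g : V -> W) x :
  smooth_at f x -> smooth_at g x -> smooth_at (fun y => f y + g y) x.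
Proof. by apply: smooth_at_op2 => U oU sf sg k; exact: CkD. Qed.

Lemma smooth_atZ (V W : normedModType R) (a : V -> R) (f : V -> W) x :
  smooth_at a x -> smooth_at f x -> smooth_at (fun y => a y *: f y) x.
Proof. by apply: smooth_at_op2 => U oU sf sg k; exact: CkZ. Qed.

Lemma smooth_atM (V : normedModType R) (a f : V -> R) x :
  smooth_at a x -> smooth_at f x -> smooth_at (fun y => a y * f y) x.
Proof. exact: smooth_atZ. Qed.

Lemma smooth_atN (V W : normedModType R) (f : V -> W) x :
  smooth_at f x -> smooth_at (fun y => - f y) x.
Proof.
move=> sf; have := smooth_atZ (smooth_at_cst (-1 : R) x) sf.
by apply: smooth_at_near; near=> y; rewrite scaleN1r.
Unshelve. all: by end_near. Qed.

Lemma smooth_atB (V W : normedModType R) (f g : V -> W) x :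
  smooth_at f x -> smooth_at g x -> smooth_at (fun y => f y - g y) x.
Proof. by move=> sf sg; apply: smooth_atD => //; exact: smooth_atN. Qed.

Lemma smooth_at_sum (V W : normedModType R) (I : Type) (r : seq I)
    (P : pred I) (F : I -> V -> W) x :
  (forall i, smooth_at (F i) x) ->
  smooth_at (fun y => \sum_(i <- r | P i) F i y) x.
Proof.
move=> sF; elim: r => [|i r IH].
  under eq_fun do rewrite big_nil; exact: smooth_at_cst.
under eq_fun do rewrite big_cons; case: (P i) => //; exact: smooth_atD.
Qed.

Lemma smooth_at_prod (V : normedModType R) (I : Type) (r : seq I)
    (F : I -> V -> R) x :
  (forall i, smooth_at (F i) x) ->
  smooth_at (fun y => \prod_(i <- r) F i y) x.
Proof.
move=> sF; elim: r => [|i r IH].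
  under eq_fun do rewrite big_nil; exact: smooth_at_cst.
under eq_fun do rewrite big_cons; exact: smooth_atM.
Qed.

Lemma smooth_at_real_comp (V : normedModType R) (f : V -> R) (k : R -> R) (B : set R) x :
  open B -> (forall U n, open U -> (forall y, U y -> B (f y)) -> Ck U n f ->
    Ck U n (fun y => k (f y))) ->
  B (f x) -> smooth_at f x -> smooth_at (fun y => k (f y)) x.
Proof.
move=> oB kf Bf sf; have cf := smooth_at_cont sf; have [U [oU Ux] sfU] := sf.
have nA : nbhs x (U `&` (f @^-1` B)).
  by apply: filterI; [exact: open_nbhs_nbhs | apply: cf; exact: open_nbhs_nbhs].
exists (U `&` (f @^-1` B))°; first by split; [exact: open_interior|].
move=> n; apply: kf; first exact: open_interior.
  by move=> y /interior_subset[].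
by apply: Ck_sub (sfU n) => y /interior_subset[].
Qed.

Lemma smooth_at_inv (V : normedModType R) (f : V -> R) x :
  f x != 0 -> smooth_at f x -> smooth_at (fun y => (f y)^-1) x.
Proof.
apply: (smooth_at_real_comp (B := [set z | z != 0])); first exact: open_neq.
by move=> U n; exact: Ck_inv.
Qed.

Lemma smooth_at_sqrt (V : normedModType R) (f : V -> R) x :
  0 < f x -> smooth_at f x -> smooth_at (fun y => Num.sqrt (f y)) x.
Proof.
apply: (smooth_at_real_comp (B := [set z | 0 < z])); first exact: open_gt.
by move=> U n; exact: Ck_sqrt.
Qed.

Lemma smooth_at_coord (V : normedModType R) m n (f : V -> 'M[R]_(m, n)) i j x :
  smooth_at f x -> smooth_at (fun y => f y i j) x.
Proof. by move=> [U [oU Ux] sf]; exists U => // k; exact: Ck_coord. Qed.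

Lemma smooth_at_mx (V : normedModType R) m n (f : V -> 'M[R]_(m, n)) x :
  (forall i j, smooth_at (fun y => f y i j) x) -> smooth_at f x.
Proof.
move=> sf.
have -> : f = (fun y => \sum_i \sum_j f y i j *: delta_mx i j).
  by apply/funext => y; exact: matrix_sum_delta.
apply: smooth_at_sum => i; apply: smooth_at_sum => j.
by apply: smooth_atZ => //; exact: smooth_at_cst.
Qed.

Lemma smooth_at_mulmx (V : normedModType R) m n p (A : V -> 'M[R]_(m, n))
    (B : V -> 'M[R]_(n, p)) x :
  smooth_at A x -> smooth_at B x -> smooth_at (fun y => A y *m B y) x.
Proof.
move=> sA sB; apply: smooth_at_mx => i j.
have -> : (fun y => (A y *m B y) i j) = (fun y => \sum_k A y i k * B y k j).
  by apply/funext => y; rewrite mxE.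
by apply: smooth_at_sum => k; apply: smooth_atM; exact: smooth_at_coord.
Qed.

Lemma smooth_at_tr (V : normedModType R) m n (A : V -> 'M[R]_(m, n)) x :
  smooth_at A x -> smooth_at (fun y => (A y)^T) x.
Proof.
move=> sA; apply: smooth_at_mx => i j.
have -> : (fun y => (A y)^T i j) = (fun y => A y j i).
  by apply/funext => y; rewrite mxE.
exact: smooth_at_coord.
Qed.

Lemma smooth_at_det (V : normedModType R) n (A : V -> 'M[R]_n) x :
  smooth_at A x -> smooth_at (fun y => \det (A y)) x.
Proof.
move=> sA; apply: smooth_at_sum => s; apply: smooth_atM.
  exact: smooth_at_cst.
by apply: smooth_at_prod => i; exact: smooth_at_coord.
Qed.

(** The inverse is the adjugate divided by the determinant. *)
Lemma smooth_at_invmx (V : normedModType R) n (A : V -> 'M[R]_n) x :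
  A x \in unitmx -> smooth_at A x -> smooth_at (fun y => invmx (A y)) x.
Proof.
move=> Au sA; have sd := smooth_at_det sA.
have d0 : \det (A x) != 0 by rewrite -unitfE -unitmxE.
have cd := smooth_at_cont sd.
apply: (@smooth_at_near _ _ (fun y => (\det (A y))^-1 *: \adj (A y))).
  have : \forall y \near x, \det (A y) != 0.
    by apply: (cd [set z | z != 0]); apply: open_nbhs_nbhs; split => //; exact: open_neq.
  by apply: filterS => y dy; rewrite /invmx unitmxE unitfE dy.
apply: smooth_atZ; first exact: smooth_at_inv.
apply: smooth_at_mx => i j.
have -> : (fun y => (\adj (A y)) i j) =
    (fun y => (-1) ^+ (j + i) * \det (row' j (col' i (A y)))).
  by apply/funext => y; rewrite mxE.
apply: smooth_atM; first exact: smooth_at_cst.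
apply: smooth_at_det; apply: smooth_at_mx => a b.
have -> : (fun y => (row' j (col' i (A y))) a b) =
    (fun y => A y (lift j a) (lift i b)) by apply/funext => y; rewrite !mxE.
exact: smooth_at_coord.
Qed.

Lemma smooth_at_inner (V : normedModType R) n (G : V -> 'M[R]_n)
    (u v : V -> 'rV[R]_n) x :
  smooth_at G x -> smooth_at u x -> smooth_at v x ->
  smooth_at (fun y => inner (G y) (u y) (v y)) x.
Proof.
move=> sG su sv; apply: smooth_at_coord; apply: smooth_at_mulmx.
  exact: smooth_at_mulmx.
exact: smooth_at_tr.
Qed.

End SmoothAt.

(** * Derivatives along lines, symmetry of second derivatives *)

Section Lines.
Variable R : realType.

Lemma differentiable_line (V : normedModType R) (y u : V) (s : R) :
  differentiable (fun s : R => y + s *: u) s.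
Proof.
by apply: differentiableD; [exact: differentiable_cst|exact: differentiable_scale].
Qed.

Lemma differentiable_idfun (V : normedModType R) (x : V) :
  differentiable (fun y : V => y) x.
Proof. by have [] := is_diff_id x. Qed.

Lemma derive_lineE (V : normedModType R) (y u : V) (s : R) :
  'D_1 (fun s : R => y + s *: u) s = u.
Proof.
have ds : differentiable (fun s : R => s *: u) s.
  by apply: differentiable_scale.
rewrite deriveD; [|exact: derivable_cst|exact: diff_derivable].
rewrite derive_cst add0r (derive_scale (1 : R) (differentiable_idfun s) (differentiable_cst u s)).
by rewrite derive_cst scaler0 add0r derive_id scale1r.
Qed.

Lemma derive_line (V W : normedModType R) (f : V -> W) (y u : V) (s : R) :
  differentiable f (y + s *: u) ->
  is_derive s 1 (fun s : R => f (y + s *: u)) ('D_u f (y + s *: u)).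
Proof.
move=> df; have dl := differentiable_line y u s.
apply: DeriveDef.
  by apply: diff_derivable; apply: (differentiable_comp dl df).
by rewrite (derive_comp (1 : R) dl df) derive_lineE.
Qed.

Lemma MVT_line (V : normedModType R) (f : V -> R) (y u : V) (h : R) :
  0 < h -> (forall s, 0 <= s <= h -> differentiable f (y + s *: u)) ->
  exists2 c, 0 < c < h & f (y + h *: u) - f y = 'D_u f (y + c *: u) * h.
Proof.
move=> h0 df.
have dfl s : 0 <= s <= h -> is_derive s 1 (fun s : R => f (y + s *: u))
    ('D_u f (y + s *: u)) by move=> /df; exact: derive_line.
have [|c|c] := @MVT R (fun s => f (y + s *: u))
  (fun s => 'D_u f (y + s *: u)) 0 h h0.
- by move=> s; rewrite in_itv /= => /andP[s0 sh]; apply: dfl; rewrite !ltW.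
- apply: derivable_within_continuous => s; rewrite in_itv /= => sh.
  by have [] := dfl s sh.
rewrite in_itv /= scale0r addr0 subr0 => ch E; by exists c.
Qed.

(** The mean value theorem is applied to y |-> f (y + h v) - f y in the
    direction u, and then to the derivative of f in the direction v. *)
Lemma second_difference (V : normedModType R) (f : V -> R) (x u v : V) (h : R) :
  0 < h ->
  (forall a b, 0 <= a <= h -> 0 <= b <= h ->
     differentiable f (x + a *: u + b *: v)) ->
  (forall a b, 0 <= a <= h -> 0 <= b <= h ->
     differentiable (fun y => 'D_u f y) (x + a *: u + b *: v)) ->
  exists a b, [/\ 0 < a < h, 0 < b < h &
    f (x + h *: u + h *: v) - f (x + h *: u) - f (x + h *: v) + f x =
    'D_v (fun y => 'D_u f y) (x + a *: u + b *: v) * (h * h)].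
Proof.
move=> h0 df ddf.
pose g y := f (y + h *: v) - f y.
have hh : 0 <= h <= h by rewrite ltW //=.
have h00 : 0 <= (0 : R) <= h by rewrite lexx ltW.
have dsh s : 0 <= s <= h -> differentiable (fun y => f (y + h *: v)) (x + s *: u).
  move=> sh; apply: (@differentiable_comp _ _ _ _ (fun y => y + h *: v) f) => //.
  exact: df.
have df0 s : 0 <= s <= h -> differentiable f (x + s *: u).
  by move=> sh; have := df s 0 sh h00; rewrite scale0r addr0.
have [|a ah ga] := @MVT_line V g x u h h0.
  by move=> s sh; apply: differentiableB; [exact: dsh|exact: df0].
have ah' : 0 <= a <= h by case/andP: ah => ? ?; rewrite !ltW.
have [|b bh gb] := @MVT_line V (fun y => 'D_u f y) (x + a *: u) v h h0.
  by move=> s sh; exact: ddf.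
exists a, b; split => //.
transitivity (g (x + h *: u) - g x).
  rewrite /g; ring.
rewrite ga mulrA -gb; congr (_ * _).
rewrite /g deriveB; [|by apply: diff_derivable; exact: dsh
  |by apply: diff_derivable; exact: df0].
congr (_ - _).
have dsv : differentiable (fun y => y + h *: v) (x + a *: u) by [].
have -> : 'D_u (fun y => f (y + h *: v)) (x + a *: u) = 'D_('D_u (fun y => y + h *: v) (x + a *: u)) f (x + a *: u + h *: v).
  exact: (@derive_comp _ _ _ _ f (fun y => y + h *: v) _ u dsv (df a h ah' hh)).
congr ('D_(_) f _).
rewrite deriveD; [|exact: derivable_id|exact: derivable_cst].
by rewrite derive_id derive_cst addr0.
Qed.

Lemma smooth_at_dist (V W : normedModType R) (f : V -> W) (x : V) (e : R) :
  0 < e -> smooth_at f x -> \forall y \near x, `|f x - f y| < e.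
Proof. by move=> e0 /smooth_at_cont cf; exact: cvgr_dist_lt. Qed.

(** The second difference of f is symmetric in u and v, and both second
    derivatives are limits of it. *)
Lemma derive_comm_real (V : normedModType R) (f : V -> R) (x u v : V) :
  smooth_at f x ->
  'D_v (fun y => 'D_u f y) x = 'D_u (fun y => 'D_v f y) x.
Proof.
move=> sf.
pose F1 y : R := 'D_v (fun y => 'D_u f y) y.
pose F2 y : R := 'D_u (fun y => 'D_v f y) y.
have F1E y : 'D_v (fun y => 'D_u f y) y = F1 y by [].
have F2E y : 'D_u (fun y => 'D_v f y) y = F2 y by [].
have c1 e : 0 < e -> \forall y \near x, `|F1 x - F1 y| < e.
  by move=> e0; exact: smooth_at_dist e0 (smooth_at_derive v (smooth_at_derive u sf)).
have c2 e : 0 < e -> \forall y \near x, `|F2 x - F2 y| < e.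
  by move=> e0; exact: smooth_at_dist e0 (smooth_at_derive u (smooth_at_derive v sf)).
rewrite F1E F2E; clearbody F1 F2; move: (F1 x) (F2 x) c1 c2 => L1 L2 c1 c2.
apply/eqP; rewrite -subr_eq0; apply: contraT => ne.
have e0 : 0 < `|L1 - L2| / 2 by rewrite divr_gt0 // normr_gt0.
set e := _ / 2 in e0.
have : \forall y \near x, [/\ smooth_at f y, `|L1 - F1 y| < e & `|L2 - F2 y| < e].
  apply: filterS3 (smooth_at_nbhs sf) (c1 e e0) (c2 e e0) => y ? ? ?; by split.
move=> /nbhs_ballP[d /= d0 dP].
pose h := d / (2 * (1 + `|u| + `|v|)).
have uv0 : 0 < 1 + `|u| + `|v| by rewrite -addrA ltr_pwDl // addr_ge0.
have h0 : 0 < h by rewrite divr_gt0 // mulr_gt0.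
have inb a b : 0 <= a <= h -> 0 <= b <= h -> ball x d (x + a *: u + b *: v).
  move=> /andP[a0 ah] /andP[b0 bh]; rewrite -ball_normE /= /ball_.
  rewrite -addrA opprD addrA subrr sub0r normrN.
  apply: le_lt_trans (ler_normD _ _) _; rewrite !normrZ !ger0_norm //.
  apply: (@le_lt_trans _ _ (h * (1 + `|u| + `|v|))).
    have := ler_wpM2r (normr_ge0 u) ah; have := ler_wpM2r (normr_ge0 v) bh.
    by move: h0; lra.
  rewrite /h invfM mulrA -mulrA mulVf ?gt_eqF // mulr1.
  by rewrite ltr_pdivrMr // mulr_natr mulr2n ltrDl.
have [||a [b [ah bh E1]]] := @second_difference V f x u v h h0.
- by move=> a b ah bh; have [/smooth_at_diff] := dP _ (inb _ _ ah bh).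
- by move=> a b ah bh; have [/(smooth_at_derive u)/smooth_at_diff] := dP _ (inb _ _ ah bh).
have inb' s r : 0 <= s <= h -> 0 <= r <= h -> ball x d (x + s *: v + r *: u).
  by move=> ? ?; rewrite addrAC; exact: inb.
have [||b' [a' [bh' ah' E2]]] := @second_difference V f x v u h h0.
- by move=> ? ? ah_ bh_; have [/smooth_at_diff] := dP _ (inb' _ _ ah_ bh_).
- by move=> ? ? ah_ bh_; have [/(smooth_at_derive v)/smooth_at_diff] := dP _ (inb' _ _ ah_ bh_).
have oo s : 0 < s < h -> 0 <= s <= h by move=> /andP[? ?]; rewrite !ltW.
have [_ p1 _] := dP _ (inb _ _ (oo _ ah) (oo _ bh)).
have [_ _ p2] := dP _ (inb' _ _ (oo _ bh') (oo _ ah')).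
have E : F1 (x + a *: u + b *: v) = F2 (x + b' *: v + a' *: u).
  have hh0 : h * h != 0 by rewrite mulf_neq0 // gt_eqF.
  apply: (mulIf hh0); rewrite F1E in E1; rewrite F2E in E2; rewrite -E1 -E2.
  rewrite [x + h *: v + _]addrAC; ring.
rewrite -E in p2.
have := ler_distD (F1 (x + a *: u + b *: v)) L1 L2.
rewrite [`|F1 _ - L2|]distrC => /le_lt_trans/(_ (ltrD p1 p2)).
by rewrite /e -splitr ltxx.
Qed.

(** The point t may be an end point of the interval; one of the one-sided
    difference quotients stays in it. *)
Lemma derive_eq_on_segment (W : normedModType R) (f g : R -> W) (l t : R) :
  0 < l -> 0 <= t <= l -> (forall s, 0 <= s <= l -> f s = g s) ->
  differentiable f t -> differentiable g t -> 'D_1 f t = 'D_1 g t.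
Proof.
move=> l0 /andP[t0 tl] fg df dg.
wlog gE : f g fg df dg / g = cst 0.
  move=> H; apply/eqP; rewrite -subr_eq0; apply/eqP.
  have dfg : differentiable (f - g) t by exact: differentiableB.
  rewrite -deriveB; [|exact: diff_derivable|exact: diff_derivable].
  rewrite (H _ (cst 0)) ?derive_cst // => s sl.
  by rewrite /= !fctE fg // subrr.
rewrite gE derive_cst in fg *; have /diff_derivable : differentiable f t by [].
move=> /(_ 1) df1.
have f0 s : 0 <= s <= l -> f s = 0 by exact: fg.
have ft : f t = 0 by apply: f0; rewrite t0 tl.
have [tl'|lt'] := ltP t l.
- rewrite /derive cvg_at_rightE //; apply: cvg_lim => //.
  apply: cvg_near_cst; near=> h.
  have h0 : 0 < h by [].
  have hl : h < l - t by near: h; apply: nbhs_right_lt; rewrite subr_gt0.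
  have fh : f (h *: (1 : R) + t) = 0.
    by apply: f0; rewrite -[h *: (1 : R)]/(h * 1); move: h0 hl; lra.
  by rewrite /= ft fh subr0 scaler0.
- rewrite /derive cvg_at_leftE //; apply: cvg_lim => //.
  apply: cvg_near_cst; near=> h.
  have h0 : h < 0 by [].
  have hl : - l < h by near: h; apply: nbhs_left_gt; rewrite oppr_lt0.
  have fh : f (h *: (1 : R) + t) = 0.
    by apply: f0; rewrite -[h *: (1 : R)]/(h * 1); move: h0 hl; lra.
  by rewrite /= ft fh subr0 scaler0.
Unshelve. all: by end_near. Qed.

(** Only the germ at t matters: away from t the map f may be replaced by g. *)
Lemma derive_eq_near_segment (W : normedModType R) (f g : R -> W) (l t : R) :
  0 < l -> 0 <= t <= l -> (\forall s \near t, 0 <= s <= l -> f s = g s) ->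
  differentiable f t -> differentiable g t -> 'D_1 f t = 'D_1 g t.
Proof.
move=> l0 tl fg df dg; pose U := [set s : R | 0 <= s <= l -> f s = g s].
pose h s := if `[< U s >] then f s else g s.
have hf : {near t, f =1 h} by apply: filterS fg => s sU; rewrite /h asboolT.
rewrite (near_eq_derive (1 : R) hf).
apply: derive_eq_on_segment l0 tl _ (near_eq_differentiable hf df) dg => s sl.
by rewrite /h; case: asboolP => // Us; exact: Us.
Qed.

Lemma differentiable_cos (x : R) : differentiable (@cos R) x.
Proof. by apply/derivable1_diffP; have [] := is_derive_cos x. Qed.

Lemma differentiable_sin (x : R) : differentiable (@sin R) x.
Proof. by apply/derivable1_diffP; have [] := is_derive_sin x. Qed.

Lemma derive_cos_comp (a : R -> R) t : differentiable a t ->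
  'D_1 (fun r => cos (a r)) t = - sin (a t) * 'D_1 a t.
Proof.
move=> da; have dat : is_derive t (1 : R) a ('D_1 a t) := DeriveDef (diff_derivable da) erefl.
by have [_ <-] := is_derive1_comp (is_derive_cos (a t)) dat.
Qed.

Lemma derive_sin_comp (a : R -> R) t : differentiable a t ->
  'D_1 (fun r => sin (a r)) t = cos (a t) * 'D_1 a t.
Proof.
move=> da; have dat : is_derive t (1 : R) a ('D_1 a t) := DeriveDef (diff_derivable da) erefl.
by have [_ <-] := is_derive1_comp (is_derive_sin (a t)) dat.
Qed.

End Lines.

(** * The inverse function theorem *)

Section LocalInverse.
Variable R : realType.

Lemma normr_coord_le n (v : 'rV[R]_n) i : `|v 0 i| <= `|v|.
Proof.
rewrite [leRHS]/Num.Def.normr/= mx_normrE.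
by apply: le_trans; last exact: (le_bigmax _ _ (0, i)).
Qed.

Lemma normr_row_le n (v : 'rV[R]_n) (e : R) :
  0 <= e -> (forall i, `|v 0 i| <= e) -> `|v| <= e.
Proof.
move=> e0 ve; rewrite [leLHS]/Num.Def.normr/= mx_normrE bigmax_le //= => -[i j] _ /=.
by rewrite ord1.
Qed.

HB.instance Definition _ (m n : nat) := Complete.on 'M[R]_(m, n).

Lemma half_contraction_fixpoint n (U : set 'rV[R]_n) (K : 'rV[R]_n -> 'rV[R]_n) :
  closed U -> U !=set0 -> (forall x, U x -> U (K x)) ->
  (forall x y, U x -> U y -> `|K x - K y| <= 2^-1 * `|x - y|) ->
  exists2 p, U p & p = K p.
Proof.
move=> cU U0 KU HK.
have fK : set_fun U U K by [].
pose KF : {fun U >-> U} := mkfun fK.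
have ck : is_contraction KF.
  exists (2^-1)%:nng; split => /=.
    by rewrite invf_lt1 ?ltr1n.
  by move=> [x y] [Ux Uy] /=; exact: HK.
have := @banach_fixed_point _ _ U KF ck cU U0; exact.
Qed.

Lemma diff_estimate (V W : normedModType R) (f : V -> W) (x : V) (e : R) :
  0 < e -> differentiable f x ->
  \forall d \near (0 : V), `|f (x + d) - f x - 'D_d f x| <= e * `|d|.
Proof.
move=> e0 df; have /diff_locallyP[_ /eqaddoP/(_ _ e0)] := df.
apply: filterS => d /=; rewrite /= !fctE /= deriveE // addrC.
by rewrite [x + d]addrC -addrA -opprD addrC.
Qed.

Variables (n : nat) (F : 'rV[R]_n -> 'rV[R]_n).
Hypotheses (sF : smooth_at F 0) (F0 : F 0 = 0) (DF0 : forall v, 'D_v F 0 = v).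

(* The factor n of c accounts for the n coordinates of v. *)
Let near_id_deriv : \forall x \near (0 : 'rV[R]_n),
  smooth_at F x /\ forall v, `|'D_v F x - v| <= 2^-1 * `|v|.
Proof.
pose c : R := (2 * n.+1%:R)^-1.
have c0 : 0 < c by rewrite invr_gt0 mulr_gt0.
have nj : \forall x \near (0 : 'rV[R]_n), forall j : 'I_n,
    `|'D_(basis_vec R j) F x - basis_vec R j| < c.
  near=> x => j; move: j; near: x; apply: filter_forall => j.
  have := smooth_at_dist c0 (smooth_at_derive (basis_vec R j) sF).
  by apply: filterS => x; rewrite DF0 distrC.
apply: filterS2 (smooth_at_nbhs sF) nj => x sx xj; split=> // v.
rewrite (derive_basis _ (smooth_at_diff sx)) {2}(row_sum_basis v) -sumrB.
apply: (le_trans (ler_norm_sum _ _ _)).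
apply: (@le_trans _ _ (\sum_(i < n) `|v| * c)).
  apply: ler_sum => i _; rewrite -scalerBr normrZ.
  by apply: ler_pM => //; [exact: normr_coord_le|exact: ltW].
rewrite sumr_const card_ord -[leLHS]mulr_natr -mulrA [2^-1 * _]mulrC ler_wpM2l //.
rewrite /c invfM -mulrA ler_piMr // mulrC ler_pdivrMr // mul1r ler_nat.
exact: leqnSn.
Unshelve. all: by end_near. Qed.

(** The inverse function theorem, at a point where the differential is the
    identity: G y is the fixed point of z |-> z - F z + y, a contraction near 0,
    and the differential of F is inverted in the same way. *)
Lemma local_inverse :
  exists (r : R) (G : 'rV[R]_n -> 'rV[R]_n), [/\ 0 < r,
    forall y, `|y| < r -> [/\ F (G y) = y, `|G y| <= 2 * `|y| &
      forall v, exists2 w, 'D_w F (G y) = v & is_derive y v G w] &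
    forall x, `|x| < r -> G (F x) = x].
Proof.
have /nbhs_ballP[rho /= rho0 Hrho] := near_id_deriv.
have bE x : `|x| < rho -> smooth_at F x /\ forall v, `|'D_v F x - v| <= 2^-1 * `|v|.
  by move=> xr; apply: Hrho; rewrite -ball_normE /= sub0r normrN.
have est x y : `|x| < rho -> `|y| < rho ->
    `|(x - F x) - (y - F y)| <= 2^-1 * `|x - y|.
  move=> xr yr; apply: normr_row_le => [|i]; first by rewrite mulr_ge0.
  pose f (z : 'rV[R]_n) : R := z 0 i - F z 0 i.
  have segr s : 0 <= s <= 1 -> `|y + s *: (x - y)| < rho.
    move=> /andP[s0 s1].
    have -> : y + s *: (x - y) = (1 - s) *: y + s *: x.
      by rewrite scalerBr scalerBl scale1r [s *: x - _]addrC addrA.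
    apply: le_lt_trans (ler_normD _ _) _; rewrite !normrZ !ger0_norm ?subr_ge0 //.
    have [->|s0'] := eqVneq s 0; first by rewrite subr0 mul1r mul0r addr0.
    have s0'' : 0 < s by rewrite lt_def s0'.
    have : (1 - s) * `|y| <= (1 - s) * rho by rewrite ler_wpM2l ?subr_ge0 // ltW.
    have : s * `|x| < s * rho by rewrite ltr_pM2l.
    by move: (s * `|x|) ((1 - s) * `|y|) => p q; lra.
  have dFz z : `|z| < rho -> differentiable F z by move=> /bE[/smooth_at_diff].
  have df z : `|z| < rho -> differentiable f z.
    move=> zr; apply: differentiableB; first exact: differentiable_coord.
    by apply: differentiable_mxcoord; exact: dFz.
  have [s s01|c c01 E] := @MVT_line R _ f y (x - y) 1 ltr01.
    by apply: df; exact: segr.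
  rewrite scale1r [y + _]addrC subrK mulr1 in E.
  have cr : `|y + c *: (x - y)| < rho.
    by apply: segr; case/andP: c01 => ? ?; rewrite !ltW.
  rewrite (_ : _ 0 i = f x - f y); last by rewrite /f !mxE.
  rewrite E /f deriveB; last 2 first.
  - by apply: diff_derivable; exact: differentiable_coord.
  - by apply: diff_derivable; apply: differentiable_mxcoord; exact: dFz.
  rewrite (@derive_coord _ _ _ _ F) //; last exact: dFz.
  rewrite (@derive_coord _ _ _ _ (fun z => z)); last exact: differentiable_idfun.
  rewrite derive_id.
  have [_ /(_ (x - y))] := bE _ cr.
  apply: le_trans; rewrite distrC; apply: le_trans (normr_coord_le _ i).
  by rewrite !mxE.
have inj x y : `|x| < rho -> `|y| < rho -> `|x - y| <= 2 * `|F x - F y|.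
  move=> xr yr; have := est x y xr yr.
  have -> : x - F x - (y - F y) = (x - y) - (F x - F y).
    by apply/rowP => j; rewrite !mxE; ring.
  move: (x - y) (F x - F y) => a b; have := lerB_dist a b.
  by move: `|a| `|b| `|a - b| => p q w; lra.
(* On the ball of radius rho the map z - F z has Lipschitz constant 1/2. Hence
   z |-> z - F z + y maps the closed ball of radius rho / 2 into itself when
   |y| <= rho / 4; the radius rho / 8 leaves room for difference quotients. *)
pose U : set 'rV[R]_n := [set z | `|z| <= rho / 2].
have cU : closed U.
  apply: (@closed_comp _ _ (fun z : 'rV[R]_n => `|z|) [set r | r <= rho / 2]).
    by move=> z _; exact: norm_continuous.
  exact: closed_le.
have Ur z : U z -> `|z| < rho.
  by move=> Uz; apply: le_lt_trans Uz _; rewrite ltr_pdivrMr // mulr_natr mulr2n ltrDl.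
have ex y : `|y| <= rho / 4 -> exists2 z, U z & F z = y.
  move=> yr; have [|||z Uz zE] := @half_contraction_fixpoint n U (fun z => z - F z + y) cU.
  - by exists 0; rewrite /U /= normr0 divr_ge0 // ltW.
  - move=> z Uz; rewrite /U /=; apply: le_trans (ler_normD _ _) _.
    have := est z 0 (Ur _ Uz); rewrite normr0 F0 !subr0 => /(_ rho0).
    by move: Uz yr; rewrite /U /=; move: `|z| `|y| `|_| => p q w; lra.
  - move=> a b Ua Ub; rewrite [X in `|X|](_ : _ = a - F a - (b - F b)).
      by apply: est; exact: Ur.
    by rewrite opprD addrACA subrr addr0.
  exists z => //; apply/eqP; rewrite -subr_eq0; apply/eqP.
  have : z - (z - F z + y) = 0 by rewrite -zE subrr.
  by rewrite opprD opprB addrA [z + _]addrC subrK.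
pose G y := get [set z | U z /\ F z = y].
have GP y : `|y| <= rho / 4 -> U (G y) /\ F (G y) = y.
  move=> /ex[z Uz Fz]; exact: (@getI _ [set z | U z /\ F z = y] z).
have GU z : U z -> G (F z) = z.
  move=> Uz; have [UG FG] := @getI _ [set w | U w /\ F w = F z] z (conj Uz erefl).
  apply/eqP; rewrite -subr_eq0 -normr_le0.
  by have := inj _ _ (Ur _ UG) (Ur _ Uz); rewrite FG subrr normr0 mulr0.
have surj z v : `|z| < rho -> exists w, 'D_w F z = v.
  move=> zr; have [sz Dz] := bE _ zr; have dz := smooth_at_diff sz.
  have [||||w _ wE] := @half_contraction_fixpoint n setT (fun w => w - 'D_w F z + v).
  - exact: closedT.
  - by exists 0.
  - by [].
  - move=> a b _ _; have := Dz (b - a).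
    rewrite deriveD_dir // deriveN_dir // [`|a - b|]distrC.
    move: ('D_a F z) ('D_b F z) => p q.
    suff -> : a - p + v - (b - q + v) = q - p - (b - a) by [].
    by apply/rowP => j; rewrite !mxE; ring.
  exists w; apply/eqP; rewrite -subr_eq0; apply/eqP.
  have : w - (w - 'D_w F z + v) = 0 by rewrite -wE subrr.
  by rewrite opprD opprB addrA [w + _]addrC subrK.
exists (rho / 8), G; split.
- by rewrite divr_gt0.
- move=> y yr.
  have r84 : rho / 8 <= rho / 4 by move: rho0; lra.
  have y4 : `|y| <= rho / 4 by apply: le_trans r84; exact: ltW.
  have [UG FG] := GP _ y4; split=> //.
    by have := inj (G y) 0 (Ur _ UG); rewrite normr0 F0 FG !subr0; apply.
  move=> v; have [w Dw] := surj _ v (Ur _ UG); exists w => //.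
  have [sz Dz] := bE _ (Ur _ UG); have dz := smooth_at_diff sz.
  (* With d = G (h v + y) - G y, F (G y + d) - F (G y) = h v differs from
     'D_d F (G y) by o(d), and d = O(h). *)
  have qcvg : (fun h : R => h^-1 *: (G (h *: v + y) - G y)) @ 0^' --> w.
    apply/cvgrPdist_le => /= e e0.
    pose e1 := e / (4 * (1 + `|v|)).
    have v1 : 0 < 1 + `|v| by rewrite ltr_pwDl.
    have e10 : 0 < e1 by rewrite divr_gt0 // mulr_gt0.
    have yv : \forall h \near (0 : R), `|h *: v + y| <= rho / 4.
      have yh : h *: v + y @[h --> (0 : R)] --> y.
        rewrite -[X in _ --> X]add0r -(scale0r v).
        by apply: cvgD; [apply: cvgZl; exact: cvg_id|exact: cvg_cst].
      have : \forall x \near y, `|x| < rho / 4.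
        have y4' : `|y| < rho / 4 by apply: lt_le_trans r84.
        apply: (@norm_continuous _ _ y [set r | r < rho / 4]).
        by apply: open_nbhs_nbhs; split => //; exact: open_lt.
      move=> /yh ny; near=> h; apply: ltW; near: h; exact: ny.
    have lip : \forall h \near (0 : R), `|G (h *: v + y) - G y| <= 2 * `|h| * `|v|.
      apply: filterS yv => h /GP[UGh FGh].
      apply: le_trans (inj _ _ (Ur _ UGh) (Ur _ UG)) _.
      by rewrite FGh FG addrK normrZ mulrA.
    have dest : \forall h \near (0 : R), 
      `|F (G y + (G (h *: v + y) - G y)) - F (G y) - 'D_(G (h *: v + y) - G y) F (G y)|
        <= e1 * `|G (h *: v + y) - G y|.
      have d0 : (fun h : R => G (h *: v + y) - G y) @ (0 : R) --> (0 : 'rV[R]_n).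
        apply/cvgr0Pnorm_le => /= eps eps0.
        have e20 : 0 < eps / (2 * (1 + `|v|)) by rewrite divr_gt0 // mulr_gt0.
        have nh : \forall h \near (0 : R), `|h| <= eps / (2 * (1 + `|v|)).
          apply/nbhs_ballP; exists (eps / (2 * (1 + `|v|))) => // z.
          by rewrite -ball_normE /= sub0r normrN => /ltW.
        near=> h.
        have liph : `|G (h *: v + y) - G y| <= 2 * `|h| * `|v|.
          by near: h; exact: lip.
        apply: le_trans liph _.
        have hs : `|h| <= eps / (2 * (1 + `|v|)).
          by near: h; exact: nh.
        apply: (@le_trans _ _ (2 * `|h| * (1 + `|v|))).
          by rewrite ler_wpM2l ?mulr_ge0 // lerDr.
        have : `|h| * (2 * (1 + `|v|)) <= eps by rewrite -ler_pdivlMr // mulr_gt0.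
        by move: `|h| `|v| => p q; lra.
      exact: (d0 _ (diff_estimate e10 dz)).
    near=> h.
    have h0 : h != 0 by near: h; exact: nbhs_dnbhs_neq.
    have yvh : `|h *: v + y| <= rho / 4 by near: h; exact: nbhs_dnbhs yv.
    have liph : `|G (h *: v + y) - G y| <= 2 * `|h| * `|v|.
      by near: h; exact: nbhs_dnbhs lip.
    have desth : `|F (G y + (G (h *: v + y) - G y)) - F (G y) - 'D_(G (h *: v + y) - G y) F (G y)|
        <= e1 * `|G (h *: v + y) - G y| by near: h; exact: nbhs_dnbhs dest.
    have [UGh FGh] := GP _ yvh.
    rewrite [G y + _]addrC subrK FGh FG addrK in desth.
    set d := G (h *: v + y) - G y in liph desth *.
    have hd : `|h *: w - d| <= 2 * (e1 * `|d|).
      have := Dz (h *: w - d).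
      rewrite deriveD_dir // deriveN_dir // deriveZ_dir // Dw.
      have := lerB_dist (h *: w - d) (h *: v - 'D_d F (G y)).
      rewrite [`|h *: w - d - _|]distrC.
      move: desth; move: `|h *: w - d| `|h *: v - _| `|h *: v - _ - _| => p q s.
      by move: (e1 * `|d|) => k; lra.
    have -> : w - h^-1 *: d = h^-1 *: (h *: w - d).
      by clearbody d; apply/rowP => j; rewrite !mxE; field.
    rewrite normrZ normrV ?unitfE // ler_pdivrMl ?normr_gt0 //.
    apply: le_trans hd _.
    apply: (@le_trans _ _ (2 * (e1 * (2 * `|h| * `|v|)))).
      by rewrite ler_wpM2l // ler_wpM2l // ltW.
    apply: (@le_trans _ _ (`|h| * (e1 * (4 * (1 + `|v|))))).
      have p1 : 0 <= `|h| * e1 by rewrite mulr_ge0 // ltW.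
      by move: p1; move: `|v| => q; nra.
    by rewrite /e1 divfK // mulf_neq0 // gt_eqF.
  split; first by apply/cvg_ex; exists w.
  exact: cvg_lim qcvg.
- move=> x xr; apply: GU; rewrite /U /=; apply: le_trans (ltW xr) _.
  by move: rho0; lra.
Unshelve. all: by end_near. Qed.

End LocalInverse.

(** * Folds of the plane *)

Section Fold.
Variable R : realType.

Lemma forall_I2 (P : 'I_2 -> Prop) : P 0 -> P 1 -> forall i, P i.
Proof.
move=> P0 P1 [[|[|//]] i2].
  by rewrite (_ : Ordinal i2 = 0) //; exact: val_inj.
by rewrite (_ : Ordinal i2 = 1) //; exact: val_inj.
Qed.

Definition row2 (a b : R) : 'rV[R]_2 := \row_i nth 0 [:: a; b] i.

Lemma row2_0 a b : row2 a b 0 0 = a. Proof. by rewrite mxE. Qed.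
Lemma row2_1 a b : row2 a b 0 1 = b. Proof. by rewrite mxE. Qed.

Lemma row2P (u v : 'rV[R]_2) : u 0 0 = v 0 0 -> u 0 1 = v 0 1 -> u = v.
Proof. by move=> e0 e1; apply/rowP; exact: forall_I2. Qed.

Lemma row2_eta (u : 'rV[R]_2) : u = row2 (u 0 0) (u 0 1).
Proof. by apply: row2P; rewrite ?row2_0 ?row2_1. Qed.

Lemma normr_row2_lt (a b r : R) : `|a| < r -> `|b| < r -> `|row2 a b| < r.
Proof.
move=> ar br; have r0 : 0 < r by apply: le_lt_trans ar.
apply: (@le_lt_trans _ _ (Num.max `|a| `|b|)); last by rewrite gt_max ar.
apply: normr_row_le; first by rewrite le_max normr_ge0.
by apply: forall_I2; rewrite ?row2_0 ?row2_1 le_max lexx ?orbT.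
Qed.

Lemma near_at_right_dnbhs (P : R -> Prop) (x : R) :
  (\forall h \near x^', P h) -> \forall h \near x^'+, P h.
Proof.
move=> /nbhs_ballP[e /= e0 H]; apply/nbhs_ballP; exists e => //= y ye xy.
by apply: H => //=; rewrite gt_eqF.
Qed.

Lemma near_at_right_nbhs (P : R -> Prop) (x : R) :
  (\forall h \near x, P h) -> \forall h \near x^'+, P h.
Proof. by move=> /nbhs_dnbhs/near_at_right_dnbhs. Qed.

Lemma derive_gt0_right (q : R -> R) (k : R) :
  is_derive (0 : R) 1 q k -> q 0 = 0 -> 0 < k ->
  \forall s \near 0^'+, 0 < q s.
Proof.
move=> [dq qk] q0 k0.
have qc : h^-1 *: (q (h *: 1 + 0) - q 0) @[h --> 0^'] --> k.
  by move: dq => /cvg_ex[l Hl]; rewrite -qk /derive; move/cvg_lim: (Hl) => ->.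
have : \forall h \near 0^'+, 0 < h^-1 *: (q (h *: 1 + 0) - q 0).
  apply: near_at_right_dnbhs; have := cvgr_gt k qc 0 k0; exact.
move=> H; near=> s.
have s0 : 0 < s by [].
have : 0 < s^-1 *: (q (s *: 1 + 0) - q 0) by near: s.
rewrite q0 subr0 addr0 -[s *: 1]/(s * 1) mulr1.
by rewrite -[_ *: _]/(_ * _) pmulr_rgt0 ?invr_gt0.
Unshelve. all: by end_near. Qed.

Lemma derive_lt0_right (q : R -> R) (k : R) :
  is_derive (0 : R) 1 q k -> q 0 = 0 -> k < 0 ->
  \forall s \near 0^'+, q s < 0.
Proof.
move=> dq q0 k0.
have dNq : is_derive (0 : R) 1 (- q) (- k) by exact: is_deriveN.
have := derive_gt0_right dNq; rewrite /= !fctE q0 oppr0 oppr_gt0 => /(_ erefl k0).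
by apply: filterS => s; rewrite /= oppr_gt0.
Qed.

Lemma derivable_near_right (q : R -> R) (k : R) (B : set R) :
  is_derive (0 : R) 1 q k -> open B -> B (q 0) -> \forall s \near 0^'+, B (q s).
Proof.
move=> [dq _] oB Bq; apply: near_at_right_nbhs.
have cq : {for 0, continuous q}.
  by apply: differentiable_continuous; apply/derivable1_diffP.
by apply: (cq B); exact: open_nbhs_nbhs.
Qed.

Lemma is_derive_comp_dir (U V W : normedModType R) (f : V -> W) (g : U -> V)
    x v w :
  is_derive x v g w -> differentiable f (g x) ->
  is_derive x v (fun y => f (g y)) ('D_w f (g x)).
Proof.
move=> [dg gw] df.
have lineE (Z : normedModType R) (k : U -> Z) :
    'D_v k x = 'D_1 (fun h : R => k (h *: v + x)) 0.
  have E : (fun h : R => h^-1 *: (k (h *: v + x) - k x)) =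
    (fun h : R => h^-1 *: (k ((h *: (1 : R) + 0) *: v + x) - k (0 *: v + x))).
    apply/funext => h.
    by rewrite addr0 -[h *: (1 : R)]/(h * 1) mulr1 scale0r add0r.
  by rewrite /derive /= E.
have dl : differentiable (fun h : R => g (h *: v + x)) 0.
  by apply/derivable1_diffP; move/derivable1P: dg.
have g0 : g (0 *: v + x) = g x by rewrite scale0r add0r.
have df' : differentiable f (g (0 *: v + x)) by rewrite g0.
apply: DeriveDef.
  apply/derivable1P/derivable1_diffP.
  exact: (differentiable_comp dl df').
by rewrite lineE (derive_comp (1 : R) dl df') -lineE gw g0.
Qed.

Lemma is_derive_row2_0 (F : 'rV[R]_2 -> R) y e k :
  is_derive (row2 y e) (row2 1 0) F k -> is_derive y 1 (fun s => F (row2 s e)) k.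
Proof.
move=> [dF Fk].
have E : (fun h : R => h^-1 *: (F (row2 (h *: 1 + y) e) - F (row2 y e))) =
  (fun h : R => h^-1 *: (F (h *: row2 1 0 + row2 y e) - F (row2 y e))).
  apply/funext => h; congr (_ *: (F _ - _)); apply: row2P.
    by rewrite !mxE.
  by rewrite !mxE /= mulr0 add0r.
apply: DeriveDef; first by rewrite /derivable /= E.
by rewrite /derive /= E.
Qed.

Lemma is_derive_row2_1 (F : 'rV[R]_2 -> R) y e k :
  is_derive (row2 y e) (row2 0 1) F k -> is_derive e 1 (fun s => F (row2 y s)) k.
Proof.
move=> [dF Fk].
have E : (fun h : R => h^-1 *: (F (row2 y (h *: 1 + e)) - F (row2 y e))) =
  (fun h : R => h^-1 *: (F (h *: row2 0 1 + row2 y e) - F (row2 y e))).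
  apply/funext => h; congr (_ *: (F _ - _)); apply: row2P.
    by rewrite !mxE /= mulr0 add0r.
  by rewrite !mxE.
apply: DeriveDef; first by rewrite /derivable /= E.
by rewrite /derive /= E.
Qed.

Lemma is_derive_coord (V : normedModType R) m n (A : V -> 'M[R]_(m, n)) i j x v w :
  is_derive x v A w -> is_derive x v (fun y => A y i j) (w i j).
Proof.
move=> [dA <-]; apply: DeriveDef; first by move/derivable_mxP: dA; exact.
by rewrite derive_mx // mxE.
Qed.

Lemma is_derive_continuous (f : R -> R) (x k : R) :
  is_derive x (1 : R) f k -> {for x, continuous f}.
Proof.
by move=> [df _]; apply: differentiable_continuous; apply/derivable1_diffP.
Qed.

(** At x0 the differential of (f1, f2) has rank one. Its kernel T is transversal
    to the curve h = 0, and on the side 0 < h of this curve f2 increases with h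
    along the level curves of f1. *)
Section FoldPoint.
Variables (f1 f2 h : 'rV[R]_2 -> R) (x0 X T : 'rV[R]_2).
Hypotheses (sf1 : smooth_at f1 x0) (sf2 : smooth_at f2 x0) (sh : smooth_at h x0).
Hypotheses (f1x0 : f1 x0 = 0) (f2x0 : f2 x0 = 0) (hx0 : h x0 = 0).
Hypotheses (Xf1 : 'D_X f1 x0 != 0) (Tf1 : 'D_T f1 x0 = 0).
Hypotheses (Xh : 'D_X h x0 = 0) (Th : 'D_T h x0 != 0).
Hypothesis Xf2 : 'D_X f2 x0 = 0.
Hypothesis rising : \forall x \near x0, 0 < h x ->
  forall w, 'D_w f1 x = 0 -> 0 < 'D_w h x -> 0 < 'D_w f2 x.

(* In the frame (X1, T1) the differential of (f1, h) at x0 is the identity. *)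
Let X1 := ('D_X f1 x0)^-1 *: X.
Let T1 := ('D_T h x0)^-1 *: T.
Let A (z : 'rV[R]_2) : 'rV[R]_2 := x0 + (z 0 0 *: X1 + z 0 1 *: T1).
Let L (z : 'rV[R]_2) : 'rV[R]_2 := z 0 0 *: X1 + z 0 1 *: T1.

Let coord_smooth (i : 'I_2) (z : 'rV[R]_2) : smooth_at (fun z : 'rV[R]_2 => z 0 i) z.
Proof. by apply: smooth_at_coord; exact: smooth_at_id. Qed.

Let sA z : smooth_at A z.
Proof.
apply: smooth_atD; first exact: smooth_at_cst.
by apply: smooth_atD; apply: smooth_atZ => //; exact: smooth_at_cst.
Qed.

Let A0 : A 0 = x0.
Proof. by rewrite /A !mxE !scale0r !addr0. Qed.

Let DA w z : 'D_w A z = L w.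
Proof.
have dc i : differentiable (fun z : 'rV[R]_2 => z 0 i) z.
  exact: smooth_at_diff.
have Dc i : 'D_w (fun z : 'rV[R]_2 => z 0 i) z = w 0 i.
  by rewrite (derive_coord _ _ _ (differentiable_idfun z)) derive_id.
have dZ i (u : 'rV[R]_2) : differentiable (fun z : 'rV[R]_2 => z 0 i *: u) z.
  exact: differentiable_scale.
have DZ i (u : 'rV[R]_2) : 'D_w (fun z : 'rV[R]_2 => z 0 i *: u) z = w 0 i *: u.
  rewrite (derive_scale _ (dc i) (differentiable_cst u z)).
  by rewrite derive_cst scaler0 add0r Dc.
rewrite /A deriveD; [|exact: derivable_cst|].
  rewrite derive_cst add0r deriveD ?DZ //; exact: diff_derivable.
by apply: diff_derivable; exact: differentiableD.
Qed.

Let P z := row2 (f1 (A z)) (h (A z)).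

Let sP z : smooth_at f1 (A z) -> smooth_at h (A z) -> smooth_at P z.
Proof.
move=> s1 s2; apply: smooth_at_mx => i; apply: forall_I2.
  apply: (@smooth_at_near _ _ _ (fun z => f1 (A z))).
    by near=> y; rewrite ord1 row2_0.
  exact: smooth_at_comp.
apply: (@smooth_at_near _ _ _ (fun z => h (A z))).
  by near=> y; rewrite ord1 row2_1.
exact: smooth_at_comp.
Unshelve. all: by end_near. Qed.

Let DcompA (f : 'rV[R]_2 -> R) z w : differentiable f (A z) ->
  'D_w (fun z => f (A z)) z = 'D_(L w) f (A z).
Proof.
by move=> df; rewrite (derive_comp w (smooth_at_diff (sA z)) df) DA.
Qed.

Let DP z w : smooth_at f1 (A z) -> smooth_at h (A z) ->
  'D_w P z = row2 ('D_(L w) f1 (A z)) ('D_(L w) h (A z)).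
Proof.
move=> s1 s2; have dP := smooth_at_diff (sP s1 s2).
apply: row2P; rewrite -derive_coord //.
  rewrite row2_0 -DcompA; last exact: smooth_at_diff.
  by congr ('D_w _ z); apply/funext => y; rewrite row2_0.
rewrite row2_1 -DcompA; last exact: smooth_at_diff.
by congr ('D_w _ z); apply/funext => y; rewrite row2_1.
Qed.

Let DP0 w : 'D_w P 0 = w.
Proof.
have df1 := smooth_at_diff sf1; have dh := smooth_at_diff sh.
rewrite DP ?A0 // /L !deriveD_dir // /X1 /T1 !deriveZ_dir //.
rewrite Tf1 Xh !scaler0 addr0 add0r.
apply: row2P; rewrite ?row2_0 ?row2_1.
  by rewrite -[_^-1 *: _]/(_^-1 * _) mulVf // -[_ *: _]/(_ * _) mulr1.
by rewrite -[_^-1 *: _]/(_^-1 * _) mulVf // -[_ *: _]/(_ * _) mulr1.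
Qed.

(* In the coordinates (f1, h) the map (f1, f2) has the form
   (y, e) |-> (y, m y e). *)
Let fold_coordinates : exists (r : R) (G : 'rV[R]_2 -> 'rV[R]_2), [/\ 0 < r,
  forall y e, `|y| < r -> `|e| < r ->
    [/\ f1 (A (G (row2 y e))) = y, h (A (G (row2 y e))) = e,
       forall v, exists w,
         is_derive (row2 y e) v (fun z => f2 (A (G z))) ('D_w f2 (A (G (row2 y e))))
         /\ row2 ('D_w f1 (A (G (row2 y e)))) ('D_w h (A (G (row2 y e)))) = v &
       0 < e -> forall w, 'D_w f1 (A (G (row2 y e))) = 0 ->
         0 < 'D_w h (A (G (row2 y e))) -> 0 < 'D_w f2 (A (G (row2 y e)))],
  (forall y, `|y| < r -> `|G y| <= 2 * `|y|),
  is_derive (row2 0 0) (row2 1 0) (fun z => f2 (A (G z))) 0 &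
  forall x, `|x| < r -> G (P x) = x].
Proof.
have P0 : P 0 = 0.
  by rewrite /P A0 f1x0 hx0; apply: row2P; rewrite ?row2_0 ?row2_1 mxE.
have sP0 : smooth_at P 0 by apply: sP; rewrite A0.
have [r [G [r0 HG GP]]] := local_inverse sP0 P0 DP0.
have near0 : \forall z \near (0 : 'rV[R]_2),
    [/\ smooth_at f1 (A z), smooth_at f2 (A z), smooth_at h (A z) &
     0 < h (A z) -> forall w, 'D_w f1 (A z) = 0 -> 0 < 'D_w h (A z) -> 0 < 'D_w f2 (A z)].
  have cA := smooth_at_cont (sA 0).
  have n1 := smooth_at_nbhs sf1; have n2 := smooth_at_nbhs sf2.
  have n3 := smooth_at_nbhs sh; have n4 := rising.
  rewrite -A0 in n1 n2 n3 n4.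
  near=> z; split.
  - by near: z; exact: (cA _ n1).
  - by near: z; exact: (cA _ n2).
  - by near: z; exact: (cA _ n3).
  - by near: z; exact: (cA _ n4).
have /nbhs_ballP[d /= d0 Hd] := near0.
pose r1 := Num.min r (d / 2).
have r10 : 0 < r1 by rewrite lt_min r0 divr_gt0.
have r1r x : x < r1 -> x < r by rewrite lt_min => /andP[].
exists r1, G; split=> //; last 3 first.
- by move=> y /r1r/HG[].
- have E : row2 0 0 = 0 :> 'rV[R]_2 by apply: row2P; rewrite ?row2_0 ?row2_1 mxE.
  have G0 : G (row2 0 0) = 0 by rewrite E -{1}P0 GP // normr0.
  have [_ _ /(_ (row2 1 0))[w Dw dG]] : [/\ P (G (row2 0 0)) = row2 0 0,
    `|G (row2 0 0)| <= 2 * `|row2 0 0 : 'rV[R]_2| & forall v, exists2 w,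
       'D_w P (G (row2 0 0)) = v & is_derive (row2 0 0) v G w].
    by apply: HG; rewrite E normr0.
  have wE : w = row2 1 0 by rewrite -Dw G0 DP0.
  have dE : 'D_w (fun z => f2 (A z)) (G (row2 0 0)) = 0.
    rewrite DcompA ?G0 ?A0; last exact: smooth_at_diff.
    rewrite wE /L row2_0 row2_1 scale0r addr0 scale1r /X1.
    by rewrite deriveZ_dir ?Xf2 ?scaler0 //; exact: smooth_at_diff.
  have df : differentiable (fun z => f2 (A z)) (G (row2 0 0)).
    by rewrite G0; apply: smooth_at_diff; apply: smooth_at_comp => //; rewrite A0.
  by have := is_derive_comp_dir dG df; rewrite dE.
- by move=> x /r1r; exact: GP.
move=> y e yr er.
have nr : `|row2 y e| < r1 by exact: normr_row2_lt.
have [PG Gle DG] := HG _ (r1r _ nr).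
have [s1 s2 s3 ris] : [/\ smooth_at f1 (A (G (row2 y e))),
   smooth_at f2 (A (G (row2 y e))), smooth_at h (A (G (row2 y e))) &
   0 < h (A (G (row2 y e))) -> forall w, 'D_w f1 (A (G (row2 y e))) = 0 ->
    0 < 'D_w h (A (G (row2 y e))) -> 0 < 'D_w f2 (A (G (row2 y e)))].
  apply: Hd; rewrite -ball_normE /= sub0r normrN.
  apply: le_lt_trans Gle _; rewrite mulrC -ltr_pdivlMr //.
  by move: nr; rewrite lt_min => /andP[].
have f1E : f1 (A (G (row2 y e))) = y.
  by have /rowP/(_ 0) := PG; rewrite !row2_0.
have hE : h (A (G (row2 y e))) = e.
  by have /rowP/(_ 1) := PG; rewrite !row2_1.
split=> //; last by move=> e0; apply: ris; rewrite hE.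
move=> v; have [w Dw dG] := DG v; exists (L w); split; last first.
  by rewrite -DP.
rewrite -DcompA; last exact: smooth_at_diff.
apply: (is_derive_comp_dir dG).
by apply: smooth_at_diff; exact: smooth_at_comp.
Unshelve. all: by end_near. Qed.

(** Over each y the image of 0 < h is an open interval that begins at the image
    of the curve h = 0. This curve is tangent to the first axis, so the curves p
    with p' = (0, v) are on one side of it. *)
Lemma fold_image : exists2 U : set 'rV[R]_2, open_nbhs x0 U &
  (exists O : set 'rV[R]_2, [/\ open O,
    forall x, U x -> 0 < h x -> ~ O (row2 (f1 x) (f2 x)) &
    forall (p : R -> 'rV[R]_2) v, p 0 = 0 -> is_derive (0 : R) 1 p v ->
      v 0 0 = 0 -> v 0 1 < 0 -> \forall s \near 0^'+, O (p s)]) /\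
  (forall W : set 'rV[R]_2, open_nbhs x0 W ->
    exists O : set 'rV[R]_2, [/\ open O,
    forall y, O y -> exists x, [/\ W x, 0 < h x & y = row2 (f1 x) (f2 x)] &
    forall (p : R -> 'rV[R]_2) v, p 0 = 0 -> is_derive (0 : R) 1 p v ->
      v 0 0 = 0 -> 0 < v 0 1 -> \forall s \near 0^'+, O (p s)]).
Proof.
have [r [G [r0 HG Gle dG0 GP]]] := fold_coordinates.
(* The point with f1 = y and h = e is mapped to (y, M y e). M y increases on
   0 <= e, and the graph of g = M ^~ 0 is the image of the curve h = 0. *)
pose M y e := f2 (A (G (row2 y e))).
have abs_lt (a : R) : 0 <= a < r -> `|a| < r by move=> /andP[a0 ar]; rewrite ger0_norm.
have MdY y e : `|y| < r -> `|e| < r -> exists k, is_derive y (1 : R) (M ^~ e) k.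
  move=> yr er; have [_ _ /(_ (row2 1 0))[w [dw _]] _] := HG _ _ yr er.
  by exists ('D_w f2 (A (G (row2 y e)))); exact: (@is_derive_row2_0 (fun z => f2 (A (G z)))).
have MdE y e : `|y| < r -> `|e| < r -> exists2 k, is_derive e (1 : R) (M y) k & 0 < e -> 0 < k.
  move=> yr er; have [_ _ /(_ (row2 0 1))[w [dw wE]] ris] := HG _ _ yr er.
  exists ('D_w f2 (A (G (row2 y e)))); first exact: (@is_derive_row2_1 (fun z => f2 (A (G z)))).
  have /rowP wE' := wE; move=> e0; apply: ris => //.
    by have := wE' 0; rewrite !row2_0.
  by have := wE' 1; rewrite !row2_1 => ->.
have Mcont y a b : `|y| < r -> `|a| < r -> `|b| < r -> {within `[a, b], continuous (M y)}.
  move=> yr ar br; apply: derivable_within_continuous => s; rewrite in_itv /= => /andP[as_ sb].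
  have sr : `|s| < r.
    by move: ar br; rewrite !ltr_norml => /andP[? ?] /andP[? ?]; apply/andP; split; lra.
  by have [k [dk _] _] := MdE _ _ yr sr.
have Minc y a b : `|y| < r -> 0 <= a -> a < b -> b < r -> M y a < M y b.
  move=> yr a0 ab br.
  have [||c cab E] := @MVT R (M y) (fun s => 'D_1 (M y) s) a b ab.
  - move=> s; rewrite in_itv /= => /andP[as_ sb].
    have [|k [dk kE] _] := MdE y s yr.
      by apply: abs_lt; move: as_ sb; lra.
    exact: DeriveDef.
  - by apply: Mcont => //; apply: abs_lt; lra.
  rewrite -subr_gt0 E mulr_gt0 ?subr_gt0 //.
  move: cab; rewrite in_itv /= => /andP[ac cb].
  have [|k [dk kE] k0] := MdE y c yr.
    by apply: abs_lt; move: ac cb; lra.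
  by rewrite kE; apply: k0; move: ac; lra.
have r00 : `|0 : R| < r by rewrite normr0.
have M0 : M 0 0 = 0.
  have P0 : P 0 = 0.
    by rewrite /P A0 f1x0 hx0; apply: row2P; rewrite ?row2_0 ?row2_1 mxE.
  have E : row2 0 0 = 0 :> 'rV[R]_2 by apply: row2P; rewrite ?row2_0 ?row2_1 mxE.
  by rewrite /M E -P0 GP ?normr0 // A0.
have dg0 : is_derive (0 : R) 1 (M ^~ 0) 0.
  exact: (@is_derive_row2_0 (fun z => f2 (A (G z)))).
pose g y := M y 0.
have curve (p : R -> 'rV[R]_2) v : p 0 = 0 -> is_derive (0 : R) 1 p v ->
    v 0 0 = 0 -> [/\ p 0 0 0 = 0, is_derive (0 : R) 1 (fun s => p s 0 0) 0 &
     is_derive (0 : R) 1 (fun s => p s 0 1 - g (p s 0 0)) (v 0 1)].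
  move=> p0 dp v0; split; first by rewrite p0 mxE.
    by have := is_derive_coord 0 0 dp; rewrite v0.
  have dp0 : is_derive (0 : R) 1 (fun s => p s 0 0) 0.
    by have := is_derive_coord 0 0 dp; rewrite v0.
  have dgp : is_derive (0 : R) 1 (fun s => g (p s 0 0)) ('D_0 g (p 0 0 0)).
    apply: (is_derive_comp_dir dp0).
    by rewrite p0 mxE; apply/derivable1_diffP; have [] := dg0.
  rewrite derive0 in dgp.
  by have := is_deriveB (is_derive_coord 0 1 dp) dgp; rewrite subr0.
have curveM (p : R -> 'rV[R]_2) v (e : R) : p 0 = 0 -> is_derive (0 : R) 1 p v -> `|e| < r ->
    exists k, is_derive (0 : R) 1 (fun s => p s 0 1 - M (p s 0 0) e) k.
  move=> p0 dp er; have [k dk] := MdY 0 e r00 er; eexists.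
  apply: (is_deriveB (is_derive_coord 0 1 dp)).
  apply: (@is_derive_comp_dir _ _ _ (M ^~ e) _ _ _ _ (is_derive_coord 0 0 dp)).
  by rewrite p0 mxE; apply/derivable1_diffP; have [] := dk.
have pr (p : R -> 'rV[R]_2) v (e : R) : p 0 = 0 -> is_derive (0 : R) 1 p v ->
    0 < e -> \forall s \near 0^'+, `|p s 0 0| < e.
  move=> p0 dp e0.
  apply: (derivable_near_right (B := [set x | `|x| < e]) (is_derive_coord 0 0 dp)).
    apply: (@open_comp _ _ (fun z : R => `|z|) [set x | x < e]).
      by move=> z _; exact: norm_continuous.
    exact: open_lt.
  by rewrite /= p0 mxE normr0.
have near_coord (y : 'rV[R]_2) (e : R) : `|y 0 0| < e -> nbhs y [set z : 'rV[R]_2 | `|z 0 0| < e].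
  move=> ye; apply: ((@coord_continuous R 1 2 0 0 y) [set a | `|a| < e]).
  apply: (@norm_continuous _ _ (y 0 0) [set x | x < e]).
  by apply: open_nbhs_nbhs; split => //; exact: open_lt.
have Mnear (y : 'rV[R]_2) (e : R) : `|y 0 0| < r -> `|e| < r ->
    {for y, continuous (fun z : 'rV[R]_2 => M (z 0 0) e - z 0 1)}.
  move=> yr er.
  have c1 : {for y, continuous (fun z : 'rV[R]_2 => M (z 0 0) e)}.
    apply: (@continuous_comp _ _ _ (fun z : 'rV[R]_2 => z 0 0) (M ^~ e)).
      exact: coord_continuous.
    by have [k dk] := MdY _ _ yr er; exact: is_derive_continuous dk.
  have c2 : {for y, continuous (fun z : 'rV[R]_2 => z 0 1)}.
    exact: coord_continuous.
  exact: (cvgB c1 c2).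
have openP (O : set 'rV[R]_2) : (forall y, O y -> nbhs y O) -> open O.
  by move=> HO; rewrite openE => y /HO.
pose U : set 'rV[R]_2 := [set x | exists z, [/\ x = A z, `|z| < r & `|P z| < r]].
have Ux0 : nbhs x0 U.
  pose ML : 'M[R]_2 := \matrix_(i, j) (if i == 0 then X1 0 j else T1 0 j).
  pose MB : 'M[R]_2 := \matrix_(i, j)
    row2 ('D_(basis_vec R i) f1 x0) ('D_(basis_vec R i) h x0) 0 j.
  have LE z : z *m ML = L z.
    apply/rowP => j; rewrite !mxE big_ord_recl big_ord1 !mxE /=.
    by rewrite (_ : lift ord0 ord0 = 1) //; exact: val_inj.
  have BE w : w *m MB = row2 ('D_w f1 x0) ('D_w h x0).
    have df1 := smooth_at_diff sf1; have dh := smooth_at_diff sh.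
    apply: row2P; rewrite ?row2_0 ?row2_1 mxE derive_basis //.
      by apply: eq_bigr => i _; rewrite mxE row2_0.
    by apply: eq_bigr => i _; rewrite mxE row2_1.
  have LB : MB *m ML = 1%:M.
    apply: mulmx1C; apply/row_matrixP => i; rewrite row_mul (rowE _ ML) LE BE.
    have := DP0 (delta_mx 0 i); rewrite DP A0 // => ->.
    by rewrite rowE mulmx1.
  have cz : {for x0, continuous (fun x => (x - x0) *m MB)}.
    apply: smooth_at_cont; apply: smooth_at_mulmx; last exact: smooth_at_cst.
    by apply: smooth_atB; [exact: smooth_at_id|exact: smooth_at_cst].
  have cP : {for 0, continuous P} by apply: smooth_at_cont; apply: sP; rewrite A0.
  have P0 : P 0 = 0.
    by rewrite /P A0 f1x0 hx0; apply: row2P; rewrite ?row2_0 ?row2_1 mxE.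
  have nr : \forall z \near (0 : 'rV[R]_2), `|z| < r.
    by apply/nbhs_ballP; exists r => // z; rewrite -ball_normE /= sub0r normrN.
  have nP : \forall z \near (0 : 'rV[R]_2), `|P z| < r.
    by apply: (cP [set z | `|z| < r]); rewrite P0.
  have nz (Q : 'rV[R]_2 -> Prop) : (\forall z \near (0 : 'rV[R]_2), Q z) ->
      \forall x \near x0, Q ((x - x0) *m MB).
    by move=> nQ; apply: (cz Q); rewrite subrr mul0mx.
  apply: filterS2 (nz _ nr) (nz _ nP) => x xr xP; exists ((x - x0) *m MB); split => //.
  by rewrite /A -/(L _) -LE -mulmxA LB mulmx1 addrC subrK.
exists (U°); first by split; [exact: open_interior|].
split.
  exists [set y : 'rV[R]_2 | `|y 0 0| < r /\ y 0 1 < g (y 0 0)]; split.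
  - apply: openP => y [yr yg]; have cy := Mnear y 0 yr r00.
    have y0 : 0 < M (y 0 0) 0 - y 0 1 by rewrite subr_gt0.
    apply: filterS2 (near_coord y r yr) (cvgr_gt _ cy _ y0) => z zr /=.
    by rewrite subr_gt0.
  - move=> x /interior_subset[z [-> zr Pzr]] hz [_].
    rewrite row2_0 row2_1; apply/negP; rewrite -leNgt.
    have f1r : `|f1 (A z)| < r.
      by apply: le_lt_trans Pzr; have := normr_coord_le (P z) 0; rewrite row2_0.
    have hr : h (A z) < r.
      apply: le_lt_trans Pzr; apply: le_trans (ler_norm _) _.
      by have := normr_coord_le (P z) 1; rewrite row2_1.
    apply: ltW; have := Minc _ _ _ f1r (lexx 0) hz hr.
    by rewrite /M -/(P z) GP.
  - move=> p v p0 dp v0 v1.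
    have [p00 dp0 dq] := curve p v p0 dp v0.
    have q0 : p 0 0 1 - g (p 0 0 0) = 0 by rewrite p0 mxE mxE /g M0 subrr.
    have := derive_lt0_right dq q0 v1.
    have := pr p v r p0 dp r0.
    apply: filterS2 => s ? ?; split => //; by rewrite -subr_lt0.
move=> W [oW W0].
have [eps [eps0 epsr WG]] : exists eps, [/\ 0 < eps, eps < r &
    forall y e, `|y| < eps -> `|e| <= eps -> W (A (G (row2 y e)))].
  have nW : \forall z \near (0 : 'rV[R]_2), W (A z).
    by apply: (smooth_at_cont (sA 0)); rewrite A0; exact: open_nbhs_nbhs.
  have /nbhs_ballP[d /= d0 Hd] := nW.
  have e0 : 0 < Num.min (r / 2) (d / 4) by rewrite lt_min !divr_gt0.
  have er : Num.min (r / 2) (d / 4) <= r / 2 by rewrite ge_min lexx.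
  have ed : Num.min (r / 2) (d / 4) <= d / 4 by rewrite ge_min lexx orbT.
  exists (Num.min (r / 2) (d / 4)); split=> //; first by move: r0 er; lra.
  move: (Num.min _ _) e0 er ed => eps e0 er ed y e ye ee.
  have n1 : `|row2 y e| < r.
    by apply: normr_row2_lt; [move: ye r0 er | move: ee r0 er]; lra.
  have n2 : `|row2 y e| < d / 2.
    by apply: normr_row2_lt; [move: ye d0 ed | move: ee d0 ed]; lra.
  apply: Hd; rewrite -ball_normE /= sub0r normrN.
  by apply: le_lt_trans (Gle _ n1) _; move: n2; lra.
have epsr' : `|eps| < r by rewrite gtr0_norm.
exists [set y : 'rV[R]_2 | [/\ `|y 0 0| < eps, g (y 0 0) < y 0 1 &
  y 0 1 < M (y 0 0) eps]]; split.
- apply: openP => y [ye yg yM]; have yr : `|y 0 0| < r by apply: lt_trans epsr.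
  have y0 : M (y 0 0) 0 - y 0 1 < 0 by rewrite subr_lt0.
  have y1 : 0 < M (y 0 0) eps - y 0 1 by rewrite subr_gt0.
  apply: filterS3 (near_coord y eps ye) (cvgr_lt _ (Mnear y 0 yr r00) _ y0)
    (cvgr_gt _ (Mnear y eps yr epsr') _ y1) => z z1 /=.
  by rewrite subr_lt0 subr_gt0.
- move=> y [yr gy yM].
  have yr' : `|y 0 0| < r by apply: lt_trans epsr.
  have [e eI Me] : exists2 c, c \in `[0, eps]%R & M (y 0 0) c = y 0 1.
    apply: IVT; first exact: ltW.
      by apply: Mcont => //; apply: abs_lt; rewrite ltW //=.
    by rewrite ge_min le_max (ltW gy) (ltW yM) orbT.
  move: eI; rewrite in_itv /= => /andP[e0 ee].
  have e0' : 0 < e.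
    rewrite lt_def e0 andbT; apply/eqP => eE; move: gy.
    by rewrite -Me eE /g ltxx.
  have er : `|e| < r by apply: abs_lt; rewrite e0 /=; apply: le_lt_trans epsr.
  have [f1E hE _ _] := HG _ _ yr' er.
  exists (A (G (row2 (y 0 0) e))); split.
  + by apply: WG => //; rewrite ger0_norm.
  + by rewrite hE.
  + by rewrite f1E -[f2 _]/(M (y 0 0) e) Me -row2_eta.
- move=> p v p0 dp v0 v1.
  have [p00 dp0 dq] := curve p v p0 dp v0.
  have q0 : p 0 0 1 - g (p 0 0 0) = 0 by rewrite p0 mxE mxE /g M0 subrr.
  have n1 := derive_gt0_right dq q0 v1.
  have n2 := pr p v eps p0 dp eps0.
  have [k dk] := curveM p v eps p0 dp epsr'.
  have k0 : p 0 0 1 - M (p 0 0 0) eps < 0.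
    have Me : 0 < M 0 eps by have := Minc 0 0 eps r00 (lexx 0) eps0 epsr; rewrite M0.
    by rewrite p0 mxE mxE sub0r oppr_lt0.
  have n3 := derivable_near_right dk (@open_lt _ 0) k0.
  apply: filterS3 n1 n2 n3 => s /=; rewrite subr_gt0 subr_lt0 => ? ? ?; by split.
Qed.

End FoldPoint.

End Fold.

(** * Inner products and the vector product *)

Section Inner.
Variables (R : realType) (n : nat).
Implicit Types (G : 'M[R]_n) (u v w : 'rV[R]_n).

Lemma innerE G u v : inner G u v = \sum_i \sum_j u 0 i * G i j * v 0 j.
Proof.
rewrite /inner mxE exchange_big /=; apply: eq_bigr => j _.
by rewrite !mxE mulr_suml.
Qed.

Lemma innerDl G u v w : inner G (u + v) w = inner G u w + inner G v w.
Proof. by rewrite /inner !mulmxDl mxE. Qed.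
Lemma innerDr G u v w : inner G u (v + w) = inner G u v + inner G u w.
Proof. by rewrite /inner linearD /= mulmxDr mxE. Qed.
Lemma innerZl G k u v : inner G (k *: u) v = k * inner G u v.
Proof. by rewrite /inner -!scalemxAl mxE. Qed.
Lemma innerZr G k u v : inner G u (k *: v) = k * inner G u v.
Proof. by rewrite /inner linearZ /= -scalemxAr mxE. Qed.
Lemma innerNl G u v : inner G (- u) v = - inner G u v.
Proof. by rewrite -scaleN1r innerZl mulN1r. Qed.
Lemma innerNr G u v : inner G u (- v) = - inner G u v.
Proof. by rewrite -scaleN1r innerZr mulN1r. Qed.
Lemma innerBl G u v w : inner G (u - v) w = inner G u w - inner G v w.
Proof. by rewrite innerDl innerNl. Qed.
Lemma innerBr G u v w : inner G u (v - w) = inner G u v - inner G u w.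
Proof. by rewrite innerDr innerNr. Qed.
Lemma inner0l G v : inner G 0 v = 0.
Proof. by rewrite -(scale0r v) innerZl mul0r. Qed.
Lemma inner0r G v : inner G v 0 = 0.
Proof. by rewrite -(scale0r v) innerZr mul0r. Qed.
Lemma inner_sumr G u (I : Type) (r : seq I) (F : I -> 'rV[R]_n) :
  inner G u (\sum_(i <- r) F i) = \sum_(i <- r) inner G u (F i).
Proof. by apply: (big_morph (inner G u)); [exact: innerDr|exact: inner0r]. Qed.
Lemma inner_suml G u (I : Type) (r : seq I) (F : I -> 'rV[R]_n) :
  inner G (\sum_(i <- r) F i) u = \sum_(i <- r) inner G (F i) u.
Proof.
apply: (big_morph (fun v => inner G v u)); last exact: inner0l.
by move=> v w; exact: innerDl.
Qed.

Lemma innerDmx G G' u v : inner (G + G') u v = inner G u v + inner G' u v.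
Proof. by rewrite /inner mulmxDr mulmxDl mxE. Qed.
Lemma innerZmx k G u v : inner (k *: G) u v = k * inner G u v.
Proof. by rewrite /inner -scalemxAr -scalemxAl mxE. Qed.

Lemma innerC G u v : G^T = G -> inner G u v = inner G v u.
Proof.
move=> sG; rewrite /inner -[in LHS](trmxK (u *m G *m v^T)) mxE !trmx_mul trmxK sG.
by rewrite mulmxA.
Qed.

Definition inner_product G : Prop :=
  G^T = G /\ forall u, u != 0 -> 0 < inner G u u.

Lemma inner_sym G u v : inner_product G -> inner G u v = inner G v u.
Proof. by move=> [sG _]; rewrite innerC. Qed.

Lemma inner_product_unit G : inner_product G -> G \in unitmx.
Proof.
move=> [_ pG]; rewrite -row_free_unit -kermx_eq0; apply/rowV0P => u.
move=> /sub_kermxP uG; apply/eqP; apply: contraT => /pG.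
by rewrite /inner uG mul0mx mxE ltxx.
Qed.

Lemma inner_nondegenerate G u :
  inner_product G -> (forall v, inner G u v = 0) -> u = 0.
Proof.
move=> [_ pG] uv; apply/eqP; apply: contraT => /pG.
by rewrite uv ltxx.
Qed.

Lemma inner_inj G u v :
  inner_product G -> (forall w, inner G u w = inner G v w) -> u = v.
Proof.
move=> pG uv; apply/eqP; rewrite -subr_eq0; apply/eqP.
by apply: (inner_nondegenerate pG) => w; rewrite innerBl uv subrr.
Qed.

Lemma inner_raise G (r u : 'rV[R]_n) :
  G \in unitmx -> inner G (r *m invmx G) u = (r *m u^T) 0 0.
Proof. by move=> uG; rewrite /inner -(mulmxA r) mulVmx // mulmx1. Qed.

End Inner.

(** By induction on n: the first row u of the adjugate of G satisfies
    u G = det G e_0, so <u, u> = det G det M for the minor M, which is again an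
    inner product. *)
Lemma inner_product_det (R : realType) n (G : 'M[R]_n) :
  inner_product G -> 0 < \det G.
Proof.
elim: n G => [|n IH] G [sG pG]; first by rewrite det_mx00.
pose M := row' ord0 (col' ord0 G).
have pM : inner_product M.
  split; first by apply/matrixP => i j; rewrite !mxE -[in LHS]sG mxE.
  move=> u u0; pose w : 'rV[R]_n.+1 := \row_j oapp (u 0) 0 (unlift ord0 j).
  have wl j : w 0 (lift ord0 j) = u 0 j by rewrite mxE liftK.
  have w00 : w 0 ord0 = 0 by rewrite mxE unlift_none.
  have <- : inner G w w = inner M u u.
    rewrite !innerE big_ord_recl big1 => [|j _]; last by rewrite w00 !mul0r.
    rewrite add0r; apply: eq_bigr => i _; rewrite big_ord_recl w00 mulr0 add0r.
    by apply: eq_bigr => j _; rewrite !wl !mxE.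
  apply: pG; apply: contra_neq u0 => w0; apply/rowP => j.
  by rewrite -wl w0 !mxE.
pose u := row ord0 (\adj G).
have uG : u *m G = \det G *: delta_mx 0 ord0.
  by rewrite /u -row_mul mul_adj_mx -scalemx1 linearZ /= rowE mulmx1.
have u00 : u 0 ord0 = \det M by rewrite !mxE /cofactor addn0 expr0 mul1r.
have u0 : u != 0.
  apply/eqP => /rowP/(_ ord0); rewrite u00 mxE => dM.
  by have := IH M pM; rewrite dM ltxx.
clearbody u; have := pG u u0; rewrite /inner uG -scalemxAl mxE -rowE !mxE u00.
by rewrite pmulr_lgt0 // IH.
Qed.

Section Cross.
Variable R : realType.
Implicit Types (G M : 'M[R]_3) (u v w a b c : 'rV[R]_3).

Lemma sum3E (F : 'I_3 -> R) : \sum_i F i = F 0 + F 1 + F ord_max.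
Proof.
rewrite !big_ord_recl big_ord0 addr0 -addrA; congr (F _ + (F _ + F _)); exact: val_inj.
Qed.

Lemma forall_I3 (P : 'I_3 -> Prop) : P 0 -> P 1 -> P ord_max -> forall i, P i.
Proof.
move=> P0 P1 P2 [[|[|[|//]]] i3].
- by rewrite (_ : Ordinal i3 = 0) //; exact: val_inj.
- by rewrite (_ : Ordinal i3 = 1) //; exact: val_inj.
- by rewrite (_ : Ordinal i3 = ord_max) //; exact: val_inj.
Qed.

Lemma det_mx22 (M : 'M[R]_2) : \det M = M 0 0 * M 1 1 - M 0 1 * M 1 0.
Proof.
(* Entries given by numbers identify the indices produced by lift. *)
have [m mE] : exists m : nat -> nat -> R, forall i j, M i j = m i j.
  by exists (fun i j => M (inord i) (inord j)) => i j; rewrite !inord_val.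
rewrite (expand_det_row _ 0) !big_ord_recl big_ord0 /cofactor !det_mx11 !mxE !mE /=.
rewrite /bump /= !(addn0, add0n, expr0, expr1).
ring.
Qed.

Lemma det_mx33 M : \det M =
  M 0 0 * (M 1 1 * M ord_max ord_max - M 1 ord_max * M ord_max 1)
  - M 0 1 * (M 1 0 * M ord_max ord_max - M 1 ord_max * M ord_max 0)
  + M 0 ord_max * (M 1 0 * M ord_max 1 - M 1 1 * M ord_max 0).
Proof.
have [m mE] : exists m : nat -> nat -> R, forall i j, M i j = m i j.
  by exists (fun i j => M (inord i) (inord j)) => i j; rewrite !inord_val.
rewrite (expand_det_row _ 0) !big_ord_recl big_ord0 /cofactor.
rewrite !(expand_det_row _ ord0) !big_ord_recl !big_ord0 /cofactor !det_mx11 !mxE !mE /=.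
rewrite /bump /= !(addn0, add0n, addn1, expr0, expr1, expr2, exprS).
ring.
Qed.

Definition det3 u v w : R := \det (\matrix_(i < 3) nth 0 [:: u; v; w] i).

Lemma det3E u v w : det3 u v w =
  u 0 0 * (v 0 1 * w 0 ord_max - v 0 ord_max * w 0 1)
  - u 0 1 * (v 0 0 * w 0 ord_max - v 0 ord_max * w 0 0)
  + u 0 ord_max * (v 0 0 * w 0 1 - v 0 1 * w 0 0).
Proof. by rewrite /det3 det_mx33 !mxE. Qed.

Definition cofactor_row u v : 'rV[R]_3 := \row_k det3 u v (basis_vec R k).

Lemma cofactor_row_mul u v w : (cofactor_row u v *m w^T) 0 0 = det3 u v w.
Proof.
by rewrite mxE sum3E !mxE !det3E !mxE /=; ring.
Qed.

Lemma crossE G u v : cross G u v = Num.sqrt (\det G) *: (cofactor_row u v *m invmx G).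
Proof. by []. Qed.

Lemma det3_mulmx u v w G : det3 (u *m G) (v *m G) (w *m G) = det3 u v w * \det G.
Proof.
rewrite /det3 -det_mulmx; congr (\det _); apply/row_matrixP => i.
by rewrite row_mul !rowK; move: i; apply: forall_I3.
Qed.

Lemma cofactor_row_dot u v a b : (cofactor_row u v *m (cofactor_row a b)^T) 0 0 =
  (u *m a^T) 0 0 * (v *m b^T) 0 0 - (u *m b^T) 0 0 * (v *m a^T) 0 0.
Proof. by rewrite !mxE !sum3E !mxE !det3E !mxE /=; ring. Qed.

Variables (G : 'M[R]_3) (pG : inner_product G).

(** The volume form of the oriented inner product G. *)
Definition vol u v w : R := Num.sqrt (\det G) * det3 u v w.

Let uG : G \in unitmx. Proof. exact: inner_product_unit. Qed.
Let dG : 0 < \det G. Proof. exact: inner_product_det. Qed.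

Lemma inner_cross u v w : inner G (cross G u v) w = vol u v w.
Proof. by rewrite crossE innerZl inner_raise // cofactor_row_mul. Qed.

(* The cofactors of (u G, v G) are those of (u, v) times the adjugate of G. *)
Lemma cofactor_row_lower u v :
  cofactor_row (u *m G) (v *m G) = \det G *: (cofactor_row u v *m invmx G).
Proof.
have [sG _] := pG.
apply: (can_inj (mulmxK uG)); rewrite -scalemxAl mulmxKV //.
apply/rowP => k; rewrite [RHS]mxE [cofactor_row u v 0 k]mxE.
have := cofactor_row_mul (u *m G) (v *m G) (basis_vec R k *m G).
rewrite trmx_mul sG mulmxA det3_mulmx mulrC => <-.
by rewrite /basis_vec trmx_delta -colE [RHS]mxE.
Qed.

(** Lagrange's identity. *)
Lemma inner_cross_cross u v a b : inner G (cross G u v) (cross G a b) =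
  inner G u a * inner G v b - inner G u b * inner G v a.
Proof.
rewrite !crossE innerZl innerZr mulrA -expr2 sqr_sqrtr ?ltW //.
rewrite inner_raise // trmx_mul trmx_inv (proj1 pG).
have := cofactor_row_dot (u *m G) (v *m G) a b.
rewrite cofactor_row_lower -!scalemxAl mxE -/(inner G u a) -/(inner G v b).
by rewrite -/(inner G u b) -/(inner G v a) !mulmxA.
Qed.

Lemma vol_rot u v w : vol u v w = vol v w u.
Proof. by rewrite /vol !det3E; congr (_ * _); ring. Qed.

Lemma vol_swap u v w : vol v u w = - vol u v w.
Proof. by rewrite /vol -mulrN; congr (_ * _); rewrite !det3E; ring. Qed.

Lemma vol_swapr u v w : vol u w v = - vol u v w.
Proof. by rewrite /vol -mulrN; congr (_ * _); rewrite !det3E; ring. Qed.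

Lemma vol_diag u w : vol u u w = 0.
Proof. by rewrite /vol !det3E [X in _ * X](_ : _ = 0) ?mulr0 //; ring. Qed.

Lemma vol_diagr u w : vol w u u = 0.
Proof. by rewrite vol_rot vol_diag. Qed.

Lemma volDr u v w a : vol u v (w + a) = vol u v w + vol u v a.
Proof. by rewrite -!inner_cross innerDr. Qed.

Lemma volZr k u v w : vol u v (k *: w) = k * vol u v w.
Proof. by rewrite -!inner_cross innerZr. Qed.

Lemma volDm u v w a : vol u (v + a) w = vol u v w + vol u a w.
Proof. by rewrite vol_swapr volDr opprD -!vol_swapr. Qed.

Lemma volZm k u v w : vol u (k *: v) w = k * vol u v w.
Proof. by rewrite vol_swapr volZr -mulrN -vol_swapr. Qed.

Lemma volDl u v w a : vol (u + a) v w = vol u v w + vol a v w.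
Proof. by rewrite !(vol_rot _ v) volDr. Qed.

Lemma volZl k u v w : vol (k *: u) v w = k * vol u v w.
Proof. by rewrite !(vol_rot _ v) volZr. Qed.

Lemma inner_cross_l u v : inner G (cross G u v) u = 0.
Proof. by rewrite inner_cross vol_rot vol_diagr. Qed.

Lemma inner_cross_r u v : inner G (cross G u v) v = 0.
Proof. by rewrite inner_cross vol_diagr. Qed.

(** Vectors are compared by their inner products with a basis. *)
Lemma det3_zero u v w a : det3 u v w != 0 ->
  inner G u a = 0 -> inner G v a = 0 -> inner G w a = 0 -> a = 0.
Proof.
move=> d0 ua va wa.
pose M : 'M[R]_3 := \matrix_(i < 3) nth 0 [:: u; v; w] i.
have uM : M \in unitmx by rewrite unitmxE unitfE.
have Ma : M *m G *m a^T = 0.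
  apply/row_matrixP => i; rewrite row0 !row_mul rowK.
  have E x : inner G x a = 0 -> x *m G *m a^T = 0.
    by move=> xa; apply/matrixP => j k; rewrite !ord1 [RHS]mxE.
  by move: i; apply: forall_I3; rewrite /= E.
apply: trmx_inj; rewrite trmx0.
by rewrite -(mulKmx uG a^T) -(mulKmx uM (G *m a^T)) (mulmxA M) Ma !mulmx0.
Qed.

Lemma orthonormal_frame_det u v :
  inner G u u = 1 -> inner G v v = 1 -> inner G u v = 0 ->
  inner G (cross G u v) (cross G u v) = 1 /\ det3 u v (cross G u v) != 0.
Proof.
move=> uu vv uv.
have E : inner G (cross G u v) (cross G u v) = 1.
  by rewrite inner_cross_cross uu vv uv (inner_sym v _ pG) uv mul0r subr0 mulr1.
split=> //; apply/eqP => d0.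
by move: E; rewrite inner_cross /vol d0 mulr0 => /esym/eqP; rewrite oner_eq0.
Qed.

End Cross.

(** * The tangent plane of an immersed surface *)

(** The relations between a plane p(R^2) of a Euclidean 3-space, its unit
    normal N and its rotation J. *)
Section Plane.
Variables (R : realType) (G : 'M[R]_3) (I : 'M[R]_2) (p : 'rV[R]_2 -> 'rV[R]_3).
Variables (N : 'rV[R]_3) (J : 'rV[R]_2 -> 'rV[R]_2).
(* the vector product of G, kept abstract *)
Variable cr : 'rV[R]_3 -> 'rV[R]_3 -> 'rV[R]_3.
Hypotheses (pG : inner_product G) (pI : inner_product I).
Hypotheses (pD : forall u v, p (u + v) = p u + p v).
Hypotheses (pZ : forall k u, p (k *: u) = k *: p u).
Hypothesis IE : forall u v, inner I u v = inner G (p u) (p v).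
Hypotheses (NN : inner G N N = 1) (Np : forall v, inner G N (p v) = 0).
Hypothesis crE : forall u v, cr u v = cross G u v.
Hypothesis pJ : forall v, p (J v) = cr N (p v).

Lemma plane_N (u : 'rV[R]_2) : p (- u) = - p u.
Proof. by rewrite -scaleN1r pZ scaleN1r. Qed.

Lemma plane_inj u v : p u = p v -> u = v.
Proof.
move=> uv; have [_ I0] := pI; apply/eqP; rewrite -subr_eq0; apply: contraT => /I0.
by rewrite IE pD plane_N uv subrr inner0l ltxx.
Qed.

Lemma plane_inner_rot v w : inner I (J v) w = vol G N (p v) (p w).
Proof. by rewrite IE pJ crE inner_cross. Qed.

Lemma plane_rot_skew v w : inner I (J v) w = - inner I v (J w).
Proof. by rewrite plane_inner_rot vol_swapr // (inner_sym v) // plane_inner_rot. Qed.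

Lemma plane_rot_orth v : inner I (J v) v = 0.
Proof. by rewrite plane_inner_rot vol_diagr. Qed.

Lemma plane_rot_isometry v w : inner I (J v) (J w) = inner I v w.
Proof.
rewrite !IE !pJ !crE (inner_cross_cross pG) NN mul1r.
by rewrite Np mul0r subr0.
Qed.

(* N, p u and p (J u) form an orthonormal frame. *)
Lemma plane_frame_zero u a : inner I u u = 1 ->
  inner G N a = 0 -> inner G (p u) a = 0 -> inner G (p (J u)) a = 0 -> a = 0.
Proof.
move=> uu Na ua Ja.
have puu : inner G (p u) (p u) = 1 by rewrite -IE.
have [_ d0] := orthonormal_frame_det pG NN puu (Np u).
by apply: (det3_zero pG d0) => //; rewrite -crE -pJ.
Qed.

Lemma plane_decomp u v : inner I u u = 1 ->
  v = inner I v u *: u + inner I v (J u) *: J u.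
Proof.
move=> uu; apply: plane_inj; apply/eqP; rewrite -subr_eq0; apply/eqP.
apply: (plane_frame_zero uu); rewrite innerBr.
- by rewrite !Np subrr.
- rewrite -!IE innerDr !innerZr uu (inner_sym u (J u) pI) plane_rot_orth.
  by rewrite mulr0 addr0 mulr1 (inner_sym u v pI) subrr.
- rewrite -!IE innerDr !innerZr plane_rot_orth plane_rot_isometry uu.
  by rewrite mulr0 add0r mulr1 (inner_sym (J u) v pI) subrr.
Qed.

End Plane.

Lemma normalize_unit (R : realType) n (G : 'M[R]_n) w : 0 < inner G w w ->
  inner G ((Num.sqrt (inner G w w))^-1 *: w) ((Num.sqrt (inner G w w))^-1 *: w) = 1.
Proof.
move=> w0; rewrite innerZl innerZr mulrA -invfM -expr2 sqr_sqrtr ?ltW //.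
by rewrite mulVf // gt_eqF.
Qed.

Lemma tangent_part_inner (R : realType) (G : 'M[R]_3) (I : 'M[R]_2)
    (p : 'rV[R]_2 -> 'rV[R]_3) w v :
  inner_product I -> (forall u, p u = \sum_i u 0 i *: p (basis_vec R i)) ->
  inner I ((\row_j inner G w (p (basis_vec R j))) *m invmx I) v = inner G w (p v).
Proof.
move=> pI pE; rewrite inner_raise; last exact: inner_product_unit.
rewrite mxE (pE v) inner_sumr; apply: eq_bigr => j _.
by rewrite !mxE innerZr mulrC.
Qed.

Section TangentPlane.
Variables (R : realType) (g : 'rV[R]_3 -> 'M[R]_3).
Variables (f : 'rV[R]_2 -> 'rV[R]_3) (x : 'rV[R]_2).
Hypotheses (df : differentiable f x) (pG : inner_product (g (f x))).
Hypothesis immersed : forall v, v != 0 -> 0 < inner (g (f x)) (push f x v) (push f x v).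
Local Notation G := (g (f x)).
Local Notation p := (push f x).
Local Notation N := (unit_normal g f x).
Local Notation I := (first_form g f x).
Local Notation tp := (tangent_part g f x).
Local Notation J := (rotJ g f x).
Local Notation e1 := (basis_vec R (0 : 'I_2)).
Local Notation e2 := (basis_vec R (1 : 'I_2)).

Lemma pushD u v : p (u + v) = p u + p v. Proof. exact: deriveD_dir. Qed.
Lemma pushZ k u : p (k *: u) = k *: p u. Proof. exact: deriveZ_dir. Qed.
Lemma push_sum u : p u = \sum_i u 0 i *: p (basis_vec R i).
Proof. exact: derive_basis. Qed.

Lemma first_formE u v : inner I u v = inner G (p u) (p v).
Proof.
rewrite innerE (push_sum u) (push_sum v) inner_suml; apply: eq_bigr => i _.
rewrite inner_sumr; apply: eq_bigr => j _.
by rewrite innerZl innerZr mxE; ring.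
Qed.

Lemma first_form_inner_product : inner_product I.
Proof.
split; last by move=> u u0; rewrite first_formE immersed.
apply/matrixP => i j; rewrite !mxE; exact: inner_sym.
Qed.

Let pI := first_form_inner_product.

Lemma inner_tangent_part w v : inner I (tp w) v = inner G w (p v).
Proof. exact: tangent_part_inner pI push_sum. Qed.

Lemma cross_push_gt0 :
  0 < inner G (cross G (p e1) (p e2)) (cross G (p e1) (p e2)).
Proof.
rewrite (inner_cross_cross pG).
by have := inner_product_det pI; rewrite det_mx22 !mxE.
Qed.

Lemma unit_normal_unit : inner G N N = 1.
Proof. exact: normalize_unit cross_push_gt0. Qed.

Lemma unit_normal_scale : exists2 k, 0 < k & N = k *: cross G (p e1) (p e2).
Proof.
exists (Num.sqrt (inner G (cross G (p e1) (p e2)) (cross G (p e1) (p e2))))^-1 => //.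
by rewrite invr_gt0 sqrtr_gt0 cross_push_gt0.
Qed.

Lemma unit_normal_push v : inner G N (p v) = 0.
Proof.
have [k _ ->] := unit_normal_scale.
have c1 := inner_cross_l pG (p e1) (p e2); have c2 := inner_cross_r pG (p e1) (p e2).
move: (cross _ _ _) c1 c2 => w c1 c2.
rewrite innerZl (push_sum v) inner_sumr big1 ?mulr0 // => i _.
rewrite innerZr; move: i; apply: forall_I2; [by rewrite c1 mulr0|by rewrite c2 mulr0].
Qed.

Lemma vol_push_gt0 : 0 < vol G N (p e1) (p e2).
Proof.
have [k k0 ->] := unit_normal_scale; rewrite vol_rot -(inner_cross pG).
have := cross_push_gt0; move: (cross _ _ _) => w w0.
by rewrite innerZr mulr_gt0.
Qed.

Lemma unit_normal_det : det3 N (p e1) (p e2) != 0.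
Proof.
by apply/eqP => d0; have := vol_push_gt0; rewrite /vol d0 mulr0 ltxx.
Qed.

Lemma push_tangent_part w : inner G w N = 0 -> p (tp w) = w.
Proof.
move=> wN; apply/eqP; rewrite -subr_eq0; apply/eqP.
have tE v : inner G (p (tp w)) (p v) = inner G w (p v).
  by rewrite -first_formE inner_tangent_part.
have pN := unit_normal_push (tp w).
move: (p (tp w)) tE pN => q tE pN.
apply: (det3_zero pG unit_normal_det); rewrite innerBr.
- by rewrite pN (inner_sym N w pG) wN subrr.
- by rewrite (inner_sym (p e1) q pG) (inner_sym (p e1) w pG) tE subrr.
- by rewrite (inner_sym (p e2) q pG) (inner_sym (p e2) w pG) tE subrr.
Qed.

Lemma push_rotJ v : p (J v) = cross G N (p v).
Proof. by rewrite push_tangent_part //; exact: inner_cross_l. Qed.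

(** A vector orthogonal to the plane is a multiple of N; the norm determines the
    multiple up to the sign, and the orientation determines the sign. *)
Lemma unit_normalE w : inner G w w = 1 -> (forall v, inner G w (p v) = 0) ->
  0 < vol G w (p e1) (p e2) -> w = N.
Proof.
move: unit_normal_unit unit_normal_push vol_push_gt0 unit_normal_det.
move: N => n nn np vn d0 ww wp vw.
have wE : w = inner G w n *: n.
  apply/eqP; rewrite -subr_eq0; apply/eqP; apply: (det3_zero pG d0).
  - by rewrite innerBr innerZr nn mulr1 (inner_sym n w pG) subrr.
  - by rewrite innerBr innerZr (inner_sym _ w pG) wp (inner_sym (p e1) n pG) np mulr0 subr0.
  - by rewrite innerBr innerZr (inner_sym _ w pG) wp (inner_sym (p e2) n pG) np mulr0 subr0.
have k0 : 0 < inner G w n.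
  by move: vw; rewrite {1}wE (volZl pG) pmulr_lgt0.
have : inner G w n ^+ 2 = 1.
  by rewrite -ww [in RHS]wE innerZl innerZr nn mulr1 expr2.
move/eqP; rewrite sqrf_eq1 => /orP[/eqP k1|/eqP k1].
  by rewrite wE k1 scale1r.
by move: k0; rewrite k1 oppr_gt0 ltr10.
Qed.

Lemma inner_rotJ v w : inner I (J v) w = vol G N (p v) (p w).
Proof. exact: (plane_inner_rot pG first_formE (cr := cross G)) push_rotJ v w. Qed.

Lemma rotJ_skew v w : inner I (J v) w = - inner I v (J w).
Proof.
exact: (@plane_rot_skew _ _ _ _ _ _ (cross G) pG pI first_formE _ push_rotJ v w).
Qed.

Lemma rotJ_orth v : inner I (J v) v = 0.
Proof. by rewrite inner_rotJ; exact: vol_diagr. Qed.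

Lemma rotJ_isometry v w : inner I (J v) (J w) = inner I v w.
Proof.
exact: (@plane_rot_isometry _ _ _ _ _ _ (cross G) pG first_formE unit_normal_unit unit_normal_push _ push_rotJ v w).
Qed.

Lemma rotJ_decomp u v : inner I u u = 1 ->
  v = inner I v u *: u + inner I v (J u) *: J u.
Proof.
exact: (@plane_decomp _ _ _ _ _ _ (cross G) pG pI pushD pushZ first_formE unit_normal_unit unit_normal_push _ push_rotJ u v).
Qed.

Lemma inner_shape_operator u v :
  inner I (shape_operator g f x u) v = - inner G (nabla g f (unit_normal g f) x u) (p v).
Proof. by rewrite inner_tangent_part; exact: innerNl. Qed.

End TangentPlane.

(** * Covariant derivatives *)

Section ProductRules.
Variable R : realType.

Lemma derive_sum_fun (V W : normedModType R) n (F : 'I_n -> V -> W) x v :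
  (forall i, differentiable (F i) x) ->
  'D_v (fun y => \sum_i F i y) x = \sum_i 'D_v (F i) x.
Proof.
move=> dF; have -> : (fun y => \sum_i F i y) = \sum_i F i.
  by apply/funext => y; rewrite fct_sumE.
by rewrite derive_sum // => i; apply: diff_derivable.
Qed.

Lemma derive_mul (V : normedModType R) (f h : V -> R) x v :
  differentiable f x -> differentiable h x ->
  'D_v (fun y => f y * h y) x = f x * 'D_v h x + 'D_v f x * h x.
Proof. by move=> df dh; rewrite (derive_scale v df dh). Qed.

Lemma differentiable_sum_fun (V W : normedModType R) n (F : 'I_n -> V -> W) x :
  (forall i, differentiable (F i) x) ->
  differentiable (fun y => \sum_i F i y) x.
Proof.
move=> dF; have -> : (fun y => \sum_i F i y) = \sum_i F i.
  by apply/funext => y; rewrite fct_sumE.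
exact: differentiable_sum.
Qed.

Section Trilinear.
Variables (V : normedModType R) (n : nat) (A : V -> 'M[R]_n) (u w : V -> 'rV[R]_n).
Variable (x : V).
Hypotheses (dA : differentiable A x) (du : differentiable u x) (dw : differentiable w x).

Let dterm i j : differentiable (fun y => u y 0 i * A y i j * w y 0 j) x.
Proof.
apply: differentiableM; last exact: differentiable_mxcoord.
by apply: differentiableM; exact: differentiable_mxcoord.
Qed.

Lemma differentiable_inner : differentiable (fun y => inner (A y) (u y) (w y)) x.
Proof.
have -> : (fun y => inner (A y) (u y) (w y)) =
    (fun y => \sum_i \sum_j u y 0 i * A y i j * w y 0 j).
  by apply/funext => y; exact: innerE.
by apply: differentiable_sum_fun => i; exact: differentiable_sum_fun.
Qed.

Lemma derive_inner v : 'D_v (fun y => inner (A y) (u y) (w y)) x =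
  inner ('D_v A x) (u x) (w x) + inner (A x) ('D_v u x) (w x)
  + inner (A x) (u x) ('D_v w x).
Proof.
have -> : (fun y => inner (A y) (u y) (w y)) =
    (fun y => \sum_i \sum_j u y 0 i * A y i j * w y 0 j).
  by apply/funext => y; exact: innerE.
rewrite derive_sum_fun => [|i]; last exact: differentiable_sum_fun.
rewrite !innerE -!big_split /=; apply: eq_bigr => i _.
rewrite derive_sum_fun // -!big_split /=; apply: eq_bigr => j _.
have dui := differentiable_mxcoord 0 i du.
have dAij := differentiable_mxcoord i j dA.
have dwj := differentiable_mxcoord 0 j dw.
rewrite derive_mul //; last exact: differentiableM.
rewrite derive_mul // !derive_coord //.
by ring.
Qed.

End Trilinear.

Lemma derive_comm (V : normedModType R) m n (f : V -> 'M[R]_(m, n)) (x u v : V) :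
  smooth_at f x ->
  'D_v (fun y => 'D_u f y) x = 'D_u (fun y => 'D_v f y) x.
Proof.
move=> sf; apply/matrixP => i j.
have E w : \forall y \near x, ('D_w f y) i j = 'D_w (fun y => f y i j) y.
  apply: filterS (smooth_at_nbhs sf) => y sy.
  by rewrite derive_coord //; exact: smooth_at_diff.
have Ec w z : ('D_z (fun y => 'D_w f y) x) i j =
    'D_z (fun y => 'D_w (fun y => f y i j) y) x.
  have dw := smooth_at_diff (smooth_at_derive w sf).
  by apply: etrans (esym (derive_coord _ _ _ dw)) _; exact: near_eq_derive (E w).
apply: etrans (Ec u v) _; apply: etrans _ (esym (Ec v u)).
by apply: derive_comm_real; exact: smooth_at_coord.
Qed.

(** Both the point and the vector move; the motion of the point contributes a
    second derivative of f. *)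
Lemma derive_push_curve n (W : normedModType R) (f : 'rV[R]_n -> W)
    (s v : R -> 'rV[R]_n) t :
  smooth_at f (s t) -> differentiable s t -> differentiable v t ->
  is_derive t 1 (fun r => 'D_(v r) f (s r))
    ('D_('D_1 v t) f (s t) + 'D_('D_1 s t) (fun y => 'D_(v t) f y) (s t)).
Proof.
move=> sf ds dv.
have nf := smooth_at_nbhs sf.
have nt : \forall r \near t, smooth_at f (s r).
  have cs := differentiable_continuous ds; exact: (cs _ nf).
have E : \forall r \near t, \sum_i v r 0 i *: 'D_(basis_vec R i) f (s r) = 'D_(v r) f (s r).
  by apply: filterS nt => r /smooth_at_diff dr; rewrite [RHS]derive_basis.
have dD i : differentiable (fun y => 'D_(basis_vec R i) f y) (s t).
  exact: smooth_at_diff (smooth_at_derive _ sf).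
have dc i : differentiable (fun r => 'D_(basis_vec R i) f (s r)) t.
  exact: (differentiable_comp ds (dD i)).
have dvi i : differentiable (fun r => v r 0 i) t by exact: differentiable_mxcoord.
have dterm i : differentiable (fun r => v r 0 i *: 'D_(basis_vec R i) f (s r)) t.
  exact: differentiable_scale.
apply: (near_eq_is_derive E); apply: DeriveDef.
  by apply: diff_derivable; exact: differentiable_sum_fun.
rewrite derive_sum_fun //.
have E2 : \forall y \near s t, \sum_i v t 0 i *: 'D_(basis_vec R i) f y = 'D_(v t) f y.
  by apply: filterS nf => y /smooth_at_diff dr; rewrite [RHS]derive_basis.
rewrite -(near_eq_derive _ E2) derive_sum_fun; last first.
  by move=> i; apply: differentiable_scale => //; exact: differentiable_cst.
rewrite (derive_basis _ (smooth_at_diff sf)) -big_split /=; apply: eq_bigr => i _.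
rewrite (derive_scale _ (dvi i) (dc i)).
rewrite (derive_scale _ (differentiable_cst (v t 0 i) (s t)) (dD i)).
have alg (a a' b z : R) (w0 w1 w2 : W) : a = a' -> z = 0 -> w1 = w2 ->
    b *: w1 + a *: w0 = a' *: w0 + (b *: w2 + z *: w0).
  by move=> -> -> ->; rewrite scale0r addr0 addrC.
by apply: alg; [exact: derive_coord|exact: derive_cst|exact: derive_comp].
Qed.

End ProductRules.

Section LeviCivita.
Variables (R : realType) (n : nat).
Implicit Types (g : 'rV[R]_n -> 'M[R]_n).

Definition metric_at g (x : 'rV[R]_n) : Prop :=
  smooth_at g x /\ \forall y \near x, inner_product (g y).

Lemma metric_at_inner g x : metric_at g x -> inner_product (g x).
Proof. by move=> [_ /nbhs_singleton]. Qed.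

Lemma metric_at_diff g x : metric_at g x -> differentiable g x.
Proof. by move=> [/smooth_at_diff]. Qed.

Lemma metric_at_derive_sym g x u : metric_at g x -> ('D_u g x)^T = 'D_u g x.
Proof.
move=> mg; have dg := metric_at_diff mg; have [_ pg] := mg.
apply/matrixP => i j; rewrite mxE -!derive_coord //.
by apply: near_eq_derive; apply: filterS pg => y [sy _]; rewrite -[in LHS]sy mxE.
Qed.

Let raise_alg (G A B C : 'M[R]_n) (D : 'I_n -> 'M[R]_n) (u v w : 'rV[R]_n) :
  G \in unitmx -> C = \sum_k w 0 k *: D k ->
  inner G ((\row_k (2^-1 * (inner A v (basis_vec R k) + inner B u (basis_vec R k)
                            - inner (D k) u v))) *m invmx G) w =
  2^-1 * (inner A v w + inner B u w - inner C u v).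
Proof.
move=> uG CE; rewrite inner_raise //.
have lin M (z : 'rV[R]_n) : inner M z w = \sum_k w 0 k * inner M z (basis_vec R k).
  rewrite {1}(row_sum_basis w) inner_sumr; apply: eq_bigr => k _.
  by rewrite innerZr.
have lin2 : inner C u v = \sum_k w 0 k * inner (D k) u v.
  rewrite CE; elim/big_rec2: _ => [|k a b _ <-].
    by rewrite /inner mulmx0 mul0mx mxE.
  by rewrite innerDmx innerZmx.
rewrite mxE (lin A v) (lin B u) lin2 -big_split /= -sumrB mulr_sumr.
by apply: eq_bigr => k _; rewrite !mxE; ring.
Qed.

(** The Koszul formula, with an arbitrary vector w instead of a basis vector. *)
Lemma christoffel_lower g x u v w : metric_at g x ->
  inner (g x) (christoffel g x u v) w =
  2^-1 * (inner ('D_u g x) v w + inner ('D_v g x) u w - inner ('D_w g x) u v).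
Proof.
move=> mg; apply: raise_alg; first exact: inner_product_unit (metric_at_inner mg).
exact: derive_basis (metric_at_diff mg).
Qed.

Lemma christoffel_sym g x u v : metric_at g x ->
  christoffel g x u v = christoffel g x v u.
Proof.
move=> mg; apply: (inner_inj (metric_at_inner mg)) => w.
apply: etrans (christoffel_lower u v w mg) _.
apply: etrans _ (esym (christoffel_lower v u w mg)).
have alg (a b c d : R) : a = b -> 2^-1 * (c + d - a) = 2^-1 * (d + c - b).
  by move=> ->; rewrite [c + d]addrC.
apply: alg; exact: innerC (metric_at_derive_sym w mg).
Qed.

(** Compatibility with the metric: in the sum of the two Koszul formulas all
    terms but the derivative of g in the direction of f_* u cancel. *)
Lemma nabla_metric (P : normedModType R) g (f V W : P -> 'rV[R]_n) (p u : P) :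
  metric_at g (f p) -> differentiable f p -> differentiable V p ->
  differentiable W p ->
  'D_u (fun q => inner (g (f q)) (V q) (W q)) p =
  inner (g (f p)) (nabla g f V p u) (W p) + inner (g (f p)) (V p) (nabla g f W p u).
Proof.
move=> mg df dV dW; have pg := metric_at_inner mg; have dg := metric_at_diff mg.
have dgf : differentiable (fun q => g (f q)) p by exact: (differentiable_comp df dg).
have alg (A : 'M[R]_n) (dv dw c1 c2 v w : 'rV[R]_n) b c :
    inner (g (f p)) c1 w = 2^-1 * (inner A v w + b - c) ->
    inner (g (f p)) c2 v = 2^-1 * (inner A w v + c - b) -> inner A w v = inner A v w ->
    inner A v w + inner (g (f p)) dv w + inner (g (f p)) v dw =
    inner (g (f p)) (dv + c1) w + inner (g (f p)) v (dw + c2).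
  move=> e1 e2 e3; rewrite innerDl innerDr (inner_sym v c2 pg) e1 e2 e3.
  by move: (inner _ _ _) (inner _ dv w) (inner _ v dw) => x y z; field.
apply: etrans (derive_inner dgf dV dW u) _.
apply: (alg _ _ _ _ _ (V p) (W p)).
- rewrite (derive_comp u df dg); exact: christoffel_lower.
- rewrite (derive_comp u df dg); exact: christoffel_lower.
- rewrite (derive_comp u df dg); apply: innerC; exact: metric_at_derive_sym.
Qed.

Lemma nabla_comp (P : normedModType R) g (f : P -> 'rV[R]_n)
    (Y : 'rV[R]_n -> 'rV[R]_n) (p u : P) :
  differentiable f p -> differentiable Y (f p) ->
  nabla g f (fun q => Y (f q)) p u = nabla g idfun Y (f p) ('D_u f p).
Proof. by move=> df dY; rewrite /nabla (derive_comp u df dY) derive_id. Qed.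

Lemma nabla_curve m g (f V : 'rV[R]_m -> 'rV[R]_n) (s : R -> 'rV[R]_m) t :
  differentiable s t -> differentiable f (s t) -> differentiable V (s t) ->
  nabla g (fun r => f (s r)) (fun r => V (s r)) t 1 = nabla g f V (s t) ('D_1 s t).
Proof.
move=> ds df dV.
exact: (f_equal2 +%R (derive_comp (1 : R) ds dV)
  (f_equal (fun z => christoffel g (f (s t)) z (V (s t))) (derive_comp (1 : R) ds df))).
Qed.

(** The connection has no torsion. *)
Lemma nabla_push_sym m g (f : 'rV[R]_m -> 'rV[R]_n) x u v :
  metric_at g (f x) -> smooth_at f x ->
  nabla g f (fun y => 'D_u f y) x v = nabla g f (fun y => 'D_v f y) x u.
Proof.
move=> mg sf.
exact: (f_equal2 +%R (derive_comm u v sf) (christoffel_sym _ _ mg)).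
Qed.

Lemma nabla_cst g x u v : nabla g idfun (fun=> v) x u = christoffel g x u v.
Proof. by rewrite /nabla derive_cst add0r derive_id. Qed.

End LeviCivita.

(** * Riemannian submersions with a unit Killing field as vertical direction *)

Section Submersion.
Variables (R : realType) (g : 'rV[R]_3 -> 'M[R]_3) (G : 'rV[R]_2 -> 'M[R]_2).
Variables (P : 'rV[R]_3 -> 'rV[R]_2) (xi : 'rV[R]_3 -> 'rV[R]_3) (y0 : 'rV[R]_3).
Hypotheses (mg : metric_at g y0) (mG : metric_at G (P y0)).
Hypotheses (sP : smooth_at P y0) (sxi : smooth_at xi y0).
Let eta y u := inner (g y) u (xi y).
Hypothesis submersion : \forall y \near y0, forall u v,
  inner (G (P y)) ('D_u P y) ('D_v P y) = inner (g y) u v - eta y u * eta y v.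
Hypothesis killing : forall u v, inner (g y0) (nabla g idfun xi y0 u) v
  + inner (g y0) u (nabla g idfun xi y0 v) = 0.

(* the second fundamental form of P, the Hessian of P as a map into the base *)
Let B (w u : 'rV[R]_3) : 'rV[R]_2 :=
  nabla G P (fun y => 'D_u P y) y0 w - 'D_(christoffel g y0 w u) P y0.
Let omega w u := inner (g y0) (nabla g idfun xi y0 w) u.

Let dP : differentiable P y0. Proof. exact: smooth_at_diff. Qed.
Let dDP u : differentiable (fun y => 'D_u P y) y0.
Proof. exact: smooth_at_diff (smooth_at_derive u sP). Qed.
Let dxi : differentiable xi y0. Proof. exact: smooth_at_diff. Qed.

Let sub0 u v : inner (G (P y0)) ('D_u P y0) ('D_v P y0)
  = inner (g y0) u v - eta y0 u * eta y0 v.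
Proof. exact: (nbhs_singleton submersion). Qed.

Let BC w u : B w u = B u w.
Proof.
have alg (a b : 'rV[R]_2) (c d : 'rV[R]_3) : a = b -> c = d -> a - 'D_c P y0 = b - 'D_d P y0.
  by move=> -> ->.
by apply: alg; [exact: nabla_push_sym|exact: christoffel_sym].
Qed.

(* The metric identity of the submersion, differentiated in the direction w. *)
Let B_skew w u v :
  inner (G (P y0)) (B w u) ('D_v P y0) + inner (G (P y0)) (B w v) ('D_u P y0)
  = - omega w u * eta y0 v - eta y0 u * omega w v.
Proof.
have pG := metric_at_inner mG; have pg := metric_at_inner mg.
have E1 := nabla_metric w mG dP (dDP u) (dDP v).
have cst_diff (a : 'rV[R]_3) : differentiable (fun _ : 'rV[R]_3 => a) y0.
  exact: differentiable_cst.
have dg : differentiable g y0 := metric_at_diff mg.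
have Ei a b : 'D_w (fun y => inner (g y) a b) y0 =
    inner (g y0) (christoffel g y0 w a) b + inner (g y0) a (christoffel g y0 w b).
  have := @nabla_metric _ _ _ g idfun (fun=> a) (fun=> b) y0 w mg (differentiable_idfun y0) (cst_diff a) (cst_diff b).
  by rewrite !nabla_cst.
have Ee a : 'D_w (fun y => eta y a) y0 = inner (g y0) (christoffel g y0 w a) (xi y0) + omega w a.
  have := @nabla_metric _ _ _ g idfun (fun=> a) xi y0 w mg (differentiable_idfun y0) (cst_diff a) dxi.
  by rewrite nabla_cst /omega (inner_sym (nabla g idfun xi y0 w) a pg).
have de a : differentiable (fun y => eta y a) y0 by exact: differentiable_inner.
have di a b : differentiable (fun y => inner (g y) a b) y0 by exact: differentiable_inner.
have E2 : 'D_w (fun y => inner (G (P y)) ('D_u P y) ('D_v P y)) y0 =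
    (inner (g y0) (christoffel g y0 w u) v + inner (g y0) u (christoffel g y0 w v))
    - (eta y0 u * (eta y0 (christoffel g y0 w v) + omega w v)
       + (eta y0 (christoffel g y0 w u) + omega w u) * eta y0 v).
  have E3 : \forall y \near y0, inner (G (P y)) ('D_u P y) ('D_v P y) =
     inner (g y) u v - eta y u * eta y v.
    by apply: filterS submersion => y; apply.
  apply: etrans (near_eq_derive _ E3) _.
  have dee : differentiable (fun y => eta y u * eta y v) y0 by exact: differentiableM.
  rewrite deriveB; [|exact: diff_derivable|exact: diff_derivable].
  by rewrite Ei (derive_mul w (de u) (de v)) !Ee.
have E := etrans (esym E1) E2.
have bE a : nabla G P (fun y => 'D_a P y) y0 w = B w a + 'D_(christoffel g y0 w a) P y0.
  by rewrite /B subrK.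
rewrite !bE in E; move: (B w u) (B w v) E => b1 b2.
rewrite innerDl innerDr !sub0 (inner_sym ('D_u P y0) b2 pG).
move: (inner _ b1 _) (inner _ b2 _) => x y.
move: (inner _ _ v) (inner _ u _) (eta _ (christoffel _ _ _ _)) (eta _ (christoffel _ _ _ _)).
move: (eta _ _) (eta _ _) (omega _ _) (omega _ _) => e1 e2 o1 o2 i1 i2 e3 e4.
move=> E; apply: (@addIr _ (i1 - e4 * e2 + (i2 - e1 * e3))).
have -> : x + y + (i1 - e4 * e2 + (i2 - e1 * e3)) = x + (i1 - e4 * e2) + (y + (i2 - e1 * e3)).
  by ring.
rewrite E; ring.
Qed.

(** Since B is symmetric, the identity above determines it, exactly as the
    Koszul formula determines the Levi-Civita connection. *)
Lemma submersion_second_form w v : 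
  inner (G (P y0)) (B w w) ('D_v P y0) = - 2 * eta y0 w * omega w v.
Proof.
have K u a : omega u a = - omega a u.
  have pg := metric_at_inner mg.
  by have /eqP := killing u a; rewrite addr_eq0 (inner_sym u _ pg) => /eqP.
have E1 := B_skew w w v; have E2 := B_skew v w w.
rewrite (BC v w) in E2.
have oww : omega w w = 0.
  by have := K w w => /eqP; rewrite -addr_eq0 -mulr2n mulrn_eq0 => /eqP.
rewrite oww in E1; rewrite (K v w) in E2.
have alg (x y a b o : R) : x + y = - 0 * b - a * o ->
    y + y = - - o * a - a * - o -> x = - 2 * a * o.
  move=> F1 F2; have -> : x = (x + y) - (y + y) / 2 by field.
  by rewrite F1 F2; field.
exact: alg E1 E2.
Qed.

(** The projection of a curve is curved by the curvature of the curve and, for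
    the vertical part of its velocity, by the bundle curvature. *)
Lemma submersion_curve (s : R -> 'rV[R]_3) t n :
  s t = y0 -> smooth_at s t -> eta y0 n = 0 ->
  inner (G (P y0)) (nabla G (fun r => P (s r)) (fun r => 'D_1 (fun r => P (s r)) r) t 1) ('D_n P y0)
  = inner (g y0) (nabla g s (fun r => 'D_1 s r) t 1) n
    - 2 * eta y0 ('D_1 s t) * omega ('D_1 s t) n.
Proof.
move=> st ss en; have ds := smooth_at_diff ss.
have ds' : differentiable (fun r => 'D_1 s r) t := smooth_at_diff (smooth_at_derive (1 : R) ss).
have sPt : smooth_at P (s t) by rewrite st.
have nP : \forall r \near t, smooth_at P (s r).
  have cs := differentiable_continuous ds; exact: (cs _ (smooth_at_nbhs sPt)).
have E1 : \forall r \near t, 'D_1 (fun r => P (s r)) r = 'D_('D_1 s r) P (s r).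
  apply: filterS2 nP (smooth_at_nbhs ss) => r sPr ssr.
  by apply: derive_comp; exact: smooth_at_diff.
have E2 : 'D_1 (fun r => 'D_1 (fun r => P (s r)) r) t =
    'D_('D_1 (fun r => 'D_1 s r) t) P y0 + 'D_('D_1 s t) (fun y => 'D_('D_1 s t) P y) y0.
  apply: etrans (near_eq_derive _ E1) _.
  have [_ ->] := derive_push_curve sPt ds ds'.
  by rewrite st.
have E3 := nbhs_singleton E1.
set w := 'D_1 s t in E2 E3 *.
have nE : nabla G (fun r => P (s r)) (fun r => 'D_1 (fun r => P (s r)) r) t 1 =
    B w w + 'D_(nabla g s (fun r => 'D_1 s r) t 1) P y0.
  rewrite /nabla E2 E3 -/w st /B (deriveD_dir _ _ dP) /nabla.
  move: ('D_('D_1 _ t) P y0) ('D_w _ y0) ('D_(christoffel _ _ _ _) P y0) (christoffel _ _ _ _) => a b c d.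
  by rewrite [a + c]addrC addrA addrNK [a + b]addrC addrAC.
rewrite nE innerDl submersion_second_form sub0 en mulr0 subr0 addrC.
by rewrite !mulNr.
Qed.

End Submersion.

(** * The second fundamental form *)

Section SmoothCross.
Variables (R : realType) (V : normedModType R).

Lemma smooth_at_cross (G : V -> 'M[R]_3) (u v : V -> 'rV[R]_3) x :
  inner_product (G x) -> smooth_at G x -> smooth_at u x -> smooth_at v x ->
  smooth_at (fun y => cross (G y) (u y) (v y)) x.
Proof.
move=> pG sG su sv; apply: smooth_atZ.
  by apply: smooth_at_sqrt; [exact: inner_product_det|exact: smooth_at_det].
apply: smooth_at_mulmx; last first.
  by apply: smooth_at_invmx => //; exact: inner_product_unit.
apply: smooth_at_mx => i k.
have -> : (fun y => (\row_k0 \det (\matrix_(i0 < 3) nth 0 [:: u y; v y; basis_vec R k0] i0)) i k)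
   = (fun y => det3 (u y) (v y) (basis_vec R k)).
  by apply/funext => y; rewrite mxE.
have -> : (fun y => det3 (u y) (v y) (basis_vec R k)) = (fun y =>
  u y 0 0 * (v y 0 1 * basis_vec R k 0 ord_max - v y 0 ord_max * basis_vec R k 0 1)
  - u y 0 1 * (v y 0 0 * basis_vec R k 0 ord_max - v y 0 ord_max * basis_vec R k 0 0)
  + u y 0 ord_max * (v y 0 0 * basis_vec R k 0 1 - v y 0 1 * basis_vec R k 0 0)).
  by apply/funext => y; exact: det3E.
have sc (A : V -> 'rV[R]_3) j : smooth_at A x -> smooth_at (fun y => A y 0 j) x.
  exact: smooth_at_coord.
have st (A B : V -> 'rV[R]_3) j l m (a b : R) : smooth_at A x -> smooth_at B x ->
    smooth_at (fun y => A y 0 j * (B y 0 l * a - B y 0 m * b)) x.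
  move=> sA sB; apply: smooth_atM; first exact: sc.
  by apply: smooth_atB; apply: smooth_atM; (try exact: sc); exact: smooth_at_cst.
by apply: smooth_atD; [apply: smooth_atB|]; exact: st.
Qed.

End SmoothCross.

Section SecondForm.
Variables (R : realType) (g : 'rV[R]_3 -> 'M[R]_3).
Variables (f : 'rV[R]_2 -> 'rV[R]_3) (x : 'rV[R]_2).

Definition immersion_at : Prop := [/\ smooth_at f x, metric_at g (f x) &
  \forall y \near x, inner_product (g (f y)) /\
    forall v, v != 0 -> 0 < inner (g (f y)) (push f y v) (push f y v)].

Hypothesis imm : immersion_at.

Let sf : smooth_at f x. Proof. by case: imm. Qed.
Let mg : metric_at g (f x). Proof. by case: imm. Qed.
Let df : differentiable f x. Proof. exact: smooth_at_diff. Qed.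
Let pG : inner_product (g (f x)). Proof. exact: metric_at_inner. Qed.
Let inj v : v != 0 -> 0 < inner (g (f x)) (push f x v) (push f x v).
Proof. by case: imm => _ _ /nbhs_singleton[_ +]; exact. Qed.
Local Notation N := (unit_normal g f).
Local Notation G := (g (f x)).

Lemma smooth_at_push v : smooth_at (fun y => push f y v) x.
Proof. exact: smooth_at_derive. Qed.

Lemma smooth_at_unit_normal : smooth_at N x.
Proof.
have sgf : smooth_at (fun y => g (f y)) x.
  by apply: smooth_at_comp => //; case: mg.
have sc : smooth_at (fun y => cross (g (f y)) (push f y (basis_vec R 0))
    (push f y (basis_vec R 1))) x.
  by apply: smooth_at_cross => //; exact: smooth_at_push.
apply: smooth_atZ => //; apply: smooth_at_inv.
  by rewrite gt_eqF // sqrtr_gt0; exact: cross_push_gt0 df pG inj.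
apply: smooth_at_sqrt; first exact: cross_push_gt0 df pG inj.
exact: smooth_at_inner.
Qed.

Let dN : differentiable N x. Proof. exact: smooth_at_diff smooth_at_unit_normal. Qed.
Let dpush v : differentiable (fun y => push f y v) x.
Proof. exact: smooth_at_diff (smooth_at_push v). Qed.

Lemma near_unit_normal_push : \forall y \near x, forall v,
  inner (g (f y)) (N y) (push f y v) = 0.
Proof.
have [_ _ ni] := imm; apply: filterS2 (smooth_at_nbhs sf) ni => y sy [pGy iy] v.
exact: unit_normal_push (smooth_at_diff sy) pGy iy v.
Qed.

(** <N, f_* v> = 0 is differentiated. *)
Lemma second_form_push u v : inner G (nabla g f N x u) (push f x v)
  = - inner G (N x) (nabla g f (fun y => push f y v) x u).
Proof.
have E := nabla_metric u mg df dN (dpush v).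
have E0 : \forall y \near x, inner (g (f y)) (N y) (push f y v) = cst 0 y.
  by apply: filterS near_unit_normal_push => y; apply.
have D0 := etrans (esym E) (etrans (near_eq_derive u E0) (derive_cst 0 x u)).
by apply/eqP; rewrite -addr_eq0 D0.
Qed.

(** The second derivatives of f are symmetric. *)
Lemma second_form_sym u v : inner G (nabla g f N x u) (push f x v)
  = inner G (nabla g f N x v) (push f x u).
Proof.
apply: etrans (second_form_push u v) _; apply: etrans _ (esym (second_form_push v u)).
exact: (f_equal (fun z => - inner G (N x) z) (nabla_push_sym v u mg sf)).
Qed.

Lemma derive_angle (xi : 'rV[R]_3 -> 'rV[R]_3) v : smooth_at xi (f x) ->
  'D_v (angle g xi f) x = inner G (nabla g f N x v) (xi (f x))
    + inner G (N x) (nabla g idfun xi (f x) (push f x v)).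
Proof.
move=> sxi; have dxi := smooth_at_diff sxi.
have dxf : differentiable (fun y => xi (f y)) x by exact: (differentiable_comp df dxi).
apply: etrans (nabla_metric v mg df dN dxf) _.
exact: (f_equal (fun z => _ + inner G (N x) z) (nabla_comp g v df dxi)).
Qed.

(** The normal part of the acceleration of a curve on the surface only depends
    on its velocity: <N, (f s)'> = 0 is differentiated. *)
Lemma normal_curvature (s : R -> 'rV[R]_2) t : s t = x -> smooth_at s t ->
  inner G (nabla g (fun r => f (s r)) (fun r => 'D_1 (fun r => f (s r)) r) t 1) (N x)
  = - inner G (nabla g f N x ('D_1 s t)) (push f x ('D_1 s t)).
Proof.
move=> st ss; have ds := smooth_at_diff ss.
have sft : smooth_at f (s t) by rewrite st.
have sNt : smooth_at N (s t) by rewrite st; exact: smooth_at_unit_normal.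
have sfs : smooth_at (fun r => f (s r)) t by exact: smooth_at_comp.
have dfs := smooth_at_diff sfs.
have dfs' := smooth_at_diff (smooth_at_derive (1 : R) sfs).
have dNs := smooth_at_diff (smooth_at_comp ss sNt).
have mgs : metric_at g (f (s t)) by rewrite st.
have E := nabla_metric (1 : R) mgs dfs dNs dfs'.
have cs := differentiable_continuous ds.
have nN : \forall r \near t, forall v,
    inner (g (f (s r))) (N (s r)) (push f (s r) v) = 0.
  by have := near_unit_normal_push; rewrite -st => /(cs _).
have nf : \forall r \near t, smooth_at f (s r) := cs _ (smooth_at_nbhs sft).
have E0 : \forall r \near t, inner (g (f (s r))) (N (s r)) ('D_1 (fun r => f (s r)) r) = cst 0 r.
  apply: filterS3 nN nf (smooth_at_nbhs ss) => r Nr sfr ssr.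
  by rewrite (derive_comp (1 : R) (smooth_at_diff ssr) (smooth_at_diff sfr)); exact: Nr.
have D0 := etrans (esym E) (etrans (near_eq_derive (1 : R) E0) (derive_cst 0 t (1 : R))).
have E1 := nabla_curve g ds (smooth_at_diff sft) (smooth_at_diff sNt).
have E2 := derive_comp (1 : R) ds (smooth_at_diff sft).
have alg (a b c : 'rV[R]_3) (d e : 'rV[R]_3) : inner (g (f (s t))) a b + inner (g (f (s t))) c d = 0 ->
    a = e -> inner (g (f (s t))) d c = - inner (g (f (s t))) e b.
  move=> F <-; rewrite (inner_sym d c); last by rewrite st.
  by apply/eqP; rewrite -addr_eq0 addrC F.
have := alg _ _ _ _ _ D0 E1.
rewrite E2 st; exact.
Qed.

End SecondForm.

(** * The Cartan frame *)

Section NablaLinear.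
Variables (R : realType) (n : nat) (g : 'rV[R]_n -> 'M[R]_n).

Lemma christoffel_linear x u v w (a b : R) : metric_at g x ->
  christoffel g x u (a *: v + b *: w)
  = a *: christoffel g x u v + b *: christoffel g x u w.
Proof.
move=> mg; apply: (inner_inj (metric_at_inner mg)) => z.
have dg := metric_at_diff mg.
have D1 : 'D_(a *: v + b *: w) g x = a *: 'D_v g x + b *: 'D_w g x.
  by rewrite deriveD_dir // !deriveZ_dir.
have L := christoffel_lower u (a *: v + b *: w) z mg.
rewrite D1 in L; apply: etrans L _.
have Lv := christoffel_lower u v z mg; have Lw := christoffel_lower u w z mg.
have alg (c1 c2 : 'rV[R]_n) (A B C D : 'M[R]_n) :
    inner (g x) c1 z = 2^-1 * (inner A v z + inner B u z - inner D u v) ->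
    inner (g x) c2 z = 2^-1 * (inner A w z + inner C u z - inner D u w) ->
    2^-1 * (inner A (a *: v + b *: w) z + inner (a *: B + b *: C) u z
       - inner D u (a *: v + b *: w)) = inner (g x) (a *: c1 + b *: c2) z.
  move=> e1 e2; rewrite !innerDl !innerDr !innerZl !innerZr innerDmx !innerZmx e1 e2.
  by ring.
exact: alg Lv Lw.
Qed.

Lemma nabla_lincomb (P : normedModType R) (f V W : P -> 'rV[R]_n) (a b : P -> R) p u :
  metric_at g (f p) -> differentiable V p -> differentiable W p ->
  differentiable a p -> differentiable b p ->
  nabla g f (fun q => a q *: V q + b q *: W q) p u =
  ('D_u a p *: V p + a p *: nabla g f V p u) + ('D_u b p *: W p + b p *: nabla g f W p u).
Proof.
move=> mg dV dW da db; have sV := differentiable_scale da dV.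
have sW := differentiable_scale db dW.
have E1 := derive_scale u da dV; have E2 := derive_scale u db dW.
have dV' : derivable (fun y => a y *: V y) p u by exact: diff_derivable.
have dW' : derivable (fun y => b y *: W y) p u by exact: diff_derivable.
have E := deriveD dV' dW'.
apply: etrans (f_equal2 +%R (etrans E (f_equal2 +%R E1 E2))
  (christoffel_linear ('D_u f p) (V p) (W p) (a p) (b p) mg)) _.
rewrite /nabla !scalerDr.
move: (a p *: 'D_u V p) (b p *: 'D_u W p) ('D_u a p *: _) ('D_u b p *: _) => x y z t.
move: (a p *: _) (b p *: _) => c d.
by rewrite [x + z]addrC [y + t]addrC addrACA -!addrA.
Qed.

End NablaLinear.

Section OrthonormalFrame.
Variables (R : realType) (G : 'M[R]_3) (a b c : 'rV[R]_3).
Hypotheses (pG : inner_product G) (pos : 0 < det3 a b c).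
Hypotheses (aa : inner G a a = 1) (bb : inner G b b = 1) (cc : inner G c c = 1).
Hypotheses (ab : inner G a b = 0) (ac : inner G a c = 0) (bc : inner G b c = 0).

(** a x b is a multiple of c of norm 1, with a positive factor. *)
Lemma cross_orthonormal : cross G a b = c.
Proof.
have d0 : det3 a b c != 0 by rewrite gt_eqF.
have w1 := inner_cross_cross pG a b a b; rewrite aa bb ab mul0r subr0 mulr1 in w1.
have wa := inner_cross_l pG a b; have wb := inner_cross_r pG a b.
have wc : 0 < inner G (cross G a b) c.
  rewrite (inner_cross pG) mulr_gt0 // sqrtr_gt0; exact: inner_product_det.
move: (cross G a b) w1 wa wb wc => w w1 wa wb wc.
have wE : w = inner G w c *: c.
  apply/eqP; rewrite -subr_eq0; apply/eqP; apply: (det3_zero pG d0); rewrite innerBr innerZr.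
  - by rewrite (inner_sym a w pG) wa ac mulr0 subrr.
  - by rewrite (inner_sym b w pG) wb bc mulr0 subrr.
  - by rewrite (inner_sym c w pG) cc mulr1 subrr.
have : inner G w c ^+ 2 = 1.
  by rewrite -w1 [in RHS]wE innerZl innerZr cc mulr1 expr2.
move/eqP; rewrite sqrf_eq1 => /orP[/eqP k1|/eqP k1].
  by rewrite wE k1 scale1r.
by move: wc; rewrite k1 oppr_gt0 ltr10.
Qed.

End OrthonormalFrame.

Lemma cross_lincomb (R : realType) (G : 'M[R]_3) (u v w : 'rV[R]_3) (a b : R) :
  inner_product G -> cross G (a *: u + b *: v) w = a *: cross G u w + b *: cross G v w.
Proof.
move=> pG; apply: (inner_inj pG) => z; rewrite (inner_cross pG) (volDl pG) !(volZl pG).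
by rewrite innerDl (innerZl G a) (innerZl G b) !(inner_cross pG).
Qed.

Section CartanFrame.
Variables (R : realType) (kappa tau : R).
Local Notation E1 := (@E1 R kappa tau).
Local Notation E2 := (@E2 R kappa tau).
Local Notation E3 := (E3 R).
Local Notation cg := (@cartan_gram R kappa tau).
Implicit Types x : 'rV[R]_3.

Lemma inner_row (eta u v : 'rV[R]_3) :
  inner (eta^T *m eta) u v = (u *m eta^T) 0 0 * (v *m eta^T) 0 0.
Proof.
rewrite /inner mulmxA -mulmxA mxE big_ord1; congr (_ * _).
by rewrite !mxE; apply: eq_bigr => i _; rewrite !mxE mulrC.
Qed.

Lemma cartan_inner x u v : inner (cg x) u v =
  let lam := (lambda_inv kappa x)^-1 in
  let eta w := tau * lam * (x 0 1 * w 0 0 - x 0 0 * w 0 1) + w 0 ord_max in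
  lam ^+ 2 * (u 0 0 * v 0 0 + u 0 1 * v 0 1) + eta u * eta v.
Proof.
rewrite /cartan_gram innerDmx innerZmx innerDmx !inner_row !mxE !sum3E !mxE /=.
ring.
Qed.

Lemma cartan_frame x : 0 < lambda_inv kappa x ->
  [/\ inner (cg x) (E1 x) (E1 x) = 1, inner (cg x) (E2 x) (E2 x) = 1
    & inner (cg x) E3 E3 = 1] /\
  [/\ inner (cg x) (E1 x) (E2 x) = 0, inner (cg x) (E1 x) E3 = 0,
     inner (cg x) (E2 x) E3 = 0 & 0 < det3 (E1 x) (E2 x) E3].
Proof.
move=> l0; have l1 : lambda_inv kappa x != 0 by rewrite gt_eqF.
rewrite !cartan_inner det3E /E1 /E2 /E3 !mxE /=.
move: (lambda_inv kappa x) l0 l1 => l l0 l1.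
split; split; try by field.
by have := mulr_gt0 l0 l0; lra.
Qed.

Lemma derive_invariant (V W : normedModType R) (f : V -> W) y v :
  (forall h : R, f (h *: v + y) = f y) -> 'D_v f y = 0.
Proof.
move=> fi; rewrite /derive /= (_ : (fun h => _) = (fun=> 0)).
  by apply: cvg_lim => //; exact: cvg_cst.
by apply/funext => h /=; rewrite fi subrr scaler0.
Qed.

Lemma smooth_row3 (V : normedModType R) (a b c : V -> R) y :
  smooth_at a y -> smooth_at b y -> smooth_at c y ->
  smooth_at (fun z => row3 (a z) (b z) (c z)) y.
Proof.
move=> sa sb sc; apply: smooth_at_mx => i; apply: forall_I3.
- by have -> : (fun z => row3 (a z) (b z) (c z) i 0) = a by apply/funext => z; rewrite mxE.
- by have -> : (fun z => row3 (a z) (b z) (c z) i 1) = b by apply/funext => z; rewrite mxE.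
- by have -> : (fun z => row3 (a z) (b z) (c z) i ord_max) = c by apply/funext => z; rewrite mxE.
Qed.

Let sco i y : smooth_at (fun z : 'rV[R]_3 => z 0 i) y.
Proof. by apply: smooth_at_coord; exact: smooth_at_id. Qed.

Let slam y : smooth_at (lambda_inv kappa) y.
Proof.
apply: smooth_atD; first exact: smooth_at_cst.
apply: smooth_atM; first exact: smooth_at_cst.
by apply: smooth_atD; exact: smooth_atM.
Qed.

Lemma smooth_E1 y : smooth_at E1 y.
Proof.
apply: smooth_row3 => //; first exact: smooth_at_cst.
by apply: smooth_atN; apply: smooth_atM => //; exact: smooth_at_cst.
Qed.

Lemma smooth_E2 y : smooth_at E2 y.
Proof.
apply: smooth_row3 => //; first exact: smooth_at_cst.
by apply: smooth_atM => //; exact: smooth_at_cst.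
Qed.

Let shift_E3 h (y : 'rV[R]_3) : (h *: E3 + y) 0 0 = y 0 0 /\ (h *: E3 + y) 0 1 = y 0 1.
Proof. by split; rewrite !mxE /= mulr0 add0r. Qed.

Lemma derive_E1_E3 y : 'D_E3 E1 y = 0.
Proof.
apply: derive_invariant => h; have [e0 e1] := shift_E3 h y.
by rewrite /E1 /lambda_inv e0 e1.
Qed.

Lemma derive_E2_E3 y : 'D_E3 E2 y = 0.
Proof.
apply: derive_invariant => h; have [e0 e1] := shift_E3 h y.
by rewrite /E2 /lambda_inv e0 e1.
Qed.

Variables (g : 'rV[R]_3 -> 'M[R]_3) (xi : 'rV[R]_3 -> 'rV[R]_3) (y0 : 'rV[R]_3).
Hypotheses (mg : metric_at g y0) (gE : g y0 = cg y0) (l0 : 0 < lambda_inv kappa y0).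
Hypothesis xiE : \forall y \near y0, xi y = E3.
Hypothesis bundle : forall u, nabla g idfun xi y0 u = tau *: cross (g y0) u (xi y0).

Let pG : inner_product (g y0). Proof. exact: metric_at_inner. Qed.

Let frame_cross : cross (g y0) (E1 y0) E3 = - E2 y0 /\ cross (g y0) (E2 y0) E3 = E1 y0.
Proof.
have := cartan_frame l0; rewrite -gE; move=> [[n1 n2 n3] [h12 h13 h23 d]].
have d23 : 0 < det3 (E2 y0) E3 (E1 y0).
  by move: d; rewrite !det3E; congr (0 < _); ring.
have d31 : 0 < det3 E3 (E1 y0) (E2 y0).
  by move: d; rewrite !det3E; congr (0 < _); ring.
split; last by apply: (cross_orthonormal pG d23) => //; rewrite (inner_sym _ _ pG).
have c31 : cross (g y0) E3 (E1 y0) = E2 y0.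
  by apply: (cross_orthonormal pG d31) => //; rewrite (inner_sym _ _ pG).
apply: (inner_inj pG) => w; rewrite (inner_cross pG) (vol_swap _ E3) -(inner_cross pG) c31.
by rewrite innerNl.
Qed.

(* E3 commutes with the frame, so its derivative in the direction E3 is that
   of xi in the direction of the frame. *)
Let nabla_frame (Y : 'rV[R]_3 -> 'rV[R]_3) : 'D_E3 Y y0 = 0 ->
  nabla g idfun Y y0 E3 = tau *: cross (g y0) (Y y0) E3.
Proof.
move=> DY; rewrite /nabla DY add0r derive_id.
have xi0 : xi y0 = E3 := nbhs_singleton xiE.
have E := bundle (Y y0); rewrite xi0 in E; rewrite -E /nabla xi0.
have -> : 'D_(Y y0) xi y0 = 0.
  by apply: etrans (near_eq_derive (Y y0) xiE) _; exact: derive_cst.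
rewrite derive_id add0r; exact: christoffel_sym.
Qed.

(** The frame rotates about the fiber with speed - tau, and the field rotates in
    the frame with speed a'. *)
Lemma nabla_horizontal_field (q : R -> 'rV[R]_3) (a : R -> R) t :
  q t = y0 -> differentiable q t -> 'D_1 q t = E3 -> differentiable a t ->
  nabla g q (fun r => cos (a r) *: E1 (q r) + sin (a r) *: E2 (q r)) t 1
  = (tau - 'D_1 a t) *: cross (g y0) (cos (a t) *: E1 y0 + sin (a t) *: E2 y0) E3.
Proof.
move=> qt dq q' da.
have dca : differentiable (fun r => cos (a r)) t.
  exact: (differentiable_comp da (differentiable_cos _)).
have dsa : differentiable (fun r => sin (a r)) t.
  exact: (differentiable_comp da (differentiable_sin _)).
have d1 : differentiable E1 (q t) by exact: smooth_at_diff (smooth_E1 _).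
have d2 : differentiable E2 (q t) by exact: smooth_at_diff (smooth_E2 _).
have dq1 : differentiable (fun r => E1 (q r)) t by exact: (differentiable_comp dq d1).
have dq2 : differentiable (fun r => E2 (q r)) t by exact: (differentiable_comp dq d2).
have N1 := nabla_comp g (1 : R) dq d1; have N2 := nabla_comp g (1 : R) dq d2.
rewrite q' qt (nabla_frame (derive_E1_E3 y0)) in N1.
rewrite q' qt (nabla_frame (derive_E2_E3 y0)) in N2.
have mgq : metric_at g (q t) by rewrite qt.
apply: etrans (nabla_lincomb (1 : R) mgq dq1 dq2 dca dsa) _.
rewrite N1 N2 (derive_cos_comp da) (derive_sin_comp da) qt; have [c1 c2] := frame_cross.
rewrite (cross_lincomb _ _ _ _ _ pG) c1 c2; move: (E1 y0) (E2 y0) ('D_1 a t) (cos (a t)) (sin (a t)) => e1 e2 D c s.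
by apply/rowP => i; rewrite !mxE; ring.
Qed.

End CartanFrame.

(** * Local expressions of maps and curves *)

Section Charts.
Variables (R : realType) (n : nat) (X : topologicalType).
Implicit Types (c d : chart R n X) (p : X).

Lemma cinv_cod c y : (c @` cdom c) y -> cdom c (cinv c y) /\ c (cinv c y) = y.
Proof. by move=> [p cp <-]; rewrite cfunK. Qed.

Lemma near_cod c p : cdom c p -> \forall y \near c p, (c @` cdom c) y.
Proof. by move=> cp; apply: open_nbhs_nbhs; split; [exact: ccod_open | exists p]. Qed.

Lemma near_cinv c p (U : set X) : cdom c p -> nbhs p U ->
  \forall y \near c p, U (cinv c y).
Proof.
move=> cp pU; have cont : {for c p, continuous (cinv c)} by apply: cinv_cont; exists p.
by apply: cont; rewrite /= cfunK.
Qed.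

Lemma near_cinv_map (Y : topologicalType) (F : X -> Y) c p (U : set Y) :
  {for p, continuous F} -> cdom c p -> nbhs (F p) U ->
  \forall y \near c p, U (F (cinv c y)).
Proof. by move=> cF cp pU; apply: (near_cinv (U := F @^-1` U) cp); exact: cF. Qed.

Lemma near_cdom c p : cdom c p -> nbhs p (cdom c).
Proof. by move=> cp; apply: open_nbhs_nbhs; split => //; exact: cdom_open. Qed.

Lemma near_curve c (s : R -> X) t : {for t, continuous s} -> cdom c (s t) ->
  \forall r \near t, cdom c (s r).
Proof. by move=> cs cst; apply: cs; exact: near_cdom. Qed.

Lemma cfun_open c p (U : set 'rV[R]_n) : cdom c p -> nbhs (c p) U ->
  \forall q \near p, cdom c q /\ U (c q).
Proof.
move=> cp pU; apply: filterI; first exact: near_cdom.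
by have := cfun_cont cp; apply.
Qed.

End Charts.

Section LocalExpressions.
Variables (R : realType) (n m k : nat) (X Y Z : topologicalType).
Variables (c : chart R n X) (d : chart R m Y) (e : chart R k Z).

Lemma ldom_open (F : X -> Y) : continuous F -> open (ldom c d F).
Proof.
move=> cF; rewrite openE => _ [p [cp dp] <-].
have := near_cinv_map (cF _) cp (near_cdom dp).
apply: filterS2 (near_cod cp) => y yc yd.
have [c1 c2] := cinv_cod yc.
by exists (cinv c y).
Qed.

Lemma lrepE (F : X -> Y) p : cdom c p -> lrep c d F (c p) = d (F p).
Proof. by move=> cp; rewrite /lrep cfunK. Qed.

Lemma lrep_curve (F : X -> Y) (s : R -> X) t : {for t, continuous s} ->
  cdom c (s t) -> {near t, (fun r => lrep c d F (c (s r))) =1 d \o F \o s}.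
Proof.
move=> cs cst; apply: filterS (near_curve cs cst) => r cr.
exact: lrepE.
Qed.

Lemma lrep_comp (F : X -> Y) (G : Y -> Z) p : {for p, continuous F} ->
  cdom c p -> cdom d (F p) ->
  {near c p, (fun y => lrep d e G (lrep c d F y)) =1 lrep c e (G \o F)}.
Proof.
move=> cF cp dp; have := near_cinv_map cF cp (near_cdom dp).
by apply: filterS => y dy; rewrite /lrep /= cfunK.
Qed.

End LocalExpressions.

Section Manifold.
Variables (R : realType) (n : nat) (M : riemannian R n).
Implicit Types (c d : chart R n M) (p : M).

Lemma smooth_at_transition c d p : atlas c -> atlas d -> cdom c p -> cdom d p ->
  smooth_at (lrep c d (@id M)) (c p).
Proof.
move=> ac ad cp dp; apply: (smooth_on_at (U := ldom c d id)); last exact: atlas_smooth.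
  by apply: ldom_open => x; exact: cvg_id.
by exists p.
Qed.

Lemma smooth_at_gram c p : atlas c -> cdom c p -> smooth_at (gram c) (c p).
Proof.
move=> ac cp; apply: (smooth_on_at (U := c @` cdom c)); last exact: gram_smooth.
  exact: ccod_open.
by exists p.
Qed.

Lemma gram_inner_product c p : atlas c -> cdom c p -> inner_product (gram c (c p)).
Proof.
move=> ac cp; split; first exact: gram_sym.
by move=> u u0; exact: gram_pos.
Qed.

Lemma metric_at_gram c p : atlas c -> cdom c p -> metric_at (gram c) (c p).
Proof.
move=> ac cp; split; first exact: smooth_at_gram.
apply: filterS (near_cod cp) => _ [q cq <-]; exact: gram_inner_product.
Qed.

Lemma smooth_at_lrep m (N : riemannian R m) (F : M -> N) c (d : chart R m N) p :
  smooth_map F -> atlas c -> atlas d -> cdom c p -> cdom d (F p) ->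
  smooth_at (lrep c d F) (c p).
Proof.
move=> [cF sF] ac ad cp dp; apply: (smooth_on_at (U := ldom c d F)); last exact: sF.
  exact: ldom_open.
by exists p.
Qed.

Lemma smooth_at_curve (I : set R) (s : R -> M) c t : open I -> smooth_curve I s ->
  I t -> atlas c -> cdom c (s t) -> smooth_at (fun r => c (s r)) t.
Proof.
move=> oI [cs ss] It ac cst; apply: (smooth_on_at (U := I `&` s @^-1` cdom c)) => //; last exact: ss.
rewrite openE => r [Ir cr]; apply: filterI; first exact: open_nbhs_nbhs.
by apply: near_curve => //; exact: cs.
Qed.

End Manifold.

Section Immersions.
Variables (R : realType) (S : riemannian R 2) (kappa tau : R) (E : Ekt kappa tau).
Variables (phi : S -> E) (c : chart R 2 S) (d : chart R 3 E) (p : S).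
Hypotheses (iso : isometric_immersion phi) (ac : atlas c) (ad : atlas d).
Hypotheses (cp : cdom c p) (dp : cdom d (phi p)).

Lemma near_phi : \forall y \near c p, [/\ cdom c (cinv c y), c (cinv c y) = y
  & cdom d (phi (cinv c y))].
Proof.
have cF : continuous phi by case: iso => [[]].
have := near_cinv_map (cF _) cp (near_cdom dp).
apply: filterS2 (near_cod cp) => y yc yd.
by have [c1 c2] := cinv_cod yc.
Qed.

Lemma immersion_at_lrep : immersion_at (gram d) (lrep c d phi) (c p).
Proof.
have [sm iE] := iso; split; first exact: smooth_at_lrep.
  by rewrite lrepE //; exact: metric_at_gram.
apply: filterS near_phi => y [cy cE dy].
have fE : lrep c d phi y = d (phi (cinv c y)) by [].
rewrite fE; split; first exact: gram_inner_product.
move=> v v0; have := iE c d _ v v ac ad cy dy; rewrite cE => ->.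
by rewrite -cE; exact: gram_pos.
Qed.

Lemma first_form_gram : first_form (gram d) (lrep c d phi) (c p) = gram c (c p).
Proof.
have [sm iE] := iso; apply/matrixP => i j; rewrite mxE lrepE // iE //.
by rewrite /inner -rowE trmx_delta -colE !mxE.
Qed.

End Immersions.

(** * The bundle projection *)

(** By the rank theorem the kernel is a line. *)
Lemma kernel_line (R : fieldType) (A : 'M[R]_(3, 2)) (u k : 'rV[R]_3) :
  (forall w : 'rV[R]_2, exists v : 'rV[R]_3, v *m A = w) -> u != 0 -> u *m A = 0 -> k *m A = 0 ->
  exists a, k = a *: u.
Proof.
move=> surj u0 uA kA; apply/sub_rVP.
have rA : \rank A = 2.
  apply/eqP; rewrite -[_ == _]/(row_full A) -sub1mx; apply/row_subP => i.
  have [v vA] := surj (row i 1%:M); apply/submxP; exists v; exact: esym.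
have rk : \rank (kermx A) = 1 by rewrite mxrank_ker rA.
have uK : (u <= kermx A)%MS by apply/sub_kermxP.
have ru : \rank u = 1 by rewrite rank_rV u0.
apply: submx_trans (_ : (kermx A <= u)%MS); first exact/sub_kermxP.
by move: (mxrank_leqif_sup uK) => [_ <-]; rewrite rk ru.
Qed.

Lemma polarization (R : realType) (G : 'M[R]_2) (g : 'M[R]_3) (a b : 'rV[R]_2)
    (u v x : 'rV[R]_3) : inner_product G -> inner_product g ->
  inner G a a = inner g u u - inner g u x * inner g u x ->
  inner G b b = inner g v v - inner g v x * inner g v x ->
  inner G (a + b) (a + b) = inner g (u + v) (u + v) - inner g (u + v) x * inner g (u + v) x ->
  inner G a b = inner g u v - inner g u x * inner g v x.
Proof.
move=> pG pg; rewrite !(innerDl, innerDr) => -> ->.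
rewrite (inner_sym v u pg) (inner_sym b a pG); lra.
Qed.

Section Projection.
Variables (R : realType) (kappa tau : R) (E : Ekt kappa tau).
Variables (d : chart R 3 E) (e : chart R 2 (base_space E)).
Hypotheses (ad : atlas d) (ae : atlas e).
Local Notation pi := (@bundle_proj R kappa tau E).
Local Notation P := (lrep d e pi).
Local Notation g := (gram d).

Lemma smooth_at_xi p : cdom d p -> smooth_at (xi d) (d p).
Proof.
move=> dp; apply: (smooth_on_at (U := d @` cdom d)); last exact: xi_smooth.
  exact: ccod_open.
by exists p.
Qed.

Lemma smooth_at_proj p : cdom d p -> cdom e (pi p) -> smooth_at P (d p).
Proof. by move=> dp ep; apply: smooth_at_lrep => //; exact: proj_smooth. Qed.

(** Integral curves of xi stay in a fiber. *)
Lemma proj_xi p : cdom d p -> cdom e (pi p) -> 'D_(xi d (d p)) P (d p) = 0.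
Proof.
move=> dp ep; have [s [[cs is_s] s0 fib]] := xi_complete p.
have ds0 : cdom d (s 0) by rewrite s0.
have [der Ds] := is_s d 0 ad ds0.
have dsd : differentiable (fun r => d (s r)) 0 by apply/derivable1_diffP.
have dP : differentiable P (d (s 0)) by rewrite s0; exact: smooth_at_diff (smooth_at_proj dp ep).
have comp := derive_comm.
have E1 := derive_comp (1 : R) dsd dP; rewrite Ds s0 in E1; rewrite -E1.
have near_cst : {near (0 : R), (fun r => P (d (s r))) =1 cst (e (pi p))}.
  apply: filterS (lrep_curve e pi (cs 0) ds0) => r ->.
  by rewrite /= (_ : pi (s r) = pi p) //; apply/fib; exists r.
by apply: etrans (near_eq_derive (1 : R) near_cst) _; exact: derive_cst.
Qed.

Lemma xi_neq0 p : cdom d p -> xi d (d p) != 0.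
Proof.
move=> dp; apply/eqP => x0; have := xi_unit ad dp; rewrite x0 inner0l.
by move/esym/eqP; rewrite oner_eq0.
Qed.

Lemma proj_kernel p k : cdom d p -> cdom e (pi p) -> 'D_k P (d p) = 0 ->
  exists a, k = a *: xi d (d p).
Proof.
move=> dp ep k0; have dP := smooth_at_diff (smooth_at_proj dp ep).
pose A : 'M[R]_(3, 2) := \matrix_i 'D_(basis_vec R i) P (d p).
have AE v : v *m A = 'D_v P (d p).
  by rewrite (derive_basis _ dP) mulmx_sum_row; apply: eq_bigr => i _; rewrite rowK.
apply: (@kernel_line _ A); rewrite ?AE //; last 2 first.
- exact: xi_neq0.
- exact: proj_xi.
by move=> w; have [v vw] := proj_submersion ad ae dp ep w; exists v; rewrite AE.
Qed.

(** The projection kills the vertical part of a vector and preserves the length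
    of the horizontal part. *)
Lemma proj_inner p u v : cdom d p -> cdom e (pi p) ->
  inner (gram e (e (pi p))) ('D_u P (d p)) ('D_v P (d p)) =
  inner (g (d p)) u v - inner (g (d p)) u (xi d (d p)) * inner (g (d p)) v (xi d (d p)).
Proof.
move=> dp ep; have dP := smooth_at_diff (smooth_at_proj dp ep).
have pg := gram_inner_product ad dp; have pG := gram_inner_product ae ep.
have x1 := xi_unit ad dp; have xk := proj_xi dp ep.
have ker k : 'D_k P (d p) = 0 -> exists a, k = a *: xi d (d p) by exact: proj_kernel.
have riem := proj_riemannian ad ae dp ep.
move: (xi d (d p)) x1 xk ker => x x1 xk ker.
have sq w : inner (gram e (e (pi p))) ('D_w P (d p)) ('D_w P (d p)) =
    inner (g (d p)) w w - inner (g (d p)) w x * inner (g (d p)) w x.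
  pose b := inner (g (d p)) w x; pose h := w + (- b) *: x.
  have hx : inner (g (d p)) h x = 0 by rewrite innerDl innerZl x1 mulr1 subrr.
  have Dh : 'D_h P (d p) = 'D_w P (d p).
    by rewrite (deriveD_dir _ _ dP) (deriveZ_dir _ _ dP) xk scaler0 addr0.
  rewrite -Dh riem; last by move=> k /ker[a ->]; rewrite innerZr hx mulr0.
  rewrite /h !(innerDl, innerDr, innerZl, innerZr) x1 (inner_sym x w pg) -/b.
  by ring.
apply: (polarization pG pg) (sq u) (sq v) _.
by rewrite -(deriveD_dir _ _ dP); exact: sq.
Qed.

Lemma near_proj p : cdom d p -> cdom e (pi p) ->
  \forall y \near d p, [/\ cdom d (cinv d y), d (cinv d y) = y & cdom e (pi (cinv d y))].
Proof.
move=> dp ep; have cF : continuous pi by have [] := proj_smooth E.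
have := near_cinv_map (cF _) dp (near_cdom ep).
by apply: filterS2 (near_cod dp) => y yc yd; have [c1 c2] := cinv_cod yc.
Qed.

Lemma near_proj_inner p : cdom d p -> cdom e (pi p) ->
  \forall y \near d p, forall u v,
    inner (gram e (P y)) ('D_u P y) ('D_v P y) =
    inner (g y) u v - inner (g y) u (xi d y) * inner (g y) v (xi d y).
Proof.
move=> dp ep; apply: filterS (near_proj dp ep) => y [dy yE ey] u v.
have := proj_inner u v dy ey; rewrite yE => <-.
by congr (inner (gram e _) _ _).
Qed.

(** [submersion_curve] for pi, where the bundle curvature gives the derivative
    of xi. *)
Lemma proj_curve (s : R -> 'rV[R]_3) t p n : cdom d p -> cdom e (pi p) ->
  s t = d p -> smooth_at s t -> inner (g (d p)) n (xi d (d p)) = 0 ->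
  inner (gram e (P (d p))) (nabla (gram e) (fun r => P (s r)) (fun r => 'D_1 (fun r => P (s r)) r) t 1)
    ('D_n P (d p))
  = inner (g (d p)) (nabla g s (fun r => 'D_1 s r) t 1) n
    - 2 * inner (g (d p)) ('D_1 s t) (xi d (d p))
        * (tau * inner (g (d p)) (cross (g (d p)) ('D_1 s t) (xi d (d p))) n).
Proof.
move=> dp ep st ss n0.
have mg := metric_at_gram ad dp.
have mG : metric_at (gram e) (P (d p)) by rewrite lrepE //; exact: metric_at_gram.
have := submersion_curve mg mG (smooth_at_proj dp ep) (smooth_at_xi dp)
  (near_proj_inner dp ep) (fun u v => xi_killing u v ad dp) st ss n0.
move=> ->; congr (_ - _ * _).
by rewrite (xi_bundle_curvature _ ad dp) innerZl.
Qed.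

End Projection.

(** * A minimal surface along a vertical segment *)

Lemma inner_cross_self (R : realType) (G : 'M[R]_3) (N x : 'rV[R]_3) : inner_product G ->
  inner G N N = 1 -> inner G x x = 1 -> inner G N x = 0 ->
  inner G (cross G N x) (cross G N x) = 1 /\ inner G N (cross G (cross G N x) x) = - 1.
Proof.
move=> pG NN xx Nx; split; first by rewrite inner_cross_cross // NN xx Nx mul0r subr0 mulr1.
rewrite (inner_sym N _ pG) (inner_cross pG) (vol_rot G (cross G N x)) -(inner_cross pG).
by rewrite (inner_cross_cross pG) (inner_sym x N pG) Nx xx NN mul0r sub0r mulr1.
Qed.

Section VerticalSegment.
Variables (R : realType) (kappa tau : R).
Variables (g : 'rV[R]_3 -> 'M[R]_3) (xi : 'rV[R]_3 -> 'rV[R]_3).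
Variables (f : 'rV[R]_2 -> 'rV[R]_3) (s : R -> 'rV[R]_2) (a : R -> R) (l t : R).
Local Notation x := (s t).
Local Notation X := ('D_1 s t).
Local Notation y := (f x).
Local Notation N := (unit_normal g f).
Hypotheses (imm : immersion_at g f x) (ss : smooth_at s t).
Hypotheses (gE : g y = cartan_gram kappa tau y) (lam : 0 < lambda_inv kappa y).
Hypothesis xiE : \forall z \near y, xi z = E3 R.
Hypothesis bundle : forall u, nabla g idfun xi y u = tau *: cross (g y) u (xi y).
Hypotheses (xi1 : inner (g y) (xi y) (xi y) = 1) (sxi : smooth_at xi y).
Hypothesis vertical : push f x X = xi y.
Hypotheses (l0 : 0 < l) (tl : 0 <= t <= l) (da : differentiable a t).
Hypothesis normal : \forall r \near t, 0 <= r <= l -> N (s r) =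
  cos (a r) *: E1 kappa tau (f (s r)) + sin (a r) *: E2 kappa tau (f (s r)).

Let sf : smooth_at f x. Proof. by case: imm. Qed.
Let df : differentiable f x. Proof. exact: smooth_at_diff. Qed.
Let ds : differentiable s t. Proof. exact: smooth_at_diff. Qed.
Let mg : metric_at g y. Proof. by case: imm. Qed.
Let pG : inner_product (g y). Proof. exact: metric_at_inner. Qed.
Let pos : forall v, v != 0 -> 0 < inner (g y) (push f x v) (push f x v).
Proof. by case: imm => _ _ /nbhs_singleton[]. Qed.
Let NN : inner (g y) (N x) (N x) = 1. Proof. exact: unit_normal_unit. Qed.
Let Nxi : inner (g y) (N x) (xi y) = 0.
Proof. by rewrite -vertical; exact: unit_normal_push. Qed.

(** The normal is horizontal along the segment, so it turns about the fiber. *)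
Lemma nabla_normal :
  nabla g f N x X = (tau - 'D_1 a t) *: cross (g y) (N x) (xi y).
Proof.
have sN := smooth_at_diff (smooth_at_unit_normal imm).
have q' : 'D_1 (fun r => f (s r)) t = E3 R.
  rewrite (derive_comp (1 : R) ds df).
  by have := vertical; rewrite (nbhs_singleton xiE).
have dq : differentiable (fun r => f (s r)) t by exact: (differentiable_comp ds df).
have K := @nabla_horizontal_field R kappa tau g xi y mg gE lam xiE bundle
  (fun r => f (s r)) a t erefl dq q' da.
have N0 : N x = cos (a t) *: E1 kappa tau y + sin (a t) *: E2 kappa tau y.
  exact: nbhs_singleton normal tl.
have xi0 : xi y = E3 R := nbhs_singleton xiE.
apply: etrans (esym (nabla_curve g ds df sN)) _.
apply: etrans (etrans K _); last by rewrite N0 xi0.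
apply: f_equal2 (congr1 (christoffel g y _) N0).
apply: derive_eq_near_segment l0 tl normal _ _.
  exact: (differentiable_comp ds sN).
have dE1 := smooth_at_diff (@smooth_E1 R kappa tau y).
have dE2 := smooth_at_diff (@smooth_E2 R kappa tau y).
apply: differentiableD; apply: differentiable_scale.
- exact: (differentiable_comp da (differentiable_cos _)).
- exact: (differentiable_comp dq dE1).
- exact: (differentiable_comp da (differentiable_sin _)).
- exact: (differentiable_comp dq dE2).
Qed.

Let pJX : push f x (rotJ g f x X) = cross (g y) (N x) (xi y).
Proof. by rewrite (push_rotJ df pG pos) vertical. Qed.

(** The derivative of N is a multiple of N x xi = f_* J X. *)
Lemma shape_vertical :
  inner (first_form g f x) (shape_operator g f x X) X = 0 /\
  inner (first_form g f x) (shape_operator g f x X) (rotJ g f x X) = 'D_1 a t - tau.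
Proof.
have S v := inner_shape_operator df pG pos X v.
split; rewrite S nabla_normal.
  rewrite vertical; move: (inner_cross_r pG (N x) (xi y)).
  by move: (cross _ _ _) => w w0; rewrite innerZl w0 mulr0 oppr0.
rewrite pJX; move: (inner_cross_self pG NN xi1 Nxi) => [c _]; move: c.
by move: (cross _ _ _) => w w1; rewrite innerZl w1 mulr1 opprB.
Qed.

Lemma angle_vertical : 'D_X (angle g xi f) x = 0.
Proof.
rewrite (derive_angle imm X sxi) nabla_normal vertical bundle.
have -> : cross (g y) (xi y) (xi y) = 0.
  by apply: (inner_inj pG) => w; rewrite (inner_cross pG) vol_diag inner0l.
move: (inner_cross_r pG (N x) (xi y)).
by move: (cross _ _ _) => w w0; rewrite innerZl w0 mulr0 scaler0 inner0r addr0.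
Qed.

(** The derivative of N contributes tau - a', by the symmetry of the second
    fundamental form, and the derivative of xi contributes - tau. *)
Lemma angle_conormal : 'D_(rotJ g f x X) (angle g xi f) x = - 'D_1 a t.
Proof.
rewrite (derive_angle imm _ sxi) bundle.
have -> : inner (g y) (nabla g f N x (rotJ g f x X)) (xi y) = tau - 'D_1 a t.
  have := second_form_sym imm (rotJ g f x X) X; rewrite vertical => ->.
  rewrite nabla_normal pJX; move: (inner_cross_self pG NN xi1 Nxi) => [c _]; move: c.
  by move: (cross _ _ _) => w w1; rewrite innerZl w1 mulr1.
have [_] := inner_cross_self pG NN xi1 Nxi; rewrite -pJX.
move: (cross _ _ _) => w w1; rewrite innerZr w1; lra.
Qed.

End VerticalSegment.

(** * Sister surfaces along a vertical segment *)

(** The geodesic curvature of a curve only depends on its germ. *)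
Lemma nabla_near_curve (R : realType) n (g : 'rV[R]_n -> 'M[R]_n) (a b : R -> 'rV[R]_n) t :
  {near t, a =1 b} ->
  nabla g a (derive1 a) t 1 = nabla g b (fun r => 'D_1 b r) t 1.
Proof.
move=> ab; have a1 : {near t, derive1 a =1 (fun r => 'D_1 b r)}.
  move: (near_join ab); apply: filterS => r abr.
  by rewrite derive1E; exact: near_eq_derive.
rewrite /nabla (near_eq_derive (1 : R) a1) (near_eq_derive (1 : R) ab).
by rewrite (nbhs_singleton a1) (nbhs_singleton ab).
Qed.

Lemma derive_curve (R : realType) n m (M : riemannian R n) (N : riemannian R m) (F : M -> N)
    (c : chart R n M) (d : chart R m N) (s : R -> M) t :
  smooth_map F -> atlas c -> atlas d -> cdom c (s t) -> cdom d (F (s t)) ->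
  {for t, continuous s} -> differentiable (fun r => c (s r)) t ->
  'D_1 (fun r => d (F (s r))) t = 'D_('D_1 (fun r => c (s r)) t) (lrep c d F) (c (s t)).
Proof.
move=> sF ac ad cp dp cs ds.
have dF := smooth_at_diff (smooth_at_lrep sF ac ad cp dp).
by rewrite -(derive_comp (1 : R) ds dF); apply/esym/near_eq_derive; exact: lrep_curve.
Qed.

Section Sister.
Variables (R : realType) (kappa tau H kappa' tau' theta l : R).
Variables (E' : Ekt kappa' tau') (E : Ekt kappa tau) (S : riemannian R 2).
Variables (phi' : S -> E') (phi : S -> E) (gam : R -> S) (d0 : chart R 3 E').
Hypothesis sis : sister_immersions theta 0 H phi' phi.
Hypothesis vert : vertical_segment phi' gam l.
Hypothesis cart : cartan_chart d0.
Hypothesis dom0 : forall t : R, 0 <= t <= l -> cdom d0 (phi' (gam t)).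
Variables (c : chart R 2 S) (d : chart R 3 E) (t : R).
Hypotheses (ac : atlas c) (ad : atlas d) (tl : 0 <= t <= l).
Hypotheses (cp : cdom c (gam t)) (dp : cdom d (phi (gam t))).
Local Notation p := (gam t).
Local Notation s := (fun r : R => c (gam r)).
Local Notation x := (c p).
Local Notation X := ('D_1 s t).
Local Notation f' := (lrep c d0 phi').
Local Notation f := (lrep c d phi).
Local Notation g' := (gram d0).
Local Notation g := (gram d).
Local Notation y := (d (phi p)).
Local Notation J := (rotJ g f x).
Local Notation I := (gram c x).
Local Notation ka := (xi d y).

Let ad0 : atlas d0. Proof. by case: cart. Qed.
Let iso' : isometric_immersion phi'. Proof. by case: sis => _ _ []. Qed.
Let iso : isometric_immersion phi. Proof. by case: sis => _ _ _ []. Qed.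
Let imm' : immersion_at g' f' x. Proof. exact: immersion_at_lrep iso' ac ad0 cp (dom0 tl). Qed.
Let imm : immersion_at g f x. Proof. exact: immersion_at_lrep iso ac ad cp dp. Qed.
Let df' : differentiable f' x. Proof. by case: imm' => /smooth_at_diff. Qed.
Let df : differentiable f x. Proof. by case: imm => /smooth_at_diff. Qed.
Let fx' : f' x = d0 (phi' p). Proof. exact: lrepE. Qed.
Let fx : f x = y. Proof. exact: lrepE. Qed.
Let pG' : inner_product (g' (f' x)). Proof. by rewrite fx'; exact: gram_inner_product ad0 (dom0 tl). Qed.
Let pG : inner_product (g (f x)). Proof. by rewrite fx; exact: gram_inner_product. Qed.
Let pos' v : v != 0 -> 0 < inner (g' (f' x)) (push f' x v) (push f' x v).
Proof. by move: v; case: imm' => _ _ /nbhs_singleton[]. Qed.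
Let pos v : v != 0 -> 0 < inner (g (f x)) (push f x v) (push f x v).
Proof. by move: v; case: imm => _ _ /nbhs_singleton[]. Qed.
Let I' : first_form g' f' x = I. Proof. exact: first_form_gram iso' ac ad0 cp (dom0 tl). Qed.
Let IE : first_form g f x = I. Proof. exact: first_form_gram iso ac ad cp dp. Qed.

Lemma curve_continuous : {for t, continuous gam}.
Proof.
by have [_ [r r0 [cg _]] _] := vert; apply: cg => /=; move: tl r0 => /andP[*]; apply/andP; split; lra.
Qed.

Lemma curve_smooth : smooth_at s t.
Proof.
have [_ [r r0 sg] _] := vert; apply: smooth_at_curve sg _ ac cp; last first.
  by move=> /=; move: tl r0 => /andP[*]; apply/andP; split; lra.
exact: (@interval_open R (BRight (- r)) (BLeft (l + r))).
Qed.

Lemma sister_push_X : push f' x X = xi d0 (f' x).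
Proof.
have ds := smooth_at_diff curve_smooth.
have [_ _ v] := vert; rewrite fx' -(v d0 t ad0 tl (dom0 tl)) /velocity derive1E.
by apply/esym/derive_curve => //; [case: iso'|exact: dom0|exact: curve_continuous].
Qed.

Lemma velocity_unit : inner I X X = 1.
Proof.
by rewrite -I' first_formE // sister_push_X fx' xi_unit //; exact: dom0.
Qed.

Let data := let: And5 _ _ _ _ D := sis in D c d0 d p ac ad0 ad cp (dom0 tl) dp.

Lemma sister_J v : rotJ g f x v = rotJ g' f' x v.
Proof. by have [_ _] := data. Qed.

Lemma angle_zero' : angle g' (xi d0) f' x = 0.
Proof. by rewrite /angle -sister_push_X unit_normal_push. Qed.

Lemma angle_zero : angle g (xi d) f x = 0.
Proof. by have [_ _ _ ->] := data; exact: angle_zero'. Qed.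

Lemma xi_tangent_X : xi_tangent g' (xi d0) f' x = X.
Proof.
apply: (inner_inj (first_form_inner_product df' pG' pos')) => w.
rewrite /xi_tangent (inner_tangent_part df' pG' pos') angle_zero' scale0r subr0.
by rewrite first_formE // sister_push_X.
Qed.

Lemma sister_xi_tangent : xi_tangent g (xi d) f x = cos theta *: X + sin theta *: J X.
Proof. by have [_ -> _ _] := data; rewrite xi_tangent_X /Rot -sister_J. Qed.

(** The tangent part of xi is turned by theta, and it is all of xi because the
    angle function vanishes. *)
Lemma push_kernel : push f x (cos theta *: X + sin theta *: J X) = ka.
Proof.
rewrite -sister_xi_tangent /xi_tangent angle_zero scale0r subr0 fx.
apply: (push_tangent_part df pG pos).
by have := angle_zero; rewrite /angle (inner_sym _ _ pG) fx.
Qed.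

Lemma conormal_unit : inner I (J X) (J X) = 1.
Proof. by rewrite -IE (rotJ_isometry df pG pos) IE velocity_unit. Qed.
Lemma conormal_orth : inner I (J X) X = 0.
Proof. by rewrite -IE (rotJ_orth df pG pos). Qed.
Let XJ : inner I X (J X) = 0.
Proof. by rewrite inner_sym; [exact: conormal_orth | exact: gram_inner_product]. Qed.

Lemma conormal_line v : inner I v X = 0 -> v = inner I v (J X) *: J X.
Proof.
move=> v0; have := @rotJ_decomp _ _ _ _ df pG pos X v; rewrite IE => /(_ velocity_unit).
by rewrite v0 scale0r add0r.
Qed.

Lemma push_X_xi : inner (g y) (push f x X) ka = cos theta.
Proof.
rewrite -push_kernel -fx -(first_formE g df) IE; move: conormal_orth XJ conormal_unit velocity_unit.
by move: (J X) => z z1 z2 z3 z4; rewrite innerDr !innerZr z2 z4; ring.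
Qed.

Lemma push_JX_xi : inner (g y) (push f x (J X)) ka = sin theta.
Proof.
rewrite -push_kernel -fx -(first_formE g df) IE; move: conormal_orth XJ conormal_unit velocity_unit.
by move: (J X) => z z1 z2 z3 z4; rewrite innerDr !innerZr z1 z3; ring.
Qed.

Lemma sister_H : H = sin theta * tau'.
Proof. by have [_ [_ _ ->] _ _ _] := sis; ring. Qed.

Lemma sister_tau : tau = cos theta * tau'.
Proof. have [_ [_ e _] _ _ _] := sis; rewrite {1}e; ring. Qed.

Section Angle.
Variable vth : R -> R.
Hypothesis ang : normal_angle phi' d0 gam l vth.

Lemma normal_angle_smooth : smooth_at vth t.
Proof.
have [[r r0 sv] _] := ang; apply: smooth_on_at sv.
  exact: (@interval_open R (BRight (- r)) (BLeft (l + r))).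
by move=> /=; move: tl r0 => /andP[*]; apply/andP; split; lra.
Qed.

(* The hypotheses on the minimal surface hold in the chart d0. *)
Let core (T : Prop) : (
  g' (f' x) = cartan_gram kappa' tau' (f' x) ->
  0 < lambda_inv kappa' (f' x) ->
  (\forall z \near f' x, xi d0 z = E3 R) ->
  (forall u, nabla g' idfun (xi d0) (f' x) u = tau' *: cross (g' (f' x)) u (xi d0 (f' x))) ->
  inner (g' (f' x)) (xi d0 (f' x)) (xi d0 (f' x)) = 1 ->
  smooth_at (xi d0) (f' x) -> 0 < l -> differentiable vth t ->
  (\forall r \near t, 0 <= r <= l -> unit_normal g' f' (c (gam r)) =
     cos (vth r) *: E1 kappa' tau' (f' (c (gam r))) + sin (vth r) *: E2 kappa' tau' (f' (c (gam r)))) ->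
  T) -> T.
Proof.
have [_ cd] := cart; have p0 := dom0 tl; apply; rewrite ?fx'.
- by case: (cd _ p0).
- by case: (cd _ p0).
- by apply: filterS (near_cod p0) => _ [q dq <-]; case: (cd _ dq).
- by move=> u; exact: xi_bundle_curvature.
- exact: xi_unit.
- exact: smooth_at_xi.
- by case: vert.
- exact: smooth_at_diff normal_angle_smooth.
- have [_ N] := ang; apply: filterS (near_curve curve_continuous cp) => r cr rl.
  by rewrite (N c r ac rl cr) lrepE.
Qed.

(** A = Rot_theta A' + H, J is skew and H = tau' sin theta. *)
Lemma sister_shape : inner I (shape_operator g f x X) X = 2 * H - sin theta * 'D_1 vth t.
Proof.
have [sh _ _ _] := data; rewrite sh.
have [] : inner I (shape_operator g' f' x X) X = 0 /\
  inner I (shape_operator g' f' x X) (rotJ g' f' x X) = 'D_1 vth t - tau'.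
  apply: core => h1 h2 h3 h4 h5 h6 h7 h8 h9.
  have := shape_vertical imm' curve_smooth h1 h2 h3 h4 h5 sister_push_X h7 tl h8 h9.
  by rewrite I'.
rewrite /Rot scale0r subr0.
have := rotJ_skew df' pG' pos' (shape_operator g' f' x X) X; rewrite I'.
have := velocity_unit; move: (rotJ g' f' x) (shape_operator g' f' x X) => K A x1 skew AX AJ.
rewrite !innerDl !innerZl skew AX AJ x1 sister_H; ring.
Qed.

Lemma sister_angle_near : {near x, angle g (xi d) f =1 angle g' (xi d0) f'}.
Proof.
have n1 := near_phi iso cp dp; have n2 := near_phi iso' cp (dom0 tl).
apply: filterS2 n1 n2 => z [z1 z2 z3] [_ _ z4].
have [_ _ _ _ D] := sis.
by have [_ _ _] := D c d0 d (cinv c z) ac ad0 ad z1 z4 z3; rewrite z2.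
Qed.

Lemma sister_angle_X : 'D_X (angle g (xi d) f) x = 0.
Proof.
rewrite (near_eq_derive X sister_angle_near).
apply: core => h1 h2 h3 h4 h5 h6 h7 h8 h9.
exact: (angle_vertical imm' curve_smooth h1 h2 h3 h4 h6 sister_push_X h7 tl h8 h9).
Qed.

Lemma sister_angle_conormal : 'D_(J X) (angle g (xi d) f) x = - 'D_1 vth t.
Proof.
rewrite (near_eq_derive (J X) sister_angle_near) sister_J.
apply: core => h1 h2 h3 h4 h5 h6 h7 h8 h9.
exact: (angle_conormal imm' curve_smooth h1 h2 h3 h4 h5 h6 sister_push_X h7 tl h8 h9).
Qed.

Lemma sister_angle_smooth : smooth_at (angle g (xi d) f) x.
Proof.
have sf : smooth_at f x by case: imm.
apply: smooth_at_inner; last 2 first.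
- exact: smooth_at_unit_normal imm.
- by apply: smooth_at_comp => //; rewrite fx; exact: smooth_at_xi.
- by apply: smooth_at_comp => //; rewrite fx; exact: smooth_at_gram.
Qed.

Variable e : chart R 2 (base_space E).
Hypotheses (ae : atlas e) (ep : cdom e (bundle_proj (phi p))).
Local Notation P := (lrep d e (@bundle_proj R kappa tau E)).
Local Notation al := (fun r : R => e (bundle_proj (phi (gam r)))).
Local Notation N := (unit_normal g f x).

Let q := fun r : R => f (c (gam r)).
Let qt : q t = y. Proof. exact: fx. Qed.
Let sq : smooth_at q t.
Proof. by apply: smooth_at_comp; [exact: curve_smooth | case: imm]. Qed.
Let q' : 'D_1 q t = push f x X.
Proof. exact: (derive_comp (1 : R) (smooth_at_diff curve_smooth) df). Qed.
Let pg : inner_product (g y). Proof. exact: gram_inner_product. Qed.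
Let NN : inner (g y) N N = 1.
Proof. by rewrite -fx; exact: unit_normal_unit. Qed.
Let Nv v : inner (g y) N (push f x v) = 0.
Proof. by rewrite -fx; exact: unit_normal_push. Qed.
Let Nxi : inner (g y) N ka = 0.
Proof. by rewrite -push_kernel; exact: Nv. Qed.

Lemma proj_curve_near : {near t, al =1 (fun r => P (q r))}.
Proof.
have cg := curve_continuous; have [cphi _] : smooth_map phi by case: iso.
have cpg : {for t, continuous (fun r => phi (gam r))} by exact: (continuous_comp cg (cphi _)).
apply: filterS2 (lrep_curve e (@bundle_proj R kappa tau E) cpg dp) (lrep_curve d phi cg cp).
by move=> r e1 e2; rewrite /q e2 /= e1.
Qed.

Lemma derive_proj_curve : 'D_1 al t = 'D_(push f x X) P y.
Proof.
rewrite (near_eq_derive (1 : R) proj_curve_near).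
have dPq : differentiable P (q t).
  by rewrite qt; exact: smooth_at_diff (smooth_at_proj ad ae dp ep).
apply: etrans (derive_comp (1 : R) (smooth_at_diff sq) dPq) _.
by move: ('D_1 q t) (q t) q' qt => w z -> ->.
Qed.

Lemma proj_curve_speed : inner (gram e (al t)) ('D_1 al t) ('D_1 al t) = sin theta ^+ 2.
Proof.
rewrite derive_proj_curve (proj_inner ad ae _ _ dp ep) push_X_xi.
have -> : inner (g y) (push f x X) (push f x X) = 1.
  by rewrite -fx -(first_formE g df) IE velocity_unit.
have := cos2Dsin2 theta; lra.
Qed.

(** The normal curvature of gam, corrected by the bundle curvature; the
    correction is proportional to H because tau = tau' cos theta. *)
Lemma curvature_numerator :
  inner (gram e (al t)) (nabla (gram e) al (derive1 al) t 1) (proj_normal phi c d e p)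
  = sin theta ^+ 2 * (2 * H) - sin theta * 'D_1 vth t.
Proof.
rewrite (nabla_near_curve (gram e) proj_curve_near) /proj_normal.
have -> : gram e (al t) = gram e (P y) by rewrite lrepE.
rewrite (proj_curve ad ae dp ep qt sq Nxi) q' push_X_xi.
have := normal_curvature imm erefl curve_smooth; rewrite fx => ->.
have -> : - inner (g y) (nabla g f (unit_normal g f) x X) (push f x X) =
   2 * H - sin theta * 'D_1 vth t.
  have := inner_shape_operator df pG pos X X; rewrite IE sister_shape fx => <- //.
have -> : inner (g y) (cross (g y) (push f x X) ka) N = sin theta.
  have := push_JX_xi; rewrite -fx (push_rotJ df pG pos) fx.
  by move=> <-; rewrite !(inner_cross pg); exact: esym (vol_rot _ _ _ _).
rewrite sister_H sister_tau; have := cos2Dsin2 theta.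
move: (cos theta) (sin theta) ('D_1 vth t) => co si v E0.
have c2 : co ^+ 2 = 1 - si ^+ 2 by lra.
rewrite (_ : _ - _ = 2 * (si * tau') - si * v - 2 * co ^+ 2 * tau' * si); last by ring.
by rewrite c2; ring.
Qed.

Lemma proj_normal_unit :
  inner (gram e (al t)) (proj_normal phi c d e p) (proj_normal phi c d e p) = 1.
Proof. by rewrite /proj_normal (proj_inner ad ae _ _ dp ep) NN Nxi mulr0 subr0. Qed.

Lemma proj_normal_orth : inner (gram e (al t)) (proj_normal phi c d e p) ('D_1 al t) = 0.
Proof.
by rewrite derive_proj_curve /proj_normal (proj_inner ad ae _ _ dp ep) Nv Nxi mul0r subr0.
Qed.

Lemma geodesic_curvature_proj : 0 < theta < pi ->
  has_geodesic_curvature (gram e) al t (proj_normal phi c d e p)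
    (2 * H - 'D_1 vth t / sin theta).
Proof.
move=> th; have s0 := sin_gt0_pi th; have s1 : sin theta != 0 by rewrite gt_eqF.
have pe : inner_product (gram e (al t)) by exact: gram_inner_product.
rewrite /has_geodesic_curvature curvature_numerator derive1E proj_curve_speed.
split.
- apply/eqP => a0; have := proj_curve_speed; rewrite a0 inner0l => /esym/eqP.
  by rewrite sqrf_eq0; apply/negP.
- exact: proj_normal_unit.
- exact: proj_normal_orth.
- by field.
Qed.

End Angle.
End Sister.

(** * Regions bounded by a curve *)

Lemma smooth_at_derive_along (R : realType) (V : normedModType R) n (W : normedModType R)
    (f : 'rV[R]_n -> W) (q u : V -> 'rV[R]_n) x :
  smooth_at f (q x) -> smooth_at q x -> smooth_at u x ->
  smooth_at (fun z => 'D_(u z) f (q z)) x.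
Proof.
move=> sf sq su.
have near_f : \forall z \near x, differentiable f (q z).
  have : nbhs x [set z | smooth_at f (q z)] := smooth_at_cont sq (smooth_at_nbhs sf).
  by apply: filterS => z; exact: smooth_at_diff.
apply: (@smooth_at_near _ _ _ (fun z => \sum_i u z 0 i *: 'D_(basis_vec R i) f (q z))).
  by apply: filterS near_f => z df; rewrite -derive_basis.
apply: smooth_at_sum => i; apply: smooth_atZ; first exact: smooth_at_coord.
exact: (smooth_at_comp (f := fun y => 'D_(basis_vec R i) f y) sq (smooth_at_derive _ sf)).
Qed.

Lemma near_gt0 (R : realType) (V : normedModType R) (k : V -> R) x :
  smooth_at k x -> 0 < k x -> \forall z \near x, 0 < k z.
Proof. by move=> sk k0; exact: (cvgr_gt (k x) (smooth_at_cont sk) 0 k0). Qed.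

Lemma near_neq0 (R : realType) (V : normedModType R) (k : V -> R) x :
  smooth_at k x -> k x != 0 -> \forall z \near x, k z != 0.
Proof.
move=> sk k0; have : \forall z \near x, 0 < k z * k z.
  by apply: near_gt0; [exact: smooth_atM | rewrite -expr2 exprn_even_gt0].
by apply: filterS => z; apply: contraTneq => ->; rewrite mulr0 ltxx.
Qed.

Lemma near_right_ex (R : realType) (P : R -> Prop) (x : R) :
  (\forall r \near x^'+, P r) -> exists r, P r.
Proof. by move=> nP; exact: (@filter_ex _ _ (at_right_proper_filter x) _ nP). Qed.

Section Wedge.
Variable R : realType.
Implicit Types u v w : 'rV[R]_2.

Definition wedge u v : R := u 0 0 * v 0 1 - u 0 1 * v 0 0.

Lemma cramer u v w : wedge u v != 0 ->
  w = (wedge w v / wedge u v) *: u + (wedge u w / wedge u v) *: v.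
Proof.
by move=> d0; apply: row2P; rewrite !mxE; move: d0; rewrite /wedge => d0; field.
Qed.

(** If u and v were dependent, v would be a multiple of u, and l v = 0. *)
Lemma wedge_neq0 (l : 'rV[R]_2 -> R) u v : (forall k w, l (k *: w) = k * l w) ->
  u != 0 -> l u = 0 -> l v != 0 -> wedge u v != 0.
Proof.
move=> lZ u0 lu lv; apply/eqP; rewrite /wedge => d0.
have c0 : u 0 0 *: v = v 0 0 *: u by apply: row2P; rewrite !mxE; lra.
have c1 : u 0 1 *: v = v 0 1 *: u by apply: row2P; rewrite !mxE; lra.
have /eqP z0 : u 0 0 * l v = 0 by rewrite -lZ c0 lZ lu mulr0.
have /eqP z1 : u 0 1 * l v = 0 by rewrite -lZ c1 lZ lu mulr0.
move: z0 z1; rewrite !mulf_eq0 (negPf lv) !orbF => /eqP e0 /eqP e1.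
by case/eqP: u0; apply: row2P; rewrite mxE.
Qed.

Lemma orthogonal_plane_zero (G : 'M[R]_2) a w u : inner_product G ->
  inner G w a = 0 -> a != 0 -> w != 0 -> inner G u a = 0 -> inner G u w = 0 -> u = 0.
Proof.
move=> pG wa a0 w0 ua uw.
have aw : wedge a w != 0.
  apply: (@wedge_neq0 (fun v => inner G v w)) => //; first by move=> k v; rewrite innerZl.
    by rewrite (inner_sym _ _ pG).
  by rewrite gt_eqF //; case: pG => _; apply.
apply/eqP; apply: contraT => u0; have [_ /(_ u u0)] := pG.
by rewrite {2}(cramer u aw) innerDr !innerZr ua uw !mulr0 addr0 ltxx.
Qed.

End Wedge.

Section Rising.
Variables (R : realType) (f1 f2 h nu m n : 'rV[R]_2 -> R).
Variables (T : 'rV[R]_2 -> 'rV[R]_2) (x X : 'rV[R]_2).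
Hypotheses (sf1 : smooth_at f1 x) (sf2 : smooth_at f2 x) (sh : smooth_at h x).
Hypotheses (snu : smooth_at nu x) (sm : smooth_at m x) (sn : smooth_at n x).
Hypothesis sT : smooth_at T x.
Hypotheses (Xf1 : 'D_X f1 x != 0) (Xf2 : 'D_X f2 x = 0) (Xh : 'D_X h x = 0).
Hypothesis Tf1 : \forall z \near x, 'D_(T z) f1 z = - nu z * m z.
Hypothesis Tf2 : \forall z \near x, 'D_(T z) f2 z = - nu z * n z.
Hypothesis hnu : \forall z \near x, 0 < h z -> 0 < nu z.
Hypothesis sign : n x * 'D_(T x) h x < 0.

Let frame : wedge X (T x) != 0.
Proof.
have dh := smooth_at_diff sh.
have X0 : X != 0.
  apply: contraNneq Xf1 => ->; rewrite -(scale0r (0 : 'rV[R]_2)).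
  by rewrite (deriveZ_dir _ _ (smooth_at_diff sf1)) scale0r.
have Th : 'D_(T x) h x != 0.
  by apply: contraTneq sign => ->; rewrite mulr0 ltxx.
apply: (@wedge_neq0 _ (fun v => 'D_v h x)) => // k v.
exact: deriveZ_dir.
Qed.

(** In the kernel of the differential of f1 the derivatives of f2 and h are both
    proportional to the coefficient of T, with factors nu * B1 and B2. *)
Lemma rising_near : \forall z \near x, 0 < h z ->
  forall w, 'D_w f1 z = 0 -> 0 < 'D_w h z -> 0 < 'D_w f2 z.
Proof.
have sid : smooth_at (fun z : 'rV[R]_2 => z) x by exact: smooth_at_id.
have sX : smooth_at (fun _ : 'rV[R]_2 => X) x by exact: smooth_at_cst.
pose al z := 'D_X f1 z.
pose B1 z := m z * (al z)^-1 * 'D_X f2 z - n z.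
pose B2 z := 'D_(T z) h z + nu z * m z * (al z)^-1 * 'D_X h z.
have sal : smooth_at al x by exact: smooth_at_derive.
have sB : smooth_at (fun z => B1 z * B2 z) x.
  apply: smooth_atM.
    apply: smooth_atB => //; apply: smooth_atM; last exact: smooth_at_derive.
    by apply: smooth_atM => //; exact: smooth_at_inv.
  apply: smooth_atD; first exact: smooth_at_derive_along.
  apply: smooth_atM; last exact: smooth_at_derive.
  by apply: smooth_atM; [exact: smooth_atM | exact: smooth_at_inv].
have Bx : 0 < B1 x * B2 x.
  by rewrite /B1 /B2 Xf2 Xh !mulr0 sub0r addr0 mulNr oppr_gt0.
have sd : smooth_at (fun z => wedge X (T z)) x.
  by apply: smooth_atB; apply: smooth_atM; (try exact: smooth_at_cst); exact: smooth_at_coord.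
have nB := near_gt0 sB Bx; have nal := near_neq0 sal Xf1; have nd := near_neq0 sd frame.
have df1 := smooth_at_nbhs sf1; have df2 := smooth_at_nbhs sf2; have dh := smooth_at_nbhs sh.
near=> z.
have Bz : 0 < B1 z * B2 z by near: z.
have az : al z != 0 by near: z.
have dz : wedge X (T z) != 0 by near: z.
have e1 : 'D_(T z) f1 z = - nu z * m z by near: z.
have e2 : 'D_(T z) f2 z = - nu z * n z by near: z.
have d1 : differentiable f1 z by apply: smooth_at_diff; near: z.
have d2' : differentiable f2 z by apply: smooth_at_diff; near: z.
have d3 : differentiable h z by apply: smooth_at_diff; near: z.
have hn : 0 < h z -> 0 < nu z by near: z.
move=> /hn nz w; have := cramer w dz; move: (wedge w (T z) / _) (wedge X w / _) => a b ->.
rewrite !(deriveD_dir _ _ d1, deriveD_dir _ _ d2', deriveD_dir _ _ d3).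
rewrite !(deriveZ_dir _ _ d1, deriveZ_dir _ _ d2', deriveZ_dir _ _ d3) e1 e2.
rewrite -/(al z) => w1.
have aE : a = b * nu z * m z * (al z)^-1.
  apply: (mulIf az); rewrite mulfVK //; move: w1.
  rewrite -[a *: al z]/(a * al z) -[b *: (_ * _)]/(b * (_ * _)); lra.
move=> w2.
have h2 : 0 < b * B2 z.
  move: w2; rewrite aE /B2.
  rewrite -[_ *: 'D_X h z]/(_ * 'D_X h z) -[_ *: 'D_(T z) h z]/(_ * 'D_(T z) h z).
  by congr (_ < _); ring.
have -> : a *: 'D_X f2 z + b *: (- nu z * n z) = nu z * (b * B1 z).
  rewrite aE /B1 -[_ *: 'D_X f2 z]/(_ * 'D_X f2 z) -[b *: (_ * _)]/(b * (_ * _)).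
  ring.
apply: mulr_gt0 => //.
have b0 : b != 0 by apply: contraTneq h2 => ->; rewrite mul0r ltxx.
have : 0 < (b * B1 z) * (b * B2 z).
  by rewrite mulrACA mulr_gt0 // -expr2 exprn_even_gt0.
by rewrite (pmulr_lgt0 _ h2).
Unshelve. all: by end_near. Qed.

End Rising.

Section Regions.
Variables (R : realType) (S : riemannian R 2) (D : set S) (s : R -> S) (t : R).
Variable c : chart R 2 S.
Hypotheses (ac : atlas c) (cp : cdom c (s t)) (cs : {for t, continuous s}).
Local Notation p := (s t).
Local Notation x := (c p).

(** The defining function of the boundary is transported by a change of charts,
    whose differential is invertible. *)
Lemma boundary_in_chart : boundary_arc D s t -> exists h : 'rV[R]_2 -> R,
  [/\ smooth_at h x, exists v, 'D_v h x != 0,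
      \forall z \near x, D (cinv c z) <-> 0 < h z & \forall r \near t, h (c (s r)) = 0].
Proof.
move=> [c1 [U [h [[ac1 c1p [oU Ux] Uc] [sh [v hv] Dh hs]]]]].
have tE : lrep c c1 id x = c1 p by exact: lrepE.
have t1 := smooth_at_transition ac ac1 cp c1p.
have t2 := smooth_at_transition ac1 ac c1p cp.
have shx : smooth_at h (lrep c c1 id x) by rewrite tE; exact: smooth_on_at sh.
exists (fun z => h (lrep c c1 id z)); split.
- exact: smooth_at_comp.
- exists ('D_v (lrep c1 c id) (c1 p)).
  have dt1 : differentiable (lrep c c1 id) (lrep c1 c id (c1 p)).
    by rewrite [lrep c1 c id _]lrepE //; exact: smooth_at_diff.
  have E0 := derive_comp v (smooth_at_diff t2) dt1.
  have nid : {near c1 p, (fun z => lrep c c1 id (lrep c1 c id z)) =1 id}.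
    have L := lrep_comp c1 id (fun A B => B : nbhs (id p) A) c1p cp.
    apply: filterS2 L (near_cod c1p) => z -> [q c1q <-].
    exact: lrepE.
  rewrite (near_eq_derive v nid) derive_id [lrep c1 c id _]lrepE // in E0.
  rewrite (derive_comp _ (smooth_at_diff t1) (smooth_at_diff shx)) -E0.
  by move: hv; rewrite tE.
- have nU : \forall z \near x, U (lrep c c1 id z).
    have ct1 := smooth_at_cont t1; apply: ct1; rewrite tE; exact: open_nbhs_nbhs.
  apply: filterS2 nU (near_cinv cp (near_cdom c1p)) => z Uz c1z.
  by rewrite -(Dh _ Uz) /lrep cfunK.
- apply: filterS2 hs (near_curve cs cp) => r hr cr.
  by rewrite [lrep c c1 id _]lrepE.
Qed.

Variable h : 'rV[R]_2 -> R.
Hypotheses (oD : open D) (sh : smooth_at h x) (h0 : h x = 0).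
Hypothesis hD : \forall z \near x, D (cinv c z) <-> 0 < h z.

Let near_hD (q : R -> S) v : q 0 = p -> {for 0, continuous q} ->
  is_derive (0 : R) 1 (c \o q) v ->
  \forall r \near 0^'+, [/\ cdom c (q r),
    \forall z \near c (q r), D (cinv c z) <-> 0 < h z & {for c (q r), continuous h}].
Proof.
move=> q0 cq dq; apply: near_at_right_nbhs.
have cq0 : cdom c (q 0) by rewrite q0.
have cc : {for 0, continuous (fun r => c (q r))}.
  by apply: (continuous_comp cq); rewrite q0; exact: cfun_cont.
have n1 : nbhs (c (q 0)) [set y | \forall z \near y, D (cinv c z) <-> 0 < h z].
  by rewrite q0; exact: near_join hD.
have n2 : nbhs (c (q 0)) [set y | {for y, continuous h}].
  by rewrite q0; apply: filterS (smooth_at_nbhs sh) => y; exact: smooth_at_cont.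
have m1 := cc _ n1; have m2 := cc _ n2.
by apply: filterS3 (near_curve cq cq0) m1 m2 => r; split.
Qed.

Let derive_along (q : R -> S) v : q 0 = p -> is_derive (0 : R) 1 (c \o q) v ->
  is_derive (0 : R) 1 (fun r => h (c (q r))) ('D_v h x).
Proof.
move=> q0 dq; rewrite -q0; apply: (@is_derive_comp_dir _ _ _ _ h (c \o q)) dq _.
by rewrite /= q0; exact: smooth_at_diff.
Qed.

(** The sign of h along a curve is that of its derivative at 0. *)
Lemma points_inside_derive v : 0 < 'D_v h x -> points_inside D p c v.
Proof.
move=> hv; split=> q q0 cq dq; have nq := near_hD q0 cq dq.
  have hq := derive_gt0_right (derive_along q0 dq) (etrans (congr1 (h \o c) q0) h0) hv.
  apply: filterS2 nq hq => r [cr Dr _] hr.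
  have := (nbhs_singleton Dr).2 hr; rewrite cfunK // => Dq.
  by rewrite (interior_id D).1.
have hv' : 'D_(- v) h x < 0 by rewrite (deriveN_dir _ (smooth_at_diff sh)) oppr_lt0.
have hq := derive_lt0_right (derive_along q0 dq) (etrans (congr1 (h \o c) q0) h0) hv'.
apply: filterS2 nq hq => r [cr Dr hc] hr clD.
have hneg : nbhs (c (q r)) [set z | h z < 0] by exact: (cvgr_lt _ hc 0 hr).
have [b [Db [cb /= [hb Db']]]] := clD _ (cfun_open cr (filterI hneg Dr)).
by move: Db; rewrite -[b](cfunK cb) Db' => hb'; move: (lt_trans hb' hb); rewrite ltxx.
Qed.

(** It is enough to follow a straight line of the chart. For v = 0 the line is a
    point of the boundary, outside the open region. *)
Lemma enters_derive v : enters D p c v -> v != 0 /\ 0 <= 'D_v h x.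
Proof.
move=> eD; pose q (r : R) := cinv c (x + r *: v).
have q0 : q 0 = p by rewrite /q scale0r addr0 cfunK.
have line0 : x + (0 : R) *: v = x by rewrite scale0r addr0.
have dl : differentiable (fun r : R => x + r *: v) 0 by exact: differentiable_line.
have ncod : \forall r \near (0 : R), (c @` cdom c) (x + r *: v).
  have cl := differentiable_continuous dl; apply: cl; rewrite line0; exact: near_cod.
have cq : {for 0, continuous q}.
  apply: (@continuous_comp _ _ _ (fun r : R => x + r *: v)); first exact: differentiable_continuous.
  by rewrite line0; apply: cinv_cont; exists p.
have nq : {near (0 : R), (fun r : R => x + r *: v) =1 c \o q}.
  by apply: filterS ncod => r /cinv_cod[_]; exact: esym.
have dq : is_derive (0 : R) 1 (c \o q) v.
  have dcq : differentiable (c \o q) 0 by exact: near_eq_differentiable nq dl.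
  apply: DeriveDef; first exact: diff_derivable.
  by rewrite -(near_eq_derive (1 : R) nq) derive_lineE.
have pos : \forall r \near 0^'+, 0 < h (c (q r)).
  apply: filterS2 (eD q q0 cq dq) (near_hD q0 cq dq) => r Dq [cr Dr _].
  by rewrite -(nbhs_singleton Dr) cfunK.
split.
  apply/eqP => v0; have [r] := near_right_ex pos.
  by rewrite /q v0 scaler0 addr0 cfunK // h0 ltxx.
rewrite leNgt; apply/negP => hv.
have neg := derive_lt0_right (derive_along q0 dq) (etrans (congr1 (h \o c) q0) h0) hv.
have [r [r1 r2]] := near_right_ex (filterI pos neg).
by move: (lt_trans r1 r2); rewrite ltxx.
Qed.

(** Otherwise nu would be negative at points of the region, on the line in the
    direction v. *)
Lemma positive_derive (nu : 'rV[R]_2 -> R) v : smooth_at nu x -> nu x = 0 ->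
  (\forall z \near x, 0 < h z -> 0 < nu z) -> 0 < 'D_v h x -> 0 <= 'D_v nu x.
Proof.
move=> snu nu0 pos hv; rewrite leNgt; apply/negP => nv.
have dl : differentiable (fun r : R => x + r *: v) 0 by exact: differentiable_line.
have line0 : x + (0 : R) *: v = x by rewrite scale0r addr0.
have der (k : 'rV[R]_2 -> R) : smooth_at k x ->
    is_derive (0 : R) 1 (fun r : R => k (x + r *: v)) ('D_v k x).
  move=> sk; have := @derive_line _ _ _ k x v 0; rewrite line0; apply; exact: smooth_at_diff.
have h0' : h (x + (0 : R) *: v) = 0 by rewrite line0.
have n0' : nu (x + (0 : R) *: v) = 0 by rewrite line0.
have p1 := derive_gt0_right (der h sh) h0' hv.
have p2 := derive_lt0_right (der nu snu) n0' nv.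
have p3 : \forall r \near 0^'+, 0 < h (x + r *: v) -> 0 < nu (x + r *: v).
  apply: near_at_right_nbhs; have cl := differentiable_continuous dl.
  apply: (cl [set z | 0 < h z -> 0 < nu z]); by rewrite line0.
have [r [[r1 r2] r3]] := near_right_ex (filterI (filterI p1 p2) p3).
by move: (lt_trans (r3 r1) r2); rewrite ltxx.
Qed.

End Regions.

(** * The projection of a region *)

Lemma smooth_at_eq (R : realType) (V W : normedModType R) (f f' : V -> W) x :
  f =1 f' -> smooth_at f x -> smooth_at f' x.
Proof. by move=> /funext ->. Qed.

Lemma open_nbhs_ex (X : topologicalType) (p : X) (A : set X) : nbhs p A ->
  exists2 V, open_nbhs p V & V `<=` A.
Proof. by rewrite nbhsE => -[V openV VA]; exists V. Qed.

Section Adapted.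
Variables (R : realType) (G : 'M[R]_2) (b0 a w : 'rV[R]_2).

(** Coordinates centered at b0; they separate points if a and w are orthogonal. *)
Definition adapted (b : 'rV[R]_2) : 'rV[R]_2 :=
  row2 (inner G (b - b0) a) (inner G (b - b0) w).

Lemma adapted_base : adapted b0 = 0.
Proof. by rewrite /adapted subrr !inner0l; apply: row2P; rewrite !mxE. Qed.

Lemma smooth_adapted_coord (V : normedModType R) (F : V -> 'rV[R]_2) u x :
  smooth_at F x -> smooth_at (fun z => inner G (F z - b0) u) x.
Proof.
move=> sF; apply: smooth_at_inner; try exact: smooth_at_cst.
by apply: smooth_atB => //; exact: smooth_at_cst.
Qed.

Lemma derive_adapted_coord (V : normedModType R) (F : V -> 'rV[R]_2) u x v :
  differentiable F x -> 'D_v (fun z => inner G (F z - b0) u) x = inner G ('D_v F x) u.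
Proof.
move=> dF; have dc (W : normedModType R) (k : W) : differentiable (fun _ : V => k) x.
  exact: differentiable_cst.
have dFb : differentiable (fun z => F z - b0) x by apply: differentiableB.
rewrite (derive_inner (dc _ G) dFb (dc _ u)).
have -> : 'D_v (fun z => F z - b0) x = 'D_v F x.
  have dv : derivable F x v by exact: diff_derivable.
  have db : derivable (fun _ : V => b0) x v by exact: diff_derivable.
  by apply: etrans (deriveB dv db) _; rewrite derive_cst subr0.
have d0 (W : normedModType R) (k : W) : 'D_v (fun _ : V => k) x = 0 by exact: derive_cst.
by rewrite !d0 inner0r addr0 /inner mulmx0 mul0mx mxE add0r.
Qed.

Lemma smooth_adapted b : smooth_at adapted b.
Proof.
apply: smooth_at_mx => i.
have sc u : smooth_at (fun z => inner G (z - b0) u) b.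
  by apply: (smooth_adapted_coord (F := fun z => z)); exact: smooth_at_id.
by apply: forall_I2; [have := sc a | have := sc w];
  apply: smooth_at_eq => z; rewrite !mxE.
Qed.

Lemma derive_adapted v b : 'D_v adapted b = row2 (inner G v a) (inner G v w).
Proof.
have dA := smooth_at_diff (smooth_adapted b).
have did : differentiable (fun z : 'rV[R]_2 => z) b by exact: differentiable_idfun.
apply: row2P; rewrite -(derive_coord _ _ _ dA) ?row2_0 ?row2_1.
  under eq_fun do rewrite row2_0; rewrite (derive_adapted_coord _ _ did).
  by rewrite derive_id.
under eq_fun do rewrite row2_1; rewrite (derive_adapted_coord _ _ did).
by rewrite derive_id.
Qed.

Hypotheses (pG : inner_product G) (wa : inner G w a = 0) (a0 : a != 0) (w0 : w != 0).

Lemma adapted_inj b b' : adapted b = adapted b' -> b = b'.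
Proof.
move=> bb; have e0 := congr1 (fun m : 'rV[R]_2 => m 0 0) bb.
have e1 := congr1 (fun m : 'rV[R]_2 => m 0 1) bb.
rewrite /= !row2_0 in e0; rewrite /= !row2_1 in e1.
apply/eqP; rewrite -subr_eq0; apply/eqP; apply: (orthogonal_plane_zero pG wa a0 w0).
  by move: e0; rewrite !innerBl; lra.
by move: e1; rewrite !innerBl; lra.
Qed.

End Adapted.

Section VerticalPart.
Variables (R : realType) (S : riemannian R 2) (kappa tau : R) (E : Ekt kappa tau).
Variables (phi : S -> E) (c : chart R 2 S) (d : chart R 3 E) (e : chart R 2 (base_space E)).
Hypotheses (iso : isometric_immersion phi) (ac : atlas c) (ad : atlas d) (ae : atlas e).
Local Notation pi := (@bundle_proj R kappa tau E).
Local Notation f := (lrep c d phi).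
Local Notation P := (lrep d e pi).
Local Notation g := (gram d).
Local Notation T := (xi_tangent g (xi d) f).
Local Notation N := (unit_normal g f).
Local Notation nu := (angle g (xi d) f).
Local Notation F := (fun z => P (f z)).

(** The projection kills T + nu N. *)
Lemma derive_proj_tangent p : cdom c p -> cdom d (phi p) -> cdom e (pi (phi p)) ->
  'D_(T (c p)) F (c p) = - nu (c p) *: 'D_(N (c p)) P (f (c p)).
Proof.
move=> cp dp ep; have imm := immersion_at_lrep iso ac ad cp dp.
have [sf mg /nbhs_singleton[pG pos]] := imm.
have df := smooth_at_diff sf.
have fx : f (c p) = d (phi p) by exact: lrepE.
have dP : differentiable P (f (c p)).
  by rewrite fx; exact: smooth_at_diff (smooth_at_proj ad ae dp ep).
have NN := unit_normal_unit df pG pos.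
have xk : 'D_(xi d (f (c p))) P (f (c p)) = 0 by rewrite fx; exact: proj_xi.
have pT : push f (c p) (T (c p)) = xi d (f (c p)) - nu (c p) *: N (c p).
  apply: (push_tangent_part df pG pos); rewrite innerBl innerZl NN mulr1.
  by rewrite (inner_sym _ _ pG) subrr.
rewrite (derive_comp _ df dP) -[X in 'D_X P _]/(push f (c p) (T (c p))) pT.
by rewrite (deriveD_dir _ _ dP) xk add0r -scaleNr (deriveZ_dir _ _ dP).
Qed.

Variable p : S.
Hypotheses (cp : cdom c p) (dp : cdom d (phi p)) (ep : cdom e (pi (phi p))).
Local Notation x := (c p).

Let imm : immersion_at g f x. Proof. exact: immersion_at_lrep. Qed.
Let sf : smooth_at f x. Proof. by case: imm. Qed.
Let fx : f x = d (phi p). Proof. exact: lrepE. Qed.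
Let sP : smooth_at P (f x). Proof. by rewrite fx; exact: smooth_at_proj. Qed.

Lemma near_domains : \forall z \near x, [/\ cdom c (cinv c z), c (cinv c z) = z,
  cdom d (phi (cinv c z)) & cdom e (pi (phi (cinv c z)))].
Proof.
have [cphi _] : smooth_map phi by case: iso.
have [cpi _] := proj_smooth E.
have cQ : {for p, continuous (fun q => pi (phi q))} by exact: (continuous_comp (cphi p) (cpi _)).
apply: filterS2 (near_phi iso cp dp) (near_cinv_map cQ cp (near_cdom ep)).
by move=> z [z1 z2 z3] z4.
Qed.

Lemma smooth_xi_tangent : smooth_at T x.
Proof.
have [_ _ /nbhs_singleton[pG pos]] := imm.
have df := smooth_at_diff sf.
have sg : smooth_at (fun z => g (f z)) x.
  by apply: smooth_at_comp => //; rewrite fx; exact: smooth_at_gram.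
have sxi : smooth_at (fun z => xi d (f z)) x.
  by apply: smooth_at_comp => //; rewrite fx; exact: smooth_at_xi.
have sN := smooth_at_unit_normal imm.
have snu : smooth_at nu x by apply: smooth_at_inner.
have sp v : smooth_at (fun z => push f z v) x by exact: smooth_at_derive.
apply: smooth_at_mulmx.
  apply: smooth_at_mx => i j.
  have : smooth_at (fun z => inner (g (f z)) (xi d (f z) - nu z *: N z)
      (push f z (basis_vec R j))) x.
    by apply: smooth_at_inner => //; apply: smooth_atB => //; exact: smooth_atZ.
  by apply: smooth_at_eq => z; rewrite mxE.
apply: smooth_at_invmx.
  exact: inner_product_unit (first_form_inner_product df pG pos).
apply: smooth_at_mx => i j.
have : smooth_at (fun z => inner (g (f z)) (push f z (basis_vec R i))
    (push f z (basis_vec R j))) x by exact: smooth_at_inner.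
by apply: smooth_at_eq => z; rewrite mxE.
Qed.

Variables (D : set S) (h : 'rV[R]_2 -> R) (X w : 'rV[R]_2).
Hypotheses (sh : smooth_at h x) (hx : h x = 0).
Hypothesis hD : \forall z \near x, D (cinv c z) <-> 0 < h z.
Hypothesis hnu : \forall z \near x, 0 < h z -> 0 < nu z.
Hypotheses (nux : nu x = 0) (Xh : 'D_X h x = 0).
Local Notation Ge := (gram e (e (pi (phi p)))).
Local Notation a := ('D_X F x).
Hypotheses (a0 : a != 0) (wa : inner Ge w a = 0) (w1 : inner Ge w w = 1).
Hypothesis sign : inner Ge ('D_(N x) P (f x)) w * 'D_(T x) h x < 0.

Let sF : smooth_at F x. Proof. by apply: smooth_at_comp. Qed.
Let Fx : F x = e (pi (phi p)). Proof. by rewrite /= fx lrepE. Qed.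
Let pe : inner_product Ge. Proof. exact: gram_inner_product. Qed.
Let w0 : w != 0.
Proof. by apply: contra_eq_neq w1 => ->; rewrite inner0l eq_sym oner_eq0. Qed.
Let f1 z := inner Ge (F z - F x) a.
Let f2 z := inner Ge (F z - F x) w.
Let A := adapted Ge (F x) a w.

(** The projection of the surface folds along the curve: it is an immersion
    transversally to the curve only where nu does not vanish. *)
Lemma fold_projection : exists2 U : set 'rV[R]_2, open_nbhs x U &
  (exists O : set 'rV[R]_2, [/\ open O,
    forall z, U z -> 0 < h z -> ~ O (A (F z)) &
    forall (q : R -> 'rV[R]_2) v, q 0 = 0 -> is_derive (0 : R) 1 q v ->
      v 0 0 = 0 -> v 0 1 < 0 -> \forall r \near 0^'+, O (q r)]) /\
  (forall W : set 'rV[R]_2, open_nbhs x W ->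
    exists O : set 'rV[R]_2, [/\ open O,
    forall b, O b -> exists z, [/\ W z, 0 < h z & b = A (F z)] &
    forall (q : R -> 'rV[R]_2) v, q 0 = 0 -> is_derive (0 : R) 1 q v ->
      v 0 0 = 0 -> 0 < v 0 1 -> \forall r \near 0^'+, O (q r)]).
Proof.
have dF := smooth_at_diff sF.
have sN := smooth_at_unit_normal imm.
have sNP : smooth_at (fun z => 'D_(N z) P (f z)) x by exact: smooth_at_derive_along.
have snu : smooth_at nu x.
  apply: smooth_at_inner => //; apply: smooth_at_comp => //; rewrite fx.
    exact: smooth_at_gram.
  exact: smooth_at_xi.
have Tfu u : \forall z \near x, 'D_(T z) (fun z => inner Ge (F z - F x) u) z =
    - nu z * inner Ge ('D_(N z) P (f z)) u.
  apply: filterS2 near_domains (smooth_at_nbhs sF) => z [z1 z2 z3 z4] sFz.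
  rewrite (derive_adapted_coord _ _ _ _ (smooth_at_diff sFz)).
  by have := derive_proj_tangent z1 z3 z4; rewrite z2 => ->; rewrite innerZl.
have sfu u : smooth_at (fun z => inner Ge (F z - F x) u) x.
  exact: smooth_adapted_coord.
have smu u : smooth_at (fun z => inner Ge ('D_(N z) P (f z)) u) x.
  by apply: smooth_at_inner => //; exact: smooth_at_cst.
have Xf1 : 'D_X f1 x != 0.
  rewrite (derive_adapted_coord _ _ _ _ dF) gt_eqF //.
  by case: pe => _; apply.
have Xf2 : 'D_X f2 x = 0.
  by rewrite (derive_adapted_coord _ _ _ _ dF) (inner_sym _ _ pe).
have rising := rising_near (sfu a) (sfu w) sh snu (smu a) (smu w) smooth_xi_tangent
  Xf1 Xf2 Xh (Tfu a) (Tfu w) hnu sign.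
have f1x : f1 x = 0 by rewrite /f1 subrr inner0l.
have f2x : f2 x = 0 by rewrite /f2 subrr inner0l.
have Tf1 : 'D_(T x) f1 x = 0 by have := nbhs_singleton (Tfu a); rewrite nux oppr0 mul0r.
have Th : 'D_(T x) h x != 0 by apply: contraTneq sign => ->; rewrite mulr0 ltxx.
exact: (fold_image (sfu a) (sfu w) sh f1x f2x hx Xf1 Tf1 Xh Th Xf2 rising).
Qed.

(** In the coordinates along alpha' and w the curves with velocity w are on the
    side covered by the fold, those with velocity - w on the other side. *)
Lemma points_inside_proj_fold : points_inside_proj phi D p e w.
Proof.
have [U openU [[Q1 [openQ1 miss enter1]] hit]] := fold_projection.
have cA b : {for b, continuous A} by exact: smooth_at_cont (smooth_adapted _ _ _ _ _).
have A0 : A (e (pi (phi p))) = 0 by rewrite -Fx; exact: adapted_base.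
(* Curves in the base that leave in the direction w or - w. *)
have along (q : R -> base_space E) v : q 0 = pi (phi p) -> is_derive (0 : R) 1 (e \o q) v ->
    is_derive (0 : R) 1 (fun r => A (e (q r))) (row2 (inner Ge v a) (inner Ge v w)).
  move=> q0 dq; rewrite -(derive_adapted Ge (F x) a w v (e (q 0))).
  apply: (@is_derive_comp_dir _ _ _ _ A (e \o q)) dq _.
  exact: smooth_at_diff (smooth_adapted _ _ _ _ _).
have nearO (q : R -> base_space E) (O : set 'rV[R]_2) : q 0 = pi (phi p) ->
    {for 0, continuous q} -> open O -> (\forall r \near 0^'+, O (A (e (q r)))) ->
    \forall r \near 0^'+, nbhs (q r) [set b | cdom e b /\ O (A (e b))].
  move=> q0 cq oO; have ce0 : cdom e (q 0) by rewrite q0.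
  apply: filterS2 (near_at_right_nbhs (near_curve cq ce0)) => r er Or.
  apply: (cfun_open (U := A @^-1` O) er); apply: cA; exact: open_nbhs_nbhs.
pose K := [set z | [/\ cdom c (cinv c z), c (cinv c z) = z,
  cdom d (phi (cinv c z)) & cdom e (pi (phi (cinv c z)))] /\ (D (cinv c z) <-> 0 < h z)].
have nK : nbhs x K by apply: filterS2 near_domains hD.
have [V0 openV0 V0s] : exists2 V, open_nbhs p V & V `<=` [set q | cdom c q /\ (U `&` K) (c q)].
  have n1 : nbhs x (U `&` K) by apply: filterI => //; exact: open_nbhs_nbhs.
  exact: open_nbhs_ex (cfun_open cp n1).
exists V0 => // W oW WV; split=> q q0 cq dq.
  have [z1 z2 z3 z4] := nbhs_singleton near_domains.
  have nW : \forall z \near x, W (cinv c z) by exact: near_cinv cp (open_nbhs_nbhs oW).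
  have [W' oW' W's] : exists2 W', open_nbhs x W' & W' `<=` [set z | W (cinv c z)] `&` K.
    by apply: open_nbhs_ex; exact: filterI.
  have [Q [openQ hitQ enter]] := hit W' oW'.
  have q0' : A (e (q 0)) = 0 by rewrite q0.
  have := enter _ _ q0' (along q w q0 dq); rewrite row2_0 row2_1 wa w1 => /(_ erefl ltr01).
  move=> /(nearO q Q q0 cq openQ); apply: filterS => r; apply: filterS => b [eb /hitQ[z [W'z hz AF]]].
  have [Wz [[cz1 cz2 cz3 cz4] Dz]] := W's z W'z.
  exists (cinv c z); first by split=> //; exact/Dz.
  have bz := adapted_inj pe wa a0 w0 AF.
  by rewrite -(cfunK eb) bz /lrep (cfunK cz3) cfunK.
have q0' : A (e (q 0)) = 0 by rewrite q0.
have := enter1 _ _ q0' (along q (- w) q0 dq); rewrite row2_0 row2_1 !innerNl wa w1 oppr0 oppr_lt0.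
move=> /(_ erefl ltr01) /(nearO q Q1 q0 cq openQ1); apply: filterS => r nr clI.
have [b [[q' [Dq' Wq'] <-] [_ Ob]]] := clI _ nr.
have [cq' [Uq' [[y1 y2 y3 y4] Dh]]] := V0s _ (WV _ Wq').
rewrite cfunK // in y3 y4 Dh.
apply: (miss (c q') Uq'); first exact/Dh.
by rewrite /lrep (cfunK cq') (cfunK y3).
Qed.

End VerticalPart.

(** * The side of a region *)

Section Side.
Variables (R : realType) (kappa tau H kappa' tau' theta l : R).
Variables (E' : Ekt kappa' tau') (E : Ekt kappa tau) (S : riemannian R 2).
Variables (phi' : S -> E') (phi : S -> E) (gam : R -> S) (d0 : chart R 3 E').
Hypothesis sis : sister_immersions theta 0 H phi' phi.
Hypothesis vert : vertical_segment phi' gam l.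
Hypothesis cart : cartan_chart d0.
Hypothesis dom0 : forall t : R, 0 <= t <= l -> cdom d0 (phi' (gam t)).
Variables (vth : R -> R) (D : set S).
Hypothesis ang : normal_angle phi' d0 gam l vth.
Hypotheses (regD : region_along D gam l) (posD : positive_angle_on phi D).
Variables (c : chart R 2 S) (d : chart R 3 E) (t : R).
Hypotheses (ac : atlas c) (ad : atlas d) (tl' : 0 < t < l).
Hypotheses (cp : cdom c (gam t)) (dp : cdom d (phi (gam t))).
Local Notation p := (gam t).
Local Notation x := (c p).
Local Notation X := ('D_1 (fun r : R => c (gam r)) t).
Local Notation f := (lrep c d phi).
Local Notation g := (gram d).
Local Notation JX := (rotJ g f x X).
Local Notation nu := (angle g (xi d) f).

Let tl : 0 <= t <= l. Proof. by case/andP: tl' => *; rewrite !ltW. Qed.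

(** The angle function is positive on the region, vanishes on the curve and has
    derivative - vth' in the direction of J gam'. *)
Lemma region_function : 'D_1 vth t != 0 -> exists h : 'rV[R]_2 -> R,
  [/\ smooth_at h x, h x = 0, 'D_X h x = 0,
      \forall z \near x, D (cinv c z) <-> 0 < h z &
      \forall z \near x, 0 < h z -> 0 < nu z] /\ 'D_JX h x * 'D_1 vth t < 0.
Proof.
move=> v0; have cg := curve_continuous vert tl; have [_ _ /(_ t tl') arc] := regD.
have [h [sh [v hv] hD hs]] := boundary_in_chart ac cp cg arc.
have hx : h x = 0 := nbhs_singleton hs.
have sg := curve_smooth vert ac tl cp; have dh := smooth_at_diff sh.
have Xh : 'D_X h x = 0.
  rewrite -(derive_comp (1 : R) (smooth_at_diff sg) dh).
  have hs' : {near t, (fun r => h (c (gam r))) =1 cst 0} by [].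
  by rewrite (near_eq_derive (1 : R) hs') derive_cst.
have hnu : \forall z \near x, 0 < h z -> 0 < nu z.
  have [_ _ _ [iso _] _] := sis.
  apply: filterS2 hD (near_phi iso cp dp) => z [_ Dz] [z1 z2 z3] /Dz Dz'.
  by have := posD ac ad Dz' z1 z3; rewrite z2.
exists h; split=> //.
have snu := sister_angle_smooth sis ac ad cp dp.
have nu0 := angle_zero sis vert cart dom0 ac ad tl cp dp.
have nuJ := sister_angle_conormal sis vert cart dom0 ac ad tl cp dp ang.
have nuX := sister_angle_X sis vert cart dom0 ac ad tl cp dp ang.
have dnu := smooth_at_diff snu.
have hJ : 'D_JX h x != 0.
  pose k := inner (gram c x) v X; pose v' := v - k *: X.
  have pI := gram_inner_product ac cp.
  have v'X : inner (gram c x) v' X = 0.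
    by rewrite innerBl innerZl (velocity_unit sis vert cart dom0 ac tl cp) mulr1 subrr.
  have vE : v = k *: X + v' by rewrite addrC subrK.
  have v'E := conormal_line sis vert cart dom0 ac ad tl cp dp v'X.
  apply: contra_neq hv => J0.
  by rewrite vE v'E (deriveD_dir _ _ dh) !(deriveZ_dir _ _ dh) Xh J0 !scaler0 addr0.
have posh := positive_derive sh hx snu nu0 hnu.
have [a0|a0|a0] := ltgtP 0 ('D_JX h x); last by rewrite -a0 eqxx in hJ.
  have := posh _ a0; rewrite nuJ oppr_ge0 le_eqVlt (negPf v0) /= => v1.
  by rewrite pmulr_rlt0.
have := posh (- JX); rewrite (deriveN_dir _ dh) (deriveN_dir _ dnu) oppr_gt0 nuJ opprK.
by move=> /(_ a0); rewrite le_eqVlt eq_sym (negPf v0) /= => v1; rewrite nmulr_rlt0.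
Qed.

Let oD : open D. Proof. by case: regD. Qed.

Lemma side_inside b : b * 'D_1 vth t < 0 -> points_inside D p c (b *: JX).
Proof.
move=> bv; have v0 : 'D_1 vth t != 0 by apply: contraTneq bv => ->; rewrite mulr0 ltxx.
have [h [[sh hx Xh hD hnu] hJ]] := region_function v0.
apply: (points_inside_derive cp oD sh hx hD).
rewrite (deriveZ_dir _ _ (smooth_at_diff sh)) -[_ *: _]/(_ * _).
have : 0 < (b * 'D_1 vth t) * ('D_JX h x * 'D_1 vth t) by rewrite nmulr_rgt0.
by rewrite mulrACA pmulr_lgt0 // -expr2 exprn_even_gt0.
Qed.

Lemma side_enters v : 0 < theta < pi -> 'D_1 vth t != 0 ->
  inner (gram c x) v X = 0 -> enters D p c v ->
  xi_component phi c d p v * 'D_1 vth t < 0.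
Proof.
move=> th v0 vX eD; have [h [[sh hx Xh hD hnu] hJ]] := region_function v0.
have [vn hv] := enters_derive cp sh hx hD eD.
have vE := conormal_line sis vert cart dom0 ac ad tl cp dp vX.
have xiE := push_JX_xi sis vert cart dom0 ac ad tl cp dp.
have [_ _ _ [iso _] _] := sis; have [sf _ _] := immersion_at_lrep iso ac ad cp dp.
move: (inner _ v _) vE => k vE; rewrite vE in vn hv *.
have k0 : k != 0 by apply: contraNneq vn => ->; rewrite scale0r.
rewrite (deriveZ_dir _ _ (smooth_at_diff sh)) -[_ *: _]/(_ * _) in hv.
rewrite /xi_component (pushZ (smooth_at_diff sf)) innerZl xiE.
have s0 := sin_gt0_pi th; move: ('D_JX h x) hJ hv => a hJ hv.
have a0 : a != 0 by apply: contraTneq hJ => ->; rewrite mul0r ltxx.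
have ka : 0 < k * a by rewrite lt_neqAle hv eq_sym mulf_neq0.
rewrite mulrAC pmulr_llt0 //.
have : (k * a) * (a * 'D_1 vth t) < 0 by rewrite pmulr_rlt0.
have -> : (k * a) * (a * 'D_1 vth t) = (a * a) * (k * 'D_1 vth t) by ring.
by rewrite pmulr_rlt0 // -expr2 exprn_even_gt0.
Qed.

Variable e : chart R 2 (base_space E).
Hypotheses (ae : atlas e) (ep : cdom e (bundle_proj (phi p))).

(** Here b is the sign of vth'. *)
Lemma side_projection (b : R) : 0 < theta < pi -> b ^+ 2 = 1 -> 0 < b * 'D_1 vth t ->
  points_inside_proj phi D p e (b *: proj_normal phi c d e p).
Proof.
move=> th b2 bv; have v0 : 'D_1 vth t != 0 by apply: contraTneq bv => ->; rewrite mulr0 ltxx.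
have [h [[sh hx Xh hD hnu] hJ]] := region_function v0.
have s0 := sin_gt0_pi th.
have [_ _ _ [iso _] _] := sis; have [sf _ _] := immersion_at_lrep iso ac ad cp dp.
have df := smooth_at_diff sf; have fx : f x = d (phi p) by exact: lrepE.
have dP := smooth_at_diff (smooth_at_proj ad ae dp ep).
have dPf : differentiable (lrep d e (@bundle_proj R kappa tau E)) (f x) by rewrite fx.
have FX := derive_comp X df dPf.
have Fa : 'D_X (fun z => lrep d e (@bundle_proj R kappa tau E) (f z)) x =
    'D_1 (fun r : R => e (bundle_proj (phi (gam r)))) t.
  apply: etrans FX _; rewrite fx.
  by rewrite (derive_proj_curve sis vert ac ad tl cp dp ae ep).
have nu1 := proj_normal_unit sis vert cart dom0 ac ad tl cp dp ae ep.
have nu2 := proj_normal_orth sis vert cart dom0 ac ad tl cp dp ae ep.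
have speed := proj_curve_speed sis vert cart dom0 ac ad tl cp dp ae ep.
have nu0 := angle_zero sis vert cart dom0 ac ad tl cp dp.
apply: (points_inside_proj_fold iso ac ad ae cp dp ep sh hx hD hnu nu0 Xh).
- rewrite Fa; apply: contraTneq s0 => a0; move: speed; rewrite a0 inner0l.
  by move=> /esym/eqP; rewrite sqrf_eq0 => /eqP ->; rewrite ltxx.
- by rewrite Fa innerZl nu2 mulr0.
- by rewrite innerZl innerZr nu1 mulr1 -expr2.
rewrite (sister_xi_tangent sis vert cart dom0 ac ad tl cp dp) fx innerZr.
have dh := smooth_at_diff sh.
rewrite (deriveD_dir _ _ dh) !(deriveZ_dir _ _ dh) Xh scaler0 add0r.
have -> : inner (gram e (e (bundle_proj (phi p)))) ('D_(unit_normal g f x)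
  (lrep d e (@bundle_proj R kappa tau E)) (d (phi p))) (proj_normal phi c d e p) = 1 by [].
rewrite mulr1 -[_ *: _]/(_ * _) mulrCA pmulr_rlt0 //.
have : (b * 'D_1 vth t) * ('D_JX h x * 'D_1 vth t) < 0 by rewrite pmulr_rlt0.
by rewrite mulrACA pmulr_llt0 // -expr2 exprn_even_gt0.
Qed.

End Side.

(** * The angle of the normal *)

Section Lift.
Variable R : realType.

Lemma antiderivative (om : R -> R) (a b : R) : a < b ->
  (forall t, a <= t <= b -> {for t, continuous om}) ->
  exists F : R -> R, forall t, a < t < b -> is_derive t 1 F (om t).
Proof.
move=> ab com; have ci : {within `[a, b], continuous om}.
  apply: continuous_in_subspaceT => t; rewrite inE /= in_itv /=; exact: com.
have int := continuous_compact_integrable (@segment_compact _ a b) ci.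
exists (fun x => (\int[lebesgue_measure]_(t in [set` `[a, x]]) (om t))%R) => t /andP[t1 t2].
have ct : {for t, continuous om} by apply: com; rewrite !ltW.
have [der E0] := continuous_FTC1_closed t2 int t1 ct.
exact: DeriveDef der (etrans (esym (derive1E _ _)) E0).
Qed.

Lemma smooth_antiderivative (F om : R -> R) (U : set R) : open U ->
  (forall t, U t -> is_derive t 1 F (om t)) -> smooth_on U om -> smooth_on U F.
Proof.
move=> oU dF som; have diffF t : U t -> differentiable F t.
  by move=> /dF[d _]; apply/derivable1_diffP.
case=> [t Ut|k]; first by apply: differentiable_continuous; exact: diffF.
apply/CkS; split=> // v; apply: (@Ck_ext _ _ _ _ _ (fun t => v *: om t)) => //.
  move=> t Ut; have -> : v = v *: (1 : R) by rewrite -[_ *: _]/(_ * _) mulr1.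
  by rewrite (deriveZ_dir _ _ (diffF t Ut)); have [_ ->] := dF t Ut;
    rewrite -[v *: 1]/(v * 1) mulr1.
exact: (@CkZ _ _ _ U k (fun=> v) om oU (Ck_cst _ _ _) (som k)).
Qed.

Lemma circle_angle (x y : R) : x ^+ 2 + y ^+ 2 = 1 ->
  exists th : R, cos th = x /\ sin th = y.
Proof.
move=> xy; have x1 : -1 <= x <= 1.
  by have := sqr_ge0 y; move=> y2; apply/andP; split; nra.
have ck : cos (acos x) = x by rewrite acosK // in_itv.
have sk : sin (acos x) = `|y|.
  by rewrite sin_acos // (_ : 1 - x ^+ 2 = y ^+ 2) ?sqrtr_sqr //; lra.
have [y0|y0] := leP 0 y; first by exists (acos x); rewrite ck sk ger0_norm.
by exists (- acos x); rewrite cosN sinN ck sk ltr0_norm // opprK.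
Qed.

Variables (na nb : R -> R) (r l : R).
Hypotheses (r0 : 0 < r) (l0 : 0 < l).
Hypothesis sa : forall t, - r < t < l + r -> smooth_at na t.
Hypothesis sb : forall t, - r < t < l + r -> smooth_at nb t.
Hypothesis unit : forall t, 0 <= t <= l -> na t ^+ 2 + nb t ^+ 2 = 1.

(** The angle is a primitive of the angular velocity; the distance of (na, nb)
    to (cos th, sin th) is constant. *)
Lemma angle_lift : exists2 th : R -> R, smooth_on [set t | - (r / 2) < t < l + r / 2] th &
  forall t, 0 <= t <= l -> cos (th t) = na t /\ sin (th t) = nb t.
Proof.
pose om t := na t * 'D_1 nb t - nb t * 'D_1 na t.
have som t : - r < t < l + r -> smooth_at om t.
  move=> tr; have A1 := sa tr; have B1 := sb tr.
  by apply: smooth_atB; apply: smooth_atM => //; exact: smooth_at_derive.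
have [F dF] : exists F : R -> R, forall t, - (r / 2) < t < l + r / 2 -> is_derive t 1 F (om t).
  apply: antiderivative; first by move: r0 l0; lra.
  move=> t /andP[t1 t2]; apply: smooth_at_cont; apply: som.
  by apply/andP; split; move: r0 t1 t2; lra.
have u0 : na 0 ^+ 2 + nb 0 ^+ 2 = 1 by apply: unit; rewrite lexx ltW.
have [th0 [c0 s0]] := circle_angle u0.
pose th t := F t + (th0 - F 0).
have dth t : - (r / 2) < t < l + r / 2 -> is_derive t 1 th (om t).
  move=> tr; have := is_deriveD (dF t tr) (is_derive_cst (th0 - F 0) t (1 : R)).
  by rewrite addr0.
have oU : open [set t : R | - (r / 2) < t < l + r / 2].
  exact: (@interval_open R (BRight (- (r / 2))) (BLeft (l + r / 2))).
exists th.
  apply: smooth_antiderivative oU dth _; apply: smooth_at_on => t /andP[t1 t2].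
  by apply: som; apply/andP; split; move: r0 t1 t2; lra.
have big t : 0 <= t <= l -> - (r / 2) < t < l + r / 2.
  by move=> /andP[t1 t2]; apply/andP; split; move: r0 t1 t2; lra.
have bigr t : 0 <= t <= l -> - r < t < l + r.
  by move=> /andP[t1 t2]; apply/andP; split; move: r0 t1 t2; lra.
pose p t := na t * cos (th t) + nb t * sin (th t).
have dp t : 0 <= t <= l -> is_derive t 1 p 0.
  move=> tl; have da := smooth_at_diff (sa (bigr t tl)).
  have db := smooth_at_diff (sb (bigr t tl)).
  have [dt1 dt2] := dth t (big t tl).
  have dt : differentiable th t by apply/derivable1_diffP.
  have dcos : differentiable (fun r => cos (th r)) t.
    exact: (differentiable_comp dt (differentiable_cos _)).
  have dsin : differentiable (fun r => sin (th r)) t.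
    exact: (differentiable_comp dt (differentiable_sin _)).
  have dac : differentiable (fun r => na r * cos (th r)) t by exact: (differentiable_scale da dcos).
  have dbs : differentiable (fun r => nb r * sin (th r)) t by exact: (differentiable_scale db dsin).
  apply: DeriveDef; first by apply: diff_derivable; exact: differentiableD.
  have e1 : 'D_1 p t = 'D_1 (fun r => na r * cos (th r)) t + 'D_1 (fun r => nb r * sin (th r)) t.
    by apply: deriveD; exact: diff_derivable.
  rewrite e1 (derive_mul _ da dcos) (derive_mul _ db dsin) (derive_cos_comp dt) (derive_sin_comp dt) dt2.
  have un := unit tl.
  have dun : na t * 'D_1 na t + nb t * 'D_1 nb t = 0.
    have daa : differentiable (fun r => na r * na r) t by exact: (differentiable_scale da da).
    have dbb : differentiable (fun r => nb r * nb r) t by exact: (differentiable_scale db db).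
    have e2 : 'D_1 (fun r => na r * na r + nb r * nb r) t = 0.
      rewrite -(derive_cst (1 : R) t (1 : R)).
      apply: (derive_eq_on_segment l0 tl) => [s sl||]; last exact: differentiable_cst.
        by rewrite -!expr2 unit.
      exact: differentiableD.
    have e3 : 'D_1 (fun r => na r * na r + nb r * nb r) t =
        'D_1 (fun r => na r * na r) t + 'D_1 (fun r => nb r * nb r) t.
      by apply: deriveD; exact: diff_derivable.
    move: e2; rewrite e3 (derive_mul _ da da) (derive_mul _ db db).
    move: ('D_1 na t) ('D_1 nb t) (na t) (nb t) => A B x y; lra.
  rewrite /om; move: ('D_1 na t) ('D_1 nb t) (na t) (nb t) un dun (cos _) (sin _) => A B x y.
  move=> un dun c s.
  have AE : A = - y * (x * B - y * A).
    apply/eqP; rewrite -subr_eq0; apply/eqP.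
    rewrite (_ : _ - _ = A * (1 - (x ^+ 2 + y ^+ 2)) + x * (x * A + y * B)); last by ring.
    by rewrite un dun subrr !mulr0 addr0.
  have BE : B = x * (x * B - y * A).
    apply/eqP; rewrite -subr_eq0; apply/eqP.
    rewrite (_ : _ - _ = B * (1 - (x ^+ 2 + y ^+ 2)) + y * (x * A + y * B)); last by ring.
    by rewrite un dun subrr !mulr0 addr0.
  by move: (x * B - y * A) AE BE => w -> ->; ring.
have p0 : p 0 = 1.
  have th00 : th 0 = th0 by rewrite /th addrC subrK.
  by rewrite /p th00 c0 s0 -!expr2.
have p1 t : 0 <= t <= l -> p t = 1.
  move=> /andP[t0 tl]; move: t0; rewrite le_eqVlt => /orP[/eqP <- //|t0].
  have line s : 0 <= s <= t -> differentiable p (0 + s *: (1 : R)).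
    move=> /andP[s1 s2]; rewrite add0r -[s *: (1 : R)]/(s * 1) mulr1.
    have [d1 _] : is_derive s 1 p 0 by apply: dp; rewrite s1 (le_trans s2 tl).
    exact/derivable1_diffP.
  have [s /andP[s1 s2]] := MVT_line t0 line.
  rewrite !add0r -![_ *: (1 : R)]/(_ * 1) !mulr1 p0.
  have [_ ->] : is_derive s 1 p 0 by apply: dp; rewrite ltW //= (le_trans (ltW s2) tl).
  by rewrite mul0r; lra.
move=> t tl; have := p1 t tl; have := unit tl; have := cos2Dsin2 (th t); rewrite /p.
move: (cos _) (sin _) (na t) (nb t) => c s x y e1 e2 e3.
have : (c - x) ^+ 2 + (s - y) ^+ 2 = 0.
  by rewrite !sqrrB; move: e1 e2 e3; rewrite (mulrC x c) (mulrC y s) !mulr2n; lra.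
move/eqP; rewrite paddr_eq0 ?sqr_ge0 // !sqrf_eq0 !subr_eq0.
by move=> /andP[/eqP -> /eqP ->].
Qed.

End Lift.

Lemma sum2E (V : nmodType) (F : 'I_2 -> V) : \sum_i F i = F 0 + F 1.
Proof. by rewrite !big_ord_recl big_ord0 addr0; congr (_ + F _); exact: val_inj. Qed.

Lemma vol_wedge (R : realType) (G : 'M[R]_3) (w a b : 'rV[R]_3) (u v : 'rV[R]_2) :
  inner_product G ->
  vol G w (u 0 0 *: a + u 0 1 *: b) (v 0 0 *: a + v 0 1 *: b) = wedge u v * vol G w a b.
Proof.
move=> pG; rewrite !(volDm pG, volDr pG, volZm pG, volZr pG) !vol_diagr (vol_swapr _ _ a b) /wedge.
ring.
Qed.

Section ChangeOfChart.
Variables (R : realType) (S : riemannian R 2) (kappa tau : R) (E : Ekt kappa tau).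
Variables (phi : S -> E) (d : chart R 3 E).
Hypotheses (orS : oriented S) (iso : isometric_immersion phi) (ad : atlas d).

Lemma det_jacobian (f : 'rV[R]_2 -> 'rV[R]_2) x : differentiable f x ->
  \det ('J f x) = wedge ('D_(basis_vec R 0) f x) ('D_(basis_vec R 1) f x).
Proof.
move=> df; by rewrite det_mx22 /wedge /jacobian !mxE !deriveE.
Qed.

(** Changes of charts of the surface preserve the orientation. *)
Lemma unit_normal_chart c1 c2 p : atlas c1 -> atlas c2 -> cdom c1 p -> cdom c2 p ->
  cdom d (phi p) ->
  unit_normal (gram d) (lrep c1 d phi) (c1 p) = unit_normal (gram d) (lrep c2 d phi) (c2 p).
Proof.
move=> a1 a2 c1p c2p dp.
have [sf1 mg1 /nbhs_singleton[pG1 pos1]] := immersion_at_lrep iso a1 ad c1p dp.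
have [sf2 mg2 /nbhs_singleton[pG2 pos2]] := immersion_at_lrep iso a2 ad c2p dp.
have df1 := smooth_at_diff sf1; have df2 := smooth_at_diff sf2.
have e1 : lrep c1 d phi (c1 p) = d (phi p) by exact: lrepE.
have e2 : lrep c2 d phi (c2 p) = d (phi p) by exact: lrepE.
have dt := smooth_at_diff (smooth_at_transition a2 a1 c2p c1p).
have te : lrep c2 c1 id (c2 p) = c1 p by exact: lrepE.
have pushE v : push (lrep c2 d phi) (c2 p) v =
    push (lrep c1 d phi) (c1 p) ('D_v (lrep c2 c1 id) (c2 p)).
  rewrite /push -te -(derive_comp v dt); last by rewrite te.
  by apply/esym/near_eq_derive; exact: (lrep_comp d phi (fun A B => B : nbhs (id p) A) c2p c1p).
have det0 := orS a2 a1 c2p c1p; rewrite (det_jacobian dt) in det0.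
apply: (unit_normalE df2 pG2 pos2).
- by rewrite e2 -e1; exact: unit_normal_unit.
- by move=> v; rewrite e2 -e1 pushE; exact: unit_normal_push.
have vp := vol_push_gt0 df1 pG1 pos1.
rewrite e2 -e1 !pushE.
move: ('D_(basis_vec R 0) _ _) ('D_(basis_vec R 1) _ _) det0 => u v uv.
rewrite (push_sum df1 u) (push_sum df1 v) !sum2E (vol_wedge _ _ _ _ _ pG1).
exact: mulr_gt0.
Qed.

End ChangeOfChart.

Lemma horizontal_decomp (R : realType) (G : 'M[R]_3) (a b c w : 'rV[R]_3) : inner_product G ->
  [/\ inner G a a = 1, inner G b b = 1 & inner G c c = 1] ->
  [/\ inner G a b = 0, inner G a c = 0, inner G b c = 0 & 0 < det3 a b c] ->
  inner G w c = 0 -> w = inner G w a *: a + inner G w b *: b.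
Proof.
move=> pG [aa bb cc] [ab ac bc d0] wc; have d1 : det3 a b c != 0 by rewrite gt_eqF.
apply/eqP; rewrite -subr_eq0; apply/eqP; apply: (det3_zero pG d1).
- by rewrite innerBr innerDr !innerZr aa ab (inner_sym w a pG); ring.
- by rewrite innerBr innerDr !innerZr bb (inner_sym b a pG) ab (inner_sym w b pG); ring.
- rewrite innerBr innerDr !innerZr (inner_sym c a pG) (inner_sym c b pG) ac bc.
  by rewrite (inner_sym c w pG) wc; ring.
Qed.

Section Existence.
Variables (R : realType) (kappa tau H kappa' tau' theta l : R).
Variables (E' : Ekt kappa' tau') (E : Ekt kappa tau) (S : riemannian R 2).
Variables (phi' : S -> E') (phi : S -> E) (gam : R -> S) (d0 : chart R 3 E').
Hypothesis sis : sister_immersions theta 0 H phi' phi.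
Hypothesis vert : vertical_segment phi' gam l.
Hypothesis cart : cartan_chart d0.
Hypothesis dom0 : forall t : R, 0 <= t <= l -> cdom d0 (phi' (gam t)).
Local Notation q := (fun t : R => d0 (phi' (gam t))).

Let ad0 : atlas d0. Proof. by case: cart. Qed.
Let iso' : isometric_immersion phi'. Proof. by case: sis => _ _ []. Qed.
Let orS : oriented S. Proof. by case: sis => [[]]. Qed.
Let l0 : 0 < l. Proof. by case: vert. Qed.

(** The chart d0 covers the curve slightly beyond the segment, since it is open;
    this leaves an open interval on which the angle is smooth. *)
Lemma domain_margin : exists2 r : R, 0 < r & [/\ smooth_curve [set t | - r < t < l + r] gam &
  forall t, - r < t < l + r -> cdom d0 (phi' (gam t))].
Proof.
have [_ [r0 r00 [cg sg]] _] := vert; have [cphi _] : smooth_map phi' by case: iso'.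
have cpg t : 0 <= t <= l -> {for t, continuous (fun r => phi' (gam r))}.
  move=> tl; have cgt := curve_continuous vert tl.
  exact: (continuous_comp cgt (cphi _)).
have h0 : 0 <= (0 : R) <= l by rewrite lexx ltW.
have hl : 0 <= l <= l by rewrite lexx andbT ltW.
have /nbhs_ballP[e1 /= e10 b1] := near_curve (cpg 0 h0) (dom0 h0).
have /nbhs_ballP[e2 /= e20 b2] := near_curve (cpg l hl) (dom0 hl).
pose r := Num.min r0 (Num.min e1 e2).
have rr0 : r <= r0 by rewrite ge_min lexx.
have re1 : r <= e1 by rewrite !ge_min lexx !orbT.
have re2 : r <= e2 by rewrite !ge_min lexx !orbT.
have sub : [set t | - r < t < l + r] `<=` [set t | - r0 < t < l + r0].
  by move=> t /= /andP[t1 t2]; apply/andP; split; move: rr0 t1 t2; lra.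
exists r; first by rewrite !lt_min r00 e10.
split; first split.
- by move=> t /sub; exact: cg.
- move=> c ac k; apply: Ck_sub (sg c ac k) => t [/sub ? ?]; by split.
move=> t /andP[t1 t2]; have [tn|tp] := ltP t 0.
  by apply: b1; rewrite /ball /= sub0r normrN ltr0_norm //; move: re1 t1; lra.
have [tl|tl] := leP t l; first by apply: dom0; rewrite tp.
by apply: b2; rewrite /ball /= ltr0_norm ?subr_lt0 //; move: re2 t2; lra.
Qed.

(** The unit normals in the charts of the surface agree, so they form a smooth
    field along the curve; on [0, l] this field is horizontal. *)
Lemma normal_angle_exists : exists vth : R -> R, normal_angle phi' d0 gam l vth.
Proof.
have [r r0 [sg dom]] := domain_margin.
pose ct t := s2val (cid2 (atlas_cover (gam t))).
have act t : atlas (ct t) by exact: s2valP (cid2 (atlas_cover (gam t))).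
have cct t : cdom (ct t) (gam t) by exact: s2valP' (cid2 (atlas_cover (gam t))).
pose N t := unit_normal (gram d0) (lrep (ct t) d0 phi') (ct t (gam t)).
have NE c t : atlas c -> cdom c (gam t) -> - r < t < l + r ->
    N t = unit_normal (gram d0) (lrep c d0 phi') (c (gam t)).
  by move=> ac cg tr; apply: unit_normal_chart => //; exact: dom.
have oI : open [set t : R | - r < t < l + r].
  exact: (@interval_open R (BRight (- r)) (BLeft (l + r))).
have cg t : - r < t < l + r -> {for t, continuous gam} by case: sg => cg _; exact: cg.
have imm t : - r < t < l + r ->
    immersion_at (gram d0) (lrep (ct t) d0 phi') (ct t (gam t)).
  by move=> tr; apply: immersion_at_lrep => //; exact: dom.
have sct t : - r < t < l + r -> smooth_at (fun s => ct t (gam s)) t.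
  by move=> tr; apply: smooth_at_curve oI sg tr _ _.
have sN t : - r < t < l + r -> smooth_at N t.
  move=> tr; apply: (@smooth_at_near _ _ _
     (fun s => unit_normal (gram d0) (lrep (ct t) d0 phi') (ct t (gam s)))).
    have nI : nbhs t [set t : R | - r < t < l + r] by exact: open_nbhs_nbhs.
    apply: filterS2 nI (near_curve (cg t tr) (cct t)) => s sr cs.
    by rewrite (NE _ _ (act t) cs sr).
  exact: (smooth_at_comp (sct t tr) (smooth_at_unit_normal (imm t tr))).
have sq t : - r < t < l + r -> smooth_at q t.
  move=> tr; have [sf _ _] := imm t tr.
  apply: smooth_at_near (lrep_curve d0 phi' (cg t tr) (cct t)) _.
  exact: (smooth_at_comp (sct t tr) sf).
have sgq t : - r < t < l + r -> smooth_at (fun s => gram d0 (q s)) t.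
  move=> tr; apply: (smooth_at_comp (f := gram d0) (sq t tr)).
  by apply: smooth_at_gram => //; exact: dom.
pose na t := inner (gram d0 (q t)) (N t) (E1 kappa' tau' (q t)).
pose nb t := inner (gram d0 (q t)) (N t) (E2 kappa' tau' (q t)).
have sa t : - r < t < l + r -> smooth_at na t.
  move=> tr; apply: smooth_at_inner; [exact: sgq | exact: sN |].
  exact: (smooth_at_comp (sq t tr) (smooth_E1 _ _ _)).
have sb t : - r < t < l + r -> smooth_at nb t.
  move=> tr; apply: smooth_at_inner; [exact: sgq | exact: sN |].
  exact: (smooth_at_comp (sq t tr) (smooth_E2 _ _ _)).
have big t : 0 <= t <= l -> - r < t < l + r.
  by move=> /andP[t1 t2]; apply/andP; split; move: r0 t1 t2; lra.
have dec t : 0 <= t <= l -> N t = na t *: E1 kappa' tau' (q t) + nb t *: E2 kappa' tau' (q t)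
    /\ na t ^+ 2 + nb t ^+ 2 = 1.
  move=> tl; have tr := big t tl; have dt := dom0 tl.
  have [lam gE xE] := proj2 cart _ dt.
  have [sf _ /nbhs_singleton[pG pos]] := imm t tr.
  have fx : lrep (ct t) d0 phi' (ct t (gam t)) = q t by exact: lrepE.
  have NN := unit_normal_unit (smooth_at_diff sf) pG pos.
  rewrite fx in pG; rewrite -/(N t) fx in NN.
  have N3 : inner (gram d0 (q t)) (N t) (E3 R) = 0.
    have := angle_zero' sis vert cart dom0 (act t) tl (cct t).
    by rewrite /angle -/(N t) fx xE.
  have [fr1 fr2] := @cartan_frame R kappa' tau' _ lam; rewrite -gE in fr1 fr2.
  have D0 := horizontal_decomp pG fr1 fr2 N3; split; first exact: D0.
  move: fr1 fr2 NN D0 => [aa bb _] [ab _ _ _] NN; rewrite -/(na t) -/(nb t) => D0.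
  rewrite D0 in NN; move: NN; move: (na t) (nb t) => x y.
  rewrite innerDl !innerDr !innerZl !innerZr aa bb ab (inner_sym _ _ pG) ab => <-; ring.
have [th sth thE] := angle_lift r0 l0 sa sb (fun t tl => proj2 (dec t tl)).
exists th; split; first by exists (r / 2); rewrite ?divr_gt0.
move=> c t ac tl cgt /=; rewrite -(NE c t ac cgt (big t tl)).
by have [-> ->] := thE t tl; exact: (proj1 (dec t tl)).
Qed.

End Existence.

Unset Implicit Arguments.
Set Strict Implicit.
Set Printing Implicit Defensive.

Theorem lemma5p1 (R : realType) (kappa tau H kappa' tau' theta l : R)
  (E' : Ekt kappa' tau') (E : Ekt kappa tau) (S : riemannian R 2)
  (phi' : S -> E') (phi : S -> E) (gam : R -> S) (d0 : chart R 3 E') :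
  0 <= theta < pi ->
  sister_immersions theta 0 H phi' phi ->
  vertical_segment phi' gam l ->
  cartan_chart d0 ->
  (forall t : R, 0 <= t <= l -> cdom d0 (phi' (gam t))) ->
  (exists vth : R -> R, normal_angle phi' d0 gam l vth) /\
  (forall vth : R -> R, normal_angle phi' d0 gam l vth ->
   [/\ (* (a) *)
       forall (d : chart R 3 E) (t : R), atlas d -> 0 <= t <= l ->
         cdom d (phi (gam t)) ->
         inner (gram d (d (phi (gam t)))) (velocity d (phi \o gam) t)
               (xi d (d (phi (gam t)))) = cos theta,
       (* (b) *)
       0 < theta ->
       forall (c : chart R 2 S) (d : chart R 3 E)
         (e : chart R 2 (base_space E)) (t : R),
         atlas c -> atlas d -> atlas e -> 0 <= t <= l ->
         cdom c (gam t) -> cdom d (phi (gam t)) ->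
         cdom e (bundle_proj (phi (gam t))) ->
         has_geodesic_curvature (gram e)
           (fun r => e (bundle_proj (phi (gam r)))) t
           (proj_normal phi c d e (gam t))
           (2 * H - derive1 vth t / sin theta) &
       (* (c) *)
       forall D : set S, region_along D gam l ->
         positive_angle_on phi D ->
         ((forall t : R, 0 <= t <= l -> 0 < derive1 vth t) ->
          forall (c : chart R 2 S) (d' : chart R 3 E') (d : chart R 3 E)
            (e : chart R 2 (base_space E)) (t : R),
            atlas c -> atlas d' -> atlas d -> atlas e -> 0 < t < l ->
            cdom c (gam t) -> cdom d' (phi' (gam t)) ->
            cdom d (phi (gam t)) -> cdom e (bundle_proj (phi (gam t))) ->
            [/\ outer_conormal D c gam t
                  (rotJ (gram d') (lrep c d' phi') (c (gam t))
                     (velocity c gam t)),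
                outer_conormal D c gam t
                  (rotJ (gram d) (lrep c d phi) (c (gam t))
                     (velocity c gam t)),
                0 < theta -> points_inside_proj phi D (gam t) e
                  (proj_normal phi c d e (gam t)) &
                0 < theta -> approaches_from_below phi D c d gam t]) /\
         ((forall t : R, 0 <= t <= l -> derive1 vth t < 0) ->
          forall (c : chart R 2 S) (d' : chart R 3 E') (d : chart R 3 E)
            (e : chart R 2 (base_space E)) (t : R),
            atlas c -> atlas d' -> atlas d -> atlas e -> 0 < t < l ->
            cdom c (gam t) -> cdom d' (phi' (gam t)) ->
            cdom d (phi (gam t)) -> cdom e (bundle_proj (phi (gam t))) ->
            [/\ inner_conormal D c gam t
                  (rotJ (gram d') (lrep c d' phi') (c (gam t))
                     (velocity c gam t)),
                inner_conormal D c gam t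
                  (rotJ (gram d) (lrep c d phi) (c (gam t))
                     (velocity c gam t)),
                0 < theta -> points_outside_proj phi D (gam t) e
                  (proj_normal phi c d e (gam t)) &
                0 < theta -> approaches_from_above phi D c d gam t])]).
Proof.
move=> /andP[th0 thpi] sis vert cart dom0.
split; first exact: (normal_angle_exists sis vert cart dom0).
move=> vth ang.
have ith t : 0 < t < l -> 0 <= t <= l by case/andP=> t1 t2; rewrite !ltW.
have iphi : isometric_immersion phi by case: sis => _ _ _ [].
split.
- move=> d t ad tl dp; have [c ac cp] := atlas_cover (gam t).
  have ds := smooth_at_diff (curve_smooth vert ac tl cp).
  rewrite /velocity derive1E.
  have E0 := derive_curve (proj1 iphi) ac ad cp dp (curve_continuous vert tl) ds.
  apply: etrans (push_X_xi sis vert cart dom0 ac ad tl cp dp).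
  exact: (congr1 (fun u => inner (gram d (d (phi (gam t)))) u (xi d (d (phi (gam t))))) E0).
- move=> tpos c d e t ac ad ae tl cp dp ep; rewrite derive1E.
  by apply: (geodesic_curvature_proj sis vert cart dom0 ac ad tl cp dp ang ae ep); rewrite tpos.
move=> D regD posD.
have VE (c : chart R 2 S) t : velocity c gam t = 'D_1 (fun r => c (gam r)) t.
  by rewrite /velocity derive1E.
have JE c d' d t : atlas c -> atlas d' -> atlas d -> cdom c (gam t) ->
    cdom d' (phi' (gam t)) -> cdom d (phi (gam t)) -> forall v,
    rotJ (gram d') (lrep c d' phi') (c (gam t)) v = rotJ (gram d) (lrep c d phi) (c (gam t)) v.
  move=> ac ad' ad cp dp' dp v; have [_ _ _ _ data] := sis.
  by have [_ _ -> _] := data c d' d _ ac ad' ad cp dp' dp.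
have conormal c d t : atlas c -> atlas d -> 0 <= t <= l -> cdom c (gam t) ->
    cdom d (phi (gam t)) -> unit_conormal c gam t
      (rotJ (gram d) (lrep c d phi) (c (gam t)) ('D_1 (fun r => c (gam r)) t)).
  move=> ac ad tl cp dp; split; first exact: (conormal_unit sis vert cart dom0 ac ad tl cp dp).
  by rewrite VE; exact: (conormal_orth sis ac ad cp dp).
split=> sgn c d' d e t ac ad' ad ae tl' cp dp' dp ep; have tl := ith t tl';
  have sv := sgn t tl; rewrite derive1E in sv; rewrite VE (JE c d' d t ac ad' ad cp dp' dp).
  have inside : points_outside D (gam t) c
      (rotJ (gram d) (lrep c d phi) (c (gam t)) ('D_1 (fun r => c (gam r)) t)).
    rewrite /points_outside -scaleN1r.
    apply: (side_inside sis vert cart dom0 ang regD posD ac ad tl' cp dp).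
    by rewrite mulN1r oppr_lt0.
  have outer := conj (conormal c d t ac ad tl cp dp) inside.
  split=> // tpos; have thr : 0 < theta < pi by rewrite tpos.
    rewrite -[proj_normal _ _ _ _ _]scale1r.
    apply: (side_projection sis vert cart dom0 ang regD posD ac ad tl' cp dp ae ep thr).
      by rewrite expr1n.
    by rewrite mul1r.
  move=> v vX eD; rewrite VE in vX.
  have := side_enters sis vert cart dom0 ang regD posD ac ad tl' cp dp thr _ vX eD.
  by rewrite gt_eqF // => /(_ isT); rewrite pmulr_llt0.
have inside : points_inside D (gam t) c
    (rotJ (gram d) (lrep c d phi) (c (gam t)) ('D_1 (fun r => c (gam r)) t)).
  rewrite -[rotJ _ _ _ _]scale1r.
  apply: (side_inside sis vert cart dom0 ang regD posD ac ad tl' cp dp).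
  by rewrite mul1r.
have inner := conj (conormal c d t ac ad tl cp dp) inside.
split=> // tpos; have thr : 0 < theta < pi by rewrite tpos.
  have out : points_inside_proj phi D (gam t) e (- proj_normal phi c d e (gam t)).
    rewrite -scaleN1r.
    apply: (side_projection sis vert cart dom0 ang regD posD ac ad tl' cp dp ae ep thr).
      by rewrite sqrrN expr1n.
    by rewrite mulN1r oppr_gt0.
  exact: out.
move=> v vX eD; rewrite VE in vX.
have := side_enters sis vert cart dom0 ang regD posD ac ad tl' cp dp thr _ vX eD.
by rewrite lt_eqF // => /(_ isT); rewrite nmulr_llt0.
Qed.
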